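(* Let $m,n$ be coprime positive integers, and let $\mathfrak h_i,\hat{\mathfrak h}_i,\bar{\mathfrak h}_i$ ($i\in\mathbb{Z}$) be the operators associated with chains of cyclic $(m,n)$-parking functions defined in the context. Then for all integers $a,b$: $$\mathfrak h_a\mathfrak h_b=\mathfrak h_b\mathfrak h_a,\qquad \hat{\mathfrak h}_a\hat{\mathfrak h}_b=\hat{\mathfrak h}_b\hat{\mathfrak h}_a,\qquad \bar{\mathfrak h}_a\bar{\mathfrak h}_b=\bar{\mathfrak h}_b\bar{\mathfrak h}_a,$$ $$q\left(\hat{\mathfrak h}_b\bar{\mathfrak h}_a-\hat{\mathfrak h}_{a-1}\bar{\mathfrak h}_{b+1}\right)=\bar{\mathfrak h}_a\hat{\mathfrak h}_b-\bar{\mathfrak h}_{b+1}\hat{\mathfrak h}_{a-1}.$$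
   Context: **Cyclic parking functions.** Lattice paths use unit north steps $(0,1)$ and east steps $(1,0)$. An $(m,n)$-lattice path starts at $(-a,0)$ for some integer $a\ge0$, begins with a north step, has exactly $n$ north steps, and stays weakly above the line $my=nx$. A cyclic $(m,n)$-parking function $\pi=(P_\pi,f_\pi)$ is an $(m,n)$-lattice path with exactly $m$ east steps, together with a function $f_\pi$ assigning a positive integer to each north step, such that labels strictly increase along consecutive (vertically adjacent) north steps and, if the path ends with a north step $N'$, then the first step $N$ satisfies $f_\pi(N)>f_\pi(N')$. $\mathrm{cPF}_{m,n}$ is the set of these; $\mathrm{cPF}^k_{m,n}$ is the set of $k$-tuples, the $i$-th entry being regarded as lying in the $i$-th of $k$ copies (sheets) of $\mathbb{Z}^2$. **Statistics of a $k$-tuple $\pi^\bullet$.** A cell in sheet $i$ with south-east corner $(x,y)$ has content $k(my-nx)+i-1$; the content of a north step is that of the cell immediately to its left, that of an east step is that of the cell immediately below it. $\mathrm{pdinv}$ is the number of pairs (north step $N$, east step $E$) with $\mathrm{cont}(N)<\mathrm{cont}(E)$; $\mathrm{ldinv}$ is the number of pairs $(N,N')$ of north steps with $\mathrm{cont}(N)<\mathrm{cont}(N')<\mathrm{cont}(N)+km$ and label of $N$ $\ge$ label of $N'$; $\mathrm{stat}=\frac{(mk-1)(nk-1)+k-1}{2}-\mathrm{pdinv}-\mathrm{ldinv}$ (and $\mathrm{stat}=0$ for the empty tuple). If the $y$-th north step of $P$ starts at $(x_y,y-1)$, the area sequence is $\mathrm{aseq}(P)_y=\lfloor m(y-1)/n\rfloor-x_y$.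 With indeterminates $z_{i,j,l}$ ($1\le i\le n$, $j\ge0$, $l\ge1$), the skeleton of $\pi$ is $z(\pi)=\prod_{i=1}^n z_{i,\mathrm{aseq}(P_\pi)_i,f_\pi(N_i)}$, $N_i$ being the $i$-th north step; the skeleton of a tuple is the product of the skeletons of its entries. **Order.** $\pi\prec\pi'$ means: $P_{\pi'}$ lies weakly to the left of $P_\pi$, the paths share no east step, and at every common vertex $v$, the north step $N$ of $P_\pi$ ending at $v$ and the north step $N'$ of $P_{\pi'}$ starting at $v$ satisfy $f_\pi(N)\ge f_{\pi'}(N')$ (if $v$ is on $y=n$, $N'$ is the $(m,n)$-translate of the first step of $\pi'$; a common starting point on $y=0$ is accounted for by its $(m,n)$-translate on $y=n$). **Chains and operators.** For $a\ge1$, $\mathbf H_a$ is the set of $(\pi^{(1)},\dots,\pi^{(a)})\in\mathrm{cPF}_{m,n}^a$ with $\pi^{(i)}\prec\pi^{(i+1)}$ for $1\le i<a$; $\bar{\mathbf H}_a$ is the subset where $P_{\pi^{(1)}}$ passes through the origin, and $\hat{\mathbf H}_a=\mathbf H_a\setminus\bar{\mathbf H}_a$. Let $V_r$ be the space of (possibly infinite) formal $\mathbb{C}(q,t)$-linear combinations of the monomials $z(\tau^\bullet)$, $\tau^\bullet\in\mathrm{cPF}^r_{m,n}$ ($V_0$ spanned by $1$), and $V=\bigoplus_{r\ge0}V_r$. For $a\ge1$ the operator $\mathfrak h_a:V_r\to V_{r+a}$ is $$\mathfrak h_a\cdot z(\tau^\bullet)=\sum_{\pi^\bullet\in\mathbf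 H_a}q^{\mathrm{stat}(\tau^\bullet,\pi^\bullet)-\mathrm{stat}(\tau^\bullet)}z(\tau^\bullet,\pi^\bullet),$$ where $(\tau^\bullet,\pi^\bullet)$ is the concatenated tuple and each stat is computed with the number of sheets equal to the length of the tuple; this depends only on $z(\tau^\bullet)$ and is extended linearly, also to infinite combinations. $\hat{\mathfrak h}_a,\bar{\mathfrak h}_a$ are defined the same way with $\hat{\mathbf H}_a,\bar{\mathbf H}_a$ in place of $\mathbf H_a$. Also $\mathfrak h_0=\hat{\mathfrak h}_0=1$, $\bar{\mathfrak h}_0=0$, and $\mathfrak h_a=\hat{\mathfrak h}_a=\bar{\mathfrak h}_a=0$ for $a<0$. Products are compositions of operators (rightmost applied first). *)

(* Defs.v *)
From HB Require Import structures.
From mathcomp Require Import all_boot all_order all_algebra finmap.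
From mathcomp Require Import boolp classical_sets functions fsbigop cardinality.
From mathcomp Require Import reals complex.
From mathcomp Require Import monalg.

Set Implicit Arguments.
Unset Strict Implicit.
Unset Printing Implicit Defensive.

Import Order.TTheory GRing.Theory Num.Theory.

Local Open Scope classical_set_scope.
Local Open Scope ring_scope.

Definition point2 : Type := int * int.

(* A lattice path starting on y = 0, at (- a, 0), is the pair (a, w) of the
   natural number a and of its word w of steps: true is the north step (0, 1)
   and false is the east step (1, 0). *)
Definition lpath : Type := nat * seq bool.

Definition step_end (p : point2) (d : bool) : point2 :=
  if d then (p.1, p.2 + 1) else (p.1 + 1, p.2).

(* The steps of the word w read from the point p, each given by its starting
   point and its direction. *)
Fixpoint walk (p : point2) (w : seq bool) : seq (point2 * bool) :=
  if w is d :: w' then (p, d) :: walk (step_end p d) w' else [::].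

Definition origin : point2 := (0, 0).

Definition path_start (P : lpath) : point2 := (- P.1%:Z, 0).

Definition path_steps (P : lpath) : seq (point2 * bool) :=
  walk (path_start P) P.2.

Definition vertices (P : lpath) : seq point2 :=
  path_start P :: [seq step_end s.1 s.2 | s <- path_steps P].

(* The starting points of the north (resp. east) steps, in path order. *)
Definition norths (P : lpath) : seq point2 :=
  [seq s.1 | s <- path_steps P & s.2].
Definition easts (P : lpath) : seq point2 :=
  [seq s.1 | s <- path_steps P & ~~ s.2].

Definition is_lattice_path (m n : nat) (P : lpath) : bool :=
  [&& head false P.2, count_mem true P.2 == n
    & all (fun v : point2 => n%:Z * v.1 <= m%:Z * v.2) (vertices P)].

(* Labels are listed in the order of the north steps.  Two north steps are
   vertically adjacent when one ends where the other one starts. *)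
Definition is_cpf (m n : nat) (u : lpath * seq nat) : bool :=
  let N := zip (norths u.1) u.2 in
  [&& is_lattice_path m n u.1, count_mem false u.1.2 == m,
      size u.2 == n, all (fun l => 0 < l)%N u.2,
      all (fun p : (point2 * nat) * (point2 * nat) =>
             (step_end p.1.1 true == p.2.1) ==> (p.1.2 < p.2.2)%N)
          [seq (s, s') | s <- N, s' <- N]
    & last false u.1.2 ==> (last 0%N u.2 < head 0%N u.2)%N].

Record cPF (m n : nat) := CPF {
  cpf_val : lpath * seq nat;
  cpf_valP : is_cpf m n cpf_val }.

HB.instance Definition _ m n := [isSub for @cpf_val m n].
HB.instance Definition _ m n := [Countable of cPF m n by <:].

Section ParkingFunctions.
Variables m n : nat.
Local Notation cPF := (cPF m n).
Implicit Types (pi : cPF) (tau : seq cPF).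

Definition cpath pi : lpath := (cpf_val pi).1.
Definition labels pi : seq nat := (cpf_val pi).2.

(* North steps (starting point, label), in path order. *)
Definition lnorths pi : seq (point2 * nat) := zip (norths (cpath pi)) (labels pi).

(* The entry of index i (counted from 0) of a tuple of length k lies in sheet
   i + 1.  The cell to the left of a north step starting at (x, y) has
   south-east corner (x, y); the cell below an east step starting at (x, y) has
   south-east corner (x + 1, y - 1). *)
Definition content (k i : nat) (v : point2) : int :=
  k%:Z * (m%:Z * v.2 - n%:Z * v.1) + i%:Z.
Definition ncontent (k i : nat) (v : point2) : int := content k i v.
Definition econtent (k i : nat) (v : point2) : int :=
  content k i (v.1 + 1, v.2 - 1).

Definition sheets tau : seq (nat * cPF) := zip (iota 0 (size tau)) tau.

(* All north steps of a tuple, as pairs (content, label). *)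
Definition tuple_norths tau : seq (int * nat) :=
  [seq (ncontent (size tau) s.1 N.1, N.2) | s <- sheets tau, N <- lnorths s.2].

(* The contents of all east steps of a tuple. *)
Definition tuple_easts tau : seq int :=
  [seq econtent (size tau) s.1 E | s <- sheets tau, E <- easts (cpath s.2)].

Definition pdinv tau : nat :=
  count (fun p : (int * nat) * int => p.1.1 < p.2)
        [seq (N, E) | N <- tuple_norths tau, E <- tuple_easts tau].

Definition ldinv tau : nat :=
  count (fun p : (int * nat) * (int * nat) =>
           [&& p.1.1 < p.2.1, p.2.1 < p.1.1 + (size tau * m)%N%:Z
             & (p.2.2 <= p.1.2)%N])
        [seq (N, N') | N <- tuple_norths tau, N' <- tuple_norths tau].

(* For coprime m and n the numerator is even, so that the division is exact. *)
Definition stat tau : int :=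
  let k := size tau in
  if k == 0%N then 0 else
  (((m%:Z * k%:Z - 1) * (n%:Z * k%:Z - 1) + k%:Z - 1) %/ 2)%Z
  - (pdinv tau)%:Z - (ldinv tau)%:Z.

(* Monomials in the z_{i,j,l}; only the indices with 1 <= i <= n and 1 <= l
   are used. *)
Definition mon : Type := {cmonom (nat * nat * nat)%type}.

(* The y-th entry of the area sequence, 1 <= y <= n.  The difference is never
   negative, since the path stays weakly above the line, so that taking its
   absolute value only changes its type. *)
Definition aseq (P : lpath) (y : nat) : nat :=
  absz (((m * y.-1) %/ n)%N%:Z - (nth origin (norths P) y.-1).1).

Definition skel1 pi : mon :=
  \big[@mmul _/@mone _]_(1 <= i < n.+1)
    ucm (i, aseq (cpath pi) i, nth 0%N (labels pi) i.-1).

Definition skel tau : mon := \big[@mmul _/@mone _]_(pi <- tau) skel1 pi.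

Lemma skel_cat tau tau' : skel (tau ++ tau') = mmul (skel tau) (skel tau').
Proof.
by rewrite /skel; elim: tau => [|pi tau IH] /=;
  rewrite ?big_nil ?mul1m ?big_cons // IH mulmA.
Qed.

(* In each row, the north step of P' is weakly to the left of the one of P. *)
Definition weakly_left (P' P : lpath) : bool :=
  all2 (fun v' v : point2 => v'.1 <= v.1) (norths P') (norths P).

(* The labelled north steps followed by the (m, n)-translate of the first. *)
Definition cyclic_lnorths pi : seq (point2 * nat) :=
  lnorths pi ++
  [seq ((N.1.1 + m%:Z, N.1.2 + n%:Z), N.2) | N <- take 1 (lnorths pi)].

(* [prec pi pi'] is the order pi < pi'.  A vertex at which a north step of pi
   ends and a north step of pi' starts is common to both paths; conversely,
   given the first two conditions, two such steps exist at every common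
   vertex with y > 0, the translate being used on y = n. *)
Definition prec : rel cPF := fun pi pi' =>
  [&& weakly_left (cpath pi') (cpath pi),
      ~~ has (mem (easts (cpath pi))) (easts (cpath pi'))
    & all (fun p : (point2 * nat) * (point2 * nat) =>
             (step_end p.1.1 true == p.2.1) ==> (p.2.2 <= p.1.2)%N)
          [seq (N, N') | N <- lnorths pi, N' <- cyclic_lnorths pi']].

Definition thru_origin pi : bool := origin \in vertices (cpath pi).

Definition Hset (a : nat) : set (a.-tuple cPF) :=
  [set t | sorted prec t].
Definition Hbar (a : nat) : set (a.-tuple cPF) :=
  [set t | Hset t /\ if val t is pi :: _ then thru_origin pi else false].
Definition Hhat (a : nat) : set (a.-tuple cPF) := @Hset a `\` @Hbar a.

End ParkingFunctions.

(* C(q,t), as the fraction field of C[q][t]. *)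
Definition Cqt (R : realType) : fieldType := {fraction {poly {poly R[i]}}}.
Definition qvar (R : realType) : Cqt R :=
  FracField.tofrac (('X : {poly R[i]})%:P).

Section Operators.
Variables (R : realType) (m n : nat).
Local Notation cPF := (cPF m n).
Local Notation K := (Cqt R).

(* V, as a subspace of the space of all families of coefficients indexed by
   monomials: a family is in the sum of the V_r when the monomials with a
   nonzero coefficient are skeletons of tuples of bounded length.  The sum of
   the V_r is direct because z(tau) has degree n * size tau. *)
Definition inV : {pred (mon -> K^o)} := fun F =>
  `[< exists r : nat, forall M : mon, F M != 0 ->
        exists2 tau : seq cPF, (size tau <= r)%N & skel tau = M >].

Fact inV_submod : GRing.submod_closed inV.
Proof.
split.
  by apply/asboolP; exists 0%N => M; rewrite eqxx.
move=> c F G /asboolP[r hF] /asboolP[s hG]; apply/asboolP.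
exists (maxn r s) => M nz.
have [FM0|/hF[tau ht <-]] := eqVneq (F M) 0; last first.
  by exists tau => //; rewrite leq_max ht.
have [GM0|/hG[tau ht <-]] := eqVneq (G M) 0; last first.
  by exists tau => //; rewrite leq_max ht orbT.
by move: nz; rewrite /GRing.add /= /GRing.scale /= FM0 GM0 scaler0 addr0 eqxx.
Qed.

HB.instance Definition _ :=
  GRing.isSubmodClosed.Build K (mon -> K^o) inV inV_submod.

Record V := MkV { coef :> mon -> K^o; _ : coef \in inV }.

HB.instance Definition _ := [isSub for coef].
HB.instance Definition _ := [Choice of V by <:].
HB.instance Definition _ := [SubChoice_isSubLmodule of V by <:].

(* A tuple with skeleton M, if there is one. *)
Definition tuple_of_mon (M : mon) : seq cPF := xget [::] [set tau | skel tau = M].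

(* The exponent stat(tau, pi) - stat(tau), for any tau with z(tau) = M.  The
   choice of tau is irrelevant: appending entries preserves the comparisons of
   contents between entries of tau, and those between entries of tau and of pi
   only depend on the labelled north steps of tau, hence on z(tau). *)
Definition hexp (M : mon) (pi : seq cPF) : int :=
  let tau := tuple_of_mon M in stat (tau ++ pi) - stat tau.

(* The operator attached to a set A of a-tuples, extended linearly to infinite
   combinations: the coefficient at M of the image of F is the sum, over all
   pi in A and all monomials M' with M' * z(pi) = M, of the coefficient of F
   at M' times the power of q.  When 0 < n, the sum is finite: M has finitely
   many divisors, and a tuple is determined by its skeleton up to finitely many
   choices.  Only skeletons M' contribute, since F vanishes elsewhere. *)
Definition hop_fun (a : nat) (A : set (a.-tuple cPF)) (F : V) : mon -> K^o :=
  fun M => \sum_(p \in [set p : mon * a.-tuple cPF |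
                          A p.2 /\ mmul p.1 (skel p.2) = M])
             qvar R ^ hexp p.1 p.2 * F p.1.

Fact hop_subproof (a : nat) (A : set (a.-tuple cPF)) (F : V) :
  hop_fun A F \in inV.
Proof.
have /asboolP[r Fr] : coef F \in inV by case: F.
apply/asboolP; exists (r + a)%N => M; apply: contraNP => noM.
rewrite /hop_fun fsbig1 // => -[M' pi] /= [_ eqM].
have [->|/Fr[tau ht eqM']] := eqVneq (F M') 0; first by rewrite mulr0.
case: noM; exists (tau ++ pi); first by rewrite size_cat size_tuple leq_add2r.
by rewrite skel_cat eqM' eqM.
Qed.

Definition hop (a : nat) (A : set (a.-tuple cPF)) (F : V) : V :=
  MkV (hop_subproof A F).

Definition frakh (a : int) : V -> V :=
  match a with
  | Posz 0 => idfun
  | Posz a' => hop (@Hset m n a')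
  | Negz _ => 0
  end.

Definition frakh_hat (a : int) : V -> V :=
  match a with
  | Posz 0 => idfun
  | Posz a' => hop (@Hhat m n a')
  | Negz _ => 0
  end.

Definition frakh_bar (a : int) : V -> V :=
  match a with
  | Posz 0 => 0
  | Posz a' => hop (@Hbar m n a')
  | Negz _ => 0
  end.

End Operators.

Arguments frakh R m n a _ : clear implicits.
Arguments frakh_hat R m n a _ : clear implicits.
Arguments frakh_bar R m n a _ : clear implicits.

(* Main.v *)
Require Import Defs.
From mathcomp Require Import all_boot all_order all_algebra.
From mathcomp Require Import boolp classical_sets functions fsbigop finmap monalg.
From mathcomp Require Import reals zify ring.

Set Implicit Arguments.
Unset Strict Implicit.
Unset Printing Implicit Defensive.

Import Order.TTheory GRing.Theory Num.Theory.
Local Open Scope ring_scope.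

(** Record a north step of content c and label l as the point (c, l), and order
    points by increasing content, then by decreasing label.  A cyclic parking
    function is a point v_y in each row y of Z/n with v_(y+1) < v_y + m, where
    v + m shifts the content, and pi precedes pi' exactly when
    v_y + m <= v'_(y+1) for all y.  So a chain is a family of rows of points,
    each one interlacing with the next.  Telescoping over the east steps turns
    the statistic into a sum over pairs of north steps, in which the order of
    the sheets only matters for steps in equal or consecutive rows.

    A coefficient of a product of two operators is therefore a sum over the
    2-colourings of a fixed multiset of points whose two colour classes
    interlace.  Reading the points of two consecutive rows in increasing order,
    at most two strands are open at any time, and the transition between the
    rows is a product of cups and caps of the Temperley-Lieb category acting on
    words in two letters; the coefficient is the trace of a cyclic product of
    cups and caps on words with a given number of letters of each kind.  This
    trace is symmetric in the two letters: moving caps before cups, and rotating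
    the product, reduces it to the identity of words of some length.

    The operators with a hat or a bar prescribe the number of points of content
    0 (none or two for the commutation relations).  In the last relation there
    is exactly one such point, the first one of row 0; the powers of q are those
    that close its strand into a partial trace. *)

(** * Temperley-Lieb traces *)

(** No exchange of colours can work row by row: exchanging the letters exchanges the weights s and 1
    of the cups and caps, and so changes the kernel of a transition. The scalars produced when a cup
    meets a cap are symmetric in the two weights, 1 + s^2 for a closed loop and s for a zigzag; this
    is why a closed product, once reduced, no longer distinguishes the letters. Fixing the excess of
    one letter over the other in the trace fixes the lengths of the two chains, because interlacing
    rows have equal lengths.

    The variable s stands for q^(-1/2). The inversions between the two chains inside a row belong to
    no single transition; doubling the exponent gives one copy to the transition that enters the row
    and one to the transition that leaves it. The total is even on actual pairs of chains, so that
    the argument runs over polynomials in s and no square root of q is adjoined. *)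

Section TemperleyLieb.
Variables (R : comNzRingType) (alpha : bool -> R).
Implicit Types (w : seq bool) (f g : seq bool -> R) (o : bool * nat)
  (ops : seq (bool * nat)).

(* An operation (true, i) inserts a pair x, ~~ x of letters at position i of a
   word, and (false, i) removes such a pair, both with the weight [alpha x].
   Operations act on functions of words, so that the first one of a list is the
   first one applied to the word; out of range, they give 0. *)
Fixpoint cup i f w : R :=
  match i, w with
  | 0%N, _ => alpha true * f [:: true, false & w]
            + alpha false * f [:: false, true & w]
  | i'.+1, h :: t => cup i' (fun t' => f (h :: t')) t
  | _, _ => 0
  end.

Fixpoint cap i f w : R :=
  match i, w with
  | 0%N, x :: y :: t => if x != y then alpha x * f t else 0
  | i'.+1, h :: t => cap i' (fun t' => f (h :: t')) t
  | _, _ => 0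
  end.

Definition tlstep o f := if o.1 then cup o.2 f else cap o.2 f.
Definition tlrun ops f := foldr tlstep f ops.

Definition olen o L := if o.1 then L.+2 else L.-2.
Definition ook o L := if o.1 then (o.2 <= L)%N else (o.2.+1 < L)%N.
Definition tlfin L ops := foldl (fun L o => olen o L) L ops.
Fixpoint tlwf L ops :=
  if ops is o :: ops' then ook o L && tlwf (olen o L) ops' else true.

Definition delta w : seq bool -> R := fun w' => (w' == w)%:R.
Definition mag w : int := (count_mem true w)%:Z - (count_mem false w)%:Z.

Lemma tlfin_cat L ops1 ops2 : tlfin L (ops1 ++ ops2) = tlfin (tlfin L ops1) ops2.
Proof. exact: foldl_cat. Qed.

Lemma tlwf_cat L ops1 ops2 :
  tlwf L (ops1 ++ ops2) = tlwf L ops1 && tlwf (tlfin L ops1) ops2.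
Proof. by elim: ops1 L => //= o ops IH L; rewrite IH andbA. Qed.

Lemma tlrun_cat ops1 ops2 f : tlrun (ops1 ++ ops2) f = tlrun ops1 (tlrun ops2 f).
Proof. exact: foldr_cat. Qed.

Lemma tlstep_ext o f g w L : size w = L -> ook o L ->
  (forall w', size w' = olen o L -> f w' = g w') -> tlstep o f w = tlstep o g w.
Proof.
case: o => [[] i]; rewrite /tlstep /olen /ook /=.
  elim: i f g w L => [|i IH] f g w L sw iL fg /=.
    by rewrite !fg //= sw.
  case: w sw => [|h t] //= sw; case: L sw iL fg => // L [sw] iL fg.
  by apply: (IH _ _ _ L) => // w' sw'; apply: fg; rewrite /= sw'.
elim: i f g w L => [|i IH] f g w L sw iL fg /=.
  case: w sw => [|x [|y t]] //= sw; case: eqP => //= _.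
  by rewrite fg // -sw.
case: w sw => [|h t] //= sw; case: L sw iL fg => // L [sw] iL fg.
apply: (IH _ _ _ L) => // w' sw'; apply: fg; rewrite /= sw'; lia.
Qed.

Lemma tlrun_ext ops f g w L : size w = L -> tlwf L ops ->
  (forall w', size w' = tlfin L ops -> f w' = g w') -> tlrun ops f w = tlrun ops g w.
Proof.
elim: ops w L => [|o ops IH] w L sw /=; first by move=> _; apply.
move=> /andP[ok wf] fg; apply: (tlstep_ext sw ok) => w' sw'.
exact: IH sw' wf fg.
Qed.

Lemma tlstepP o f g a w :
  tlstep o (fun w' => a * f w' + g w') w = a * tlstep o f w + tlstep o g w.
Proof.
case: o => [[] i]; rewrite /tlstep /=.
  elim: i f g w => [|i IH] f g [|h t] /=; try by ring.
  exact: IH.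
elim: i f g w => [|i IH] f g [|h t] /=; try by ring.
  by case: t => [|y t]; [ring|case: ifP => _; ring].
exact: IH.
Qed.

Lemma tlrunP ops f g a w :
  tlrun ops (fun w' => a * f w' + g w') w = a * tlrun ops f w + tlrun ops g w.
Proof.
elim: ops w => [|o ops IH] w //=; rewrite -tlstepP.
by congr tlstep; apply/funext => w'.
Qed.

Lemma tlrun0 ops w : tlrun ops (fun=> 0) w = 0.
Proof.
transitivity (tlrun ops (fun w' => -1 * (fun=> 0) w' + (fun=> 0) w') w).
  by congr tlrun; apply/funext => w' /=; rewrite mulr0 addr0.
by rewrite tlrunP mulN1r addNr.
Qed.

Lemma tlrunZ ops f a w : tlrun ops (fun w' => a * f w') w = a * tlrun ops f w.
Proof.
rewrite -[RHS]addr0 -(tlrun0 ops w) -tlrunP.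
by congr tlrun; apply/funext => w'; rewrite addr0.
Qed.

Lemma tlrun_sum (I : Type) (r : seq I) (P : pred I) (F : I -> seq bool -> R) ops w :
  tlrun ops (fun w' => \sum_(i <- r | P i) F i w') w
  = \sum_(i <- r | P i) tlrun ops (F i) w.
Proof.
elim: r => [|i r IH].
  by rewrite big_nil -[RHS](tlrun0 ops w); congr tlrun; apply/funext => w'; rewrite big_nil.
rewrite big_cons -IH -[in RHS](mul1r (tlrun ops (F i) w)) -tlrunP.
case: ifP => Pi; congr tlrun; apply/funext => w'; rewrite big_cons Pi ?mul1r //.
Qed.

Lemma tlrun_expand ops f w L : size w = L -> tlwf L ops ->
  tlrun ops f w = \sum_(w' : (tlfin L ops).-tuple bool) tlrun ops (delta w') w * f w'.
Proof.
move=> sw wf; under eq_bigr => w' _ do rewrite mulrC -tlrunZ.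
rewrite -tlrun_sum; apply: tlrun_ext sw wf _ => u su.
rewrite (bigD1 (tcast su (in_tuple u))) //= big1 ?addr0; last first.
  move=> v nv; rewrite /delta; case: eqP => [uv|]; rewrite ?mulr0 //.
  by case/eqP: nv; apply: val_inj; rewrite /= val_tcast.
by rewrite /delta val_tcast /= eqxx mulr1.
Qed.

(** Pairs that are inserted or removed consist of opposite letters, so that the excess [mag] is
    invariant and any function of it acts as a scalar. *)
Lemma tlstep_mag o f (P : int -> R) w :
  tlstep o (fun w' => P (mag w') * f w') w = P (mag w) * tlstep o f w.
Proof.
have H (c : int) h (t : seq bool) : c + mag (h :: t) = (c + (if h then 1 else -1)) + mag t.
  by rewrite /mag; case: h => /=; rewrite ?eqxx ?add0n ?PoszD; ring.
rewrite -[mag w]add0r.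
(* Here c accumulates the excess of the letters that precede the position of the operation. *)
suff: forall c, tlstep o (fun w' => P (c + mag w') * f w') w = P (c + mag w) * tlstep o f w.
  by move=> <-; congr tlstep; apply/funext => w'; rewrite add0r.
case: o => [[] i]; rewrite /tlstep /=.
  elim: i f w => [|i IH] f w c /=.
    by rewrite !H /= ?addrK ?subrK; ring.
  case: w => [|h t]; first by rewrite mulr0.
  by rewrite H -IH; congr cup; apply/funext => w'; rewrite H.
elim: i f w => [|i IH] f w c /=.
  case: w => [|x [|y t]]; rewrite ?mulr0 // !H; case: ifP; rewrite ?mulr0 //.
  by move: x y => [] [] // _; rewrite /= ?addrK ?subrK; ring.
case: w => [|h t]; first by rewrite mulr0.
by rewrite H -IH; congr cap; apply/funext => w'; rewrite H.
Qed.

Lemma tlrun_mag ops f (P : int -> R) w :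
  tlrun ops (fun w' => P (mag w') * f w') w = P (mag w) * tlrun ops f w.
Proof.
elim: ops w => //= o ops IH w; rewrite -tlstep_mag.
by congr tlstep; apply/funext => w'; rewrite IH.
Qed.

Definition tltrace L ops (e : int) : R :=
  \sum_(w : L.-tuple bool) (mag w == e)%:R * tlrun ops (delta w) w.

(** Beyond the cyclicity of a trace, this uses that [ops1] preserves [mag], which carries the
    condition on the excess from w to the intermediate word. *)
Lemma tltrace_rot L ops1 ops2 e : tlwf L (ops1 ++ ops2) ->
  tlfin L (ops1 ++ ops2) = L ->
  tltrace L (ops1 ++ ops2) e = tltrace (tlfin L ops1) (ops2 ++ ops1) e.
Proof.
rewrite tlwf_cat tlfin_cat => /andP[wf1 wf2] fin; rewrite /tltrace.
set L1 := tlfin L ops1 in wf2 fin *.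
under eq_bigr => w _.
  rewrite tlrun_cat (tlrun_expand _ (size_tuple w) wf1) mulr_sumr; over.
under [RHS]eq_bigr => w _.
  rewrite tlrun_cat (tlrun_expand _ (size_tuple w) wf2) mulr_sumr fin; over.
rewrite exchange_big /=; apply: eq_bigr => u _; apply: eq_bigr => w _.
rewrite mulrA -(tlrun_mag ops1 (delta u) (fun x => (x == e)%:R)).
have -> : (fun w' => (mag w' == e)%:R * delta u w') =
          (fun w' => (mag u == e)%:R * delta u w').
  apply/funext => w'; rewrite /delta; case: (eqVneq w' u) => [->//|_]; by rewrite !mulr0.
by rewrite tlrunZ; ring.
Qed.

Lemma tlstepZ o f a w : tlstep o (fun w' => a * f w') w = a * tlstep o f w.
Proof. exact: (tlrunZ [:: o]). Qed.

(** A closed loop: each letter pays its weight on insertion and again on removal. *)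
Lemma cup_cap_same i f w : (i <= size w)%N ->
  cup i (cap i f) w = (alpha true ^+ 2 + alpha false ^+ 2) * f w.
Proof.
elim: i f w => [|i IH] f [|h t] //=; try by move=> _; ring.
by move=> it; rewrite IH.
Qed.

(** A zigzag: the adjacent letter of w selects one of the two insertions, and of the inserted and
    removed pairs one starts with true and the other with false. *)
Lemma cup_cap_next i f w : (i < size w)%N ->
  cup i (cap i.+1 f) w = alpha true * alpha false * f w.
Proof.
elim: i f w => [|i IH] f [|h t] // it; first by case: h it => _ /=; ring.
exact: (IH (fun t' => f (h :: t'))).
Qed.

Lemma cup_cap_prev i f w : (i < size w)%N ->
  cup i.+1 (cap i f) w = alpha true * alpha false * f w.
Proof.
elim: i f w => [|i IH] f [|h t] // it; first by case: h it => _ /=; ring.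
exact: (IH (fun t' => f (h :: t'))).
Qed.

Lemma cup_cap_right i j f w : (i <= j)%N ->
  cup i (cap j.+2 f) w = cap j (cup i f) w.
Proof.
elim: i j f w => [|i IH] j f w ij; last first.
  case: j ij => // j ij; case: w => [|h t] //.
  exact: (IH j (fun t' => f (h :: t'))).
have /esym := tlstepP (false, j) (fun u => f [:: true, false & u])
  (fun u => alpha false * f [:: false, true & u]) (alpha true) w.
by rewrite tlstepZ.
Qed.

Lemma cup_cap_left i j f w : (j <= i)%N ->
  cup i.+2 (cap j f) w = cap j (cup i f) w.
Proof.
elim: j i f w => [|j IH] i f w ij; last first.
  case: i ij => // i ij; case: w => [|h t] //.
  exact: (IH i (fun t' => f (h :: t'))).
case: w => [|x [|y t]] //=; case: ifP => _; first exact: (tlstepZ (true, i)).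
exact: (tlrun0 [:: (true, i)]).
Qed.

(* Each reduction of a cup followed by a cap decreases the sum of the lengths
   of the intermediate words. *)
Fixpoint tlheight L ops :=
  if ops is o :: ops' then (olen o L + tlheight (olen o L) ops')%N else 0%N.

Lemma tlheight_cat L ops1 ops2 :
  tlheight L (ops1 ++ ops2) = (tlheight L ops1 + tlheight (tlfin L ops1) ops2)%N.
Proof. by elim: ops1 L => //= o ops IH L; rewrite IH addnA. Qed.

Lemma tlfin_count L ops : tlwf L ops ->
  (tlfin L ops + (count (fun o => ~~ o.1) ops).*2 = L + (count fst ops).*2)%N.
Proof.
elim: ops L => //= -[[] i] ops IH L /= /andP[]; rewrite /ook /olen /= => ok /IH; lia.
Qed.

Lemma cup_then_cap ops : head false (map fst ops) -> has (fun o => ~~ o.1) ops ->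
  exists ops1 i j ops2, ops = ops1 ++ (true, i) :: (false, j) :: ops2.
Proof.
elim: ops => //= -[[] i] ops IH //= _ hn.
case: ops IH hn => [|[[] j] ops] //= IH hn; last by exists [::], i, j, ops.
by have [//|//|ops1 [i' [j' [ops2 ->]]]] := IH; exists ((true, i) :: ops1), i', j', ops2.
Qed.

Lemma tltrace_congr L ops1 r r' ops2 c e : tlwf L (ops1 ++ r) ->
  (forall f w, size w = tlfin L ops1 -> tlrun r f w = c * tlrun r' f w) ->
  tltrace L (ops1 ++ r ++ ops2) e = c * tltrace L (ops1 ++ r' ++ ops2) e.
Proof.
rewrite tlwf_cat => /andP[wf1 _] E; rewrite /tltrace mulr_sumr.
apply: eq_bigr => w _; rewrite mulrCA; congr (_ * _); rewrite !tlrun_cat -tlrunZ.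
by apply: tlrun_ext (size_tuple w) wf1 _ => u su; rewrite E.
Qed.

Definition tlsym L ops := forall e, tltrace L ops e = tltrace L ops (- e).

Lemma tlsym_congr L ops1 r r' ops2 c : tlwf L (ops1 ++ r) ->
  (forall f w, size w = tlfin L ops1 -> tlrun r f w = c * tlrun r' f w) ->
  tlsym L (ops1 ++ r' ++ ops2) -> tlsym L (ops1 ++ r ++ ops2).
Proof. by move=> wf E S e; rewrite !(tltrace_congr _ _ wf E) S. Qed.

Lemma tlsym_reduce L ops1 i j ops2 (ops := ops1 ++ (true, i) :: (false, j) :: ops2) :
  (forall ops', tlwf L ops' -> tlfin L ops' = L ->
     (tlheight L ops' < tlheight L ops)%N -> tlsym L ops') ->
  tlwf L ops -> tlfin L ops = L -> tlsym L ops.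
Proof.
rewrite /ops -[_ :: _]/([:: (true, i); (false, j)] ++ ops2) => {ops} IH.
(* The list [r'] replaces the cup and the cap up to the scalar c. From length l these contribute (l
   + 2) + l to the height, so that the bound 2 l on [r'] gives a strict decrease. *)
have key r' c : (forall f w, size w = tlfin L ops1 ->
      tlrun [:: (true, i); (false, j)] f w = c * tlrun r' f w) ->
    tlwf (tlfin L ops1) r' -> tlfin (tlfin L ops1) r' = tlfin L ops1 ->
    (tlheight (tlfin L ops1) r' <= (tlfin L ops1).*2)%N ->
    tlwf L (ops1 ++ [:: (true, i); (false, j)] ++ ops2) ->
    tlfin L (ops1 ++ [:: (true, i); (false, j)] ++ ops2) = L ->
    tlsym L (ops1 ++ [:: (true, i); (false, j)] ++ ops2).
  move=> E wf' fin' ht' wf fin.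
  have wf1 : tlwf L (ops1 ++ [:: (true, i); (false, j)]).
    by move: wf; rewrite catA tlwf_cat => /andP[].
  apply: tlsym_congr wf1 E _; apply: IH.
  - move: wf; rewrite !tlwf_cat wf' fin' /= => /and3P[-> _ /=].
    by rewrite /olen.
  - by move: fin; rewrite !tlfin_cat fin'.
  - by rewrite !tlheight_cat fin' /= /olen /=; lia.
move=> wf; move: (wf); rewrite !tlwf_cat /= /ook /olen /= => /and3P[_ /and3P[hi hj _] _].
case: (ltngtP i j) => ij.
- have [ji|ij2] := eqVneq j i.+1.
    subst j; apply: (key [::] (alpha true * alpha false)) wf => //= f w sw.
    by rewrite /tlstep /= cup_cap_next // sw.
  have [j' jE] : exists j', j = j'.+2 by exists j.-2; lia.
  subst j; apply: (key [:: (false, j'); (true, i)] 1) wf => //=.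
  + by move=> f w sw; rewrite mul1r /tlstep /= cup_cap_right //; lia.
  + by rewrite /ook /olen /=; lia.
  + by rewrite /olen /=; lia.
  + by rewrite /olen /=; lia.
- have [ji|ij2] := eqVneq i j.+1.
    subst i; apply: (key [::] (alpha true * alpha false)) wf => //= f w sw.
    by rewrite -[LHS]/(cup j.+1 (cap j f) w) cup_cap_prev // sw.
  have [i' iE] : exists i', i = i'.+2 by exists i.-2; lia.
  subst i; apply: (key [:: (false, j); (true, i')] 1) wf => //=.
  + by move=> f w sw; rewrite mul1r -[LHS]/(cup i'.+2 (cap j f) w) cup_cap_left //; lia.
  + by rewrite /ook /olen /=; lia.
  + by rewrite /olen /=; lia.
  + by rewrite /olen /=; lia.
- subst j; apply: (key [::] (alpha true ^+ 2 + alpha false ^+ 2)) wf => //= f w sw.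
  by rewrite /tlstep /= cup_cap_same // sw.
Qed.

Lemma mag_negb w : mag (map negb w) = - mag w.
Proof.
rewrite /mag !count_map opprB; congr (_%:Z - _%:Z); apply: eq_count => -[] //.
Qed.

Theorem tltrace_sym L ops : tlwf L ops -> tlfin L ops = L -> tlsym L ops.
Proof.
have [N] := ubnP (tlheight L ops); elim: N L ops => // N IH L ops.
rewrite ltnS => hN wf fin.
have [->|nz] := eqVneq ops [::].
  (* With no operation left the trace counts words, and exchanging their letters negates [mag]. *)
  move=> e; rewrite /tltrace.
  have negK : involutive (fun w : L.-tuple bool => [tuple of map negb w]).
    by move=> w; apply: val_inj; rewrite /= mapK //; apply: negbK.
  rewrite (reindex_inj (inv_inj negK)) /=; apply: eq_bigr => w _.
  by rewrite mag_negb eqr_oppLR /delta !eqxx.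
have cnt : count (fun o => ~~ o.1) ops = count fst ops.
  by have := tlfin_count wf; rewrite fin; lia.
have sz : (count fst ops + count (fun o => ~~ o.1) ops = size ops)%N.
  exact: (count_predC fst).
have hc : has fst ops.
  by rewrite has_count; case: (ops) nz sz cnt => // o ops' _ /=; lia.
(* The product is rotated so as to begin with a cup. There are as many caps as cups, since the
   length is restored, so that some cup is immediately followed by a cap. *)
pose k := find fst ops; pose L' := tlfin L (take k ops).
have wf12 : tlwf L (take k ops ++ drop k ops) by rewrite cat_take_drop.
have fin12 : tlfin L (take k ops ++ drop k ops) = L by rewrite cat_take_drop.
have rotE e' : tltrace L ops e' = tltrace L' (rot k ops) e'.
  by rewrite -{1}(cat_take_drop k ops) tltrace_rot.
move: (wf12) (fin12); rewrite tlwf_cat tlfin_cat -/L' => /andP[wf1 wf2] fin'.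
have wfr : tlwf L' (rot k ops) by rewrite /rot tlwf_cat wf2 fin' wf1.
have finr : tlfin L' (rot k ops) = L' by rewrite /rot tlfin_cat fin'.
have htr : tlheight L' (rot k ops) = tlheight L ops.
  by rewrite -{2}(cat_take_drop k ops) /rot !tlheight_cat fin' -/L' addnC.
have [|| ops1 [i [j [ops2 opsE]]]] := @cup_then_cap (rot k ops).
- rewrite /rot (drop_nth (true, 0%N)) /=; last by rewrite -has_find.
  exact: nth_find.
- by rewrite has_rot has_count cnt -has_count.
move=> e; rewrite !rotE; move: e; rewrite -/(tlsym L' (rot k ops)).
rewrite opsE in wfr finr htr *; apply: tlsym_reduce => // ops' wf' finr' ht'.
by apply: IH => //; lia.
Qed.
End TemperleyLieb.

(** * Transitions between consecutive rows *)

Section Transition.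
Variables (R : comNzRingType) (s : R).
Implicit Types (ev : seq (bool * bool)) (u w : seq bool).

(** Opening the second colour after the first costs s, and so does closing the first before the
    second. In both cases the letter read first is true, so that the same weights serve for cups and
    for caps. *)
Definition alph (x : bool) : R := if x then s else 1.

(* The list ev describes the points of two consecutive rows in increasing order:
   (true, d) is a point of the new row, which opens a strand of its colour, and
   (false, d) a point of the old row, which closes one; d holds when the point
   belongs to both colours.  The other points take their colours from the words
   w and u.  The booleans o1 and o2 tell which colours are open; at most one
   strand of each colour may be open.  The exponent of s counts the points of the
   second colour opened while the first one is open, and those of the first
   colour closed while the second one is open. *)
Fixpoint ker ev (o1 o2 : bool) u w : R :=
  match ev with
  | [::] => [&& ~~ o1, ~~ o2, nilp u & nilp w]%:R
  | (true, true) :: ev' => if o1 || o2 then 0 else ker ev' true true u w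
  | (false, true) :: ev' => if o1 && o2 then ker ev' false false u w else 0
  | (true, false) :: ev' =>
      if w is x :: w' then
        if (if x then o1 else o2) then 0
        else s ^+ (~~ x && o1) * ker ev' (x || o1) (~~ x || o2) u w'
      else 0
  | (false, false) :: ev' =>
      if u is x :: u' then
        if (if x then o1 else o2) then
          s ^+ (x && o2) * ker ev' (o1 && ~~ x) (o2 && x) u' w
        else 0
      else 0
  end.

Definition tlshift := map (fun o : bool * nat => (o.1, o.2.+1)).

(* The points are read two at a time, starting from no open strand, or from two
   when [two] holds.  Two openings form a cup, two closings a cap; an opening
   and a closing transmit a letter, at the cost of s when two strands are open,
   whatever the letter. *)
Fixpoint parse (two : bool) ev : option (nat * seq (bool * nat)) :=
  match ev with
  | [::] => if two then None else Some (0%N, [::])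
  | (a, true) :: ev' => if a == two then None else parse (~~ two) ev'
  | (a, false) :: (b, false) :: ev' =>
      if a == two then None else
      if b == two then
        omap (fun p => (p.1 + two, tlshift p.2)%N) (parse two ev')
      else if two then omap (fun p => (p.1, (false, 0%N) :: p.2)) (parse false ev')
      else omap (fun p => (p.1, (true, 0%N) :: tlshift (tlshift p.2))) (parse true ev')
  | _ => None
  end.

Lemma tlrun_shift ops f h t :
  tlrun alph (tlshift ops) f (h :: t) = tlrun alph ops (fun t' => f (h :: t')) t.
Proof.
elim: ops t => [|[c i] ops IH] t //=.
rewrite /tlstep /=; case: c => /=.
  by congr cup; apply/funext => t'; exact: IH.
by congr cap; apply/funext => t'; exact: IH.
Qed.

Lemma tlrun_delta_cons ops h t x w :
  tlrun alph (tlshift ops) (delta R (x :: w)) (h :: t)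
  = (h == x)%:R * tlrun alph ops (delta R w) t.
Proof.
rewrite tlrun_shift -tlrunZ; congr tlrun; apply/funext => t'.
by rewrite /delta eqseq_cons; case: (h == x); rewrite ?mul1r ?mul0r.
Qed.

Lemma tlwf_shift L ops : tlwf L ops -> tlwf L.+1 (tlshift ops).
Proof.
elim: ops L => //= -[[] i] ops IH L /andP[]; rewrite /olen /ook /= => ok wf.
  by rewrite ltnS ok; apply: IH.
by rewrite ltnS ok; case: L ok wf => [|[|L]] //= ok; apply: IH.
Qed.

Lemma tlfin_shift L ops : tlwf L ops -> tlfin L.+1 (tlshift ops) = (tlfin L ops).+1.
Proof.
elim: ops L => //= -[[] i] ops IH L /andP[]; rewrite /olen /ook /= => ok wf.
  exact: IH.
by case: L ok wf => [|[|L]] //= ok; apply: IH.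
Qed.

Definition nsingle (b : bool) ev := count_mem (b, false) ev.

Lemma parse_wf two ev k ops : parse two ev = Some (k, ops) ->
  tlwf (nsingle false ev) ops /\ tlfin (nsingle false ev) ops = nsingle true ev.
Proof.
have [N] := ubnP (size ev); elim: N two ev k ops => // N IH two [|[a [] ev]] k ops /=.
- by case: two => // _ [_ <-].
- rewrite ltnS /nsingle /= !xpair_eqE !andbF !add0n => hN.
  by case: ifP => // _; apply: IH.
case: ev => [|[b [] ev]] //= hN; case: eqP => // /eqP na.
have {}hN : (size ev < N)%N by move: hN; rewrite !ltnS => /ltnW.
rewrite /nsingle /= !xpair_eqE !eqxx !andbT; case: eqP => [bE|/eqP nb].
  case E : (parse two ev) => [[k' ops']|] //= -[_ <-].
  have [wf fin] := IH _ _ _ _ hN E; subst b.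
  have := tlwf_shift wf; have := tlfin_shift wf; rewrite fin.
  by case: (two) na; case: (a) => // _; rewrite ?add0n ?add1n ?addn0.
have nbt : b = a by case: (a) (b) (two) na nb => [] [] [].
case: two na nb => na nb; case: a na nbt => // _ -> {b nb}.
  case E : (parse false ev) => [[k' ops']|] //= -[_ <-].
  have [wf fin] := IH _ _ _ _ hN E.
  by rewrite /= /ook /olen /= !add0n.
case E : (parse true ev) => [[k' ops']|] //= -[_ <-].
have [wf fin] := IH _ _ _ _ hN E.
rewrite /= /ook /olen /= !add0n !add1n tlfin_shift ?tlfin_shift ?fin //; last exact: tlwf_shift.
by split => //; do 2!apply: tlwf_shift.
Qed.

Lemma ker_parse two ev u w :
  size u = nsingle false ev -> size w = nsingle true ev ->
  ker ev two two u w =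
  if parse two ev is Some (k, ops) then s ^+ k * tlrun alph ops (delta R w) u else 0.
Proof.
have [N] := ubnP (size ev); elim: N two ev u w => // N IH two [|[a [] ev]] u w.
- by case: two => //= _ /size0nil-> /size0nil->; rewrite /delta eqxx mulr1.
- rewrite ltnS /nsingle /= !xpair_eqE !andbF !add0n => hN su sw.
  have E := IH (~~ two) ev u w hN su sw.
  by case: a two E {su sw} => [] [].
(* An opening when two strands are open, or a closing when none is: both sides vanish. *)
have [->|na] := eqVneq a two.
  move=> _ _ _; have -> : parse two ((two, false) :: ev) = None.
    by case: ev => [|[b []] ev] //=; rewrite eqxx.
  by case: two u w => [u [|x w]|[|x u] w] //=; case: x.
case: ev => [|[b [] ev]].
- move=> _; case: a two na u w => [] [] // _ [|x u] [|y w] //= _ _.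
  + by case: y; rewrite /= ?mulr0.
  + by case: x; rewrite /= ?mulr0.
- move=> _; case: a two na u w => [] [] // _ [|x u] [|y w] //= _ _.
  + by case: b; case: y; rewrite /= ?mulr0.
  + by case: b; case: y; rewrite /= ?mulr0.
  + by case: b; case: x; rewrite /= ?mulr0.
  + by case: b; case: x; rewrite /= ?mulr0.
move=> hN; have {}hN : (size ev < N)%N by move: hN => /=; rewrite !ltnS => /ltnW.
(* The four cases are a cup, a transmission with no open strand, a transmission with two open
   strands, and a cap. *)
case: a two na b => [] [] // _ [];
  rewrite /nsingle /= ?xpair_eqE /= ?add0n ?add1n => su sw.
- case: w sw => [|x [|y w]] //= [sw].
  have E := IH true ev u w hN su sw.
  transitivity ((x != y)%:R * (alph x * ker ev true true u w)).
    by case: x; case: y; rewrite /alph /= ?expr0 ?expr1 ?mul1r ?mul0r ?mulr0.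
  rewrite E; case: (parse true ev) => [[k ops]|] /=; last by rewrite !mulr0.
  rewrite /tlstep /= !tlrun_shift.
  have H h h' : tlrun alph ops (fun t' => delta R [:: x, y & w] [:: h, h' & t']) u =
      ((h == x) && (h' == y))%:R * tlrun alph ops (delta R w) u.
    rewrite -tlrunZ; congr tlrun; apply/funext => t'.
    by rewrite /delta !eqseq_cons andbA; case: ((h == x) && (h' == y)); rewrite ?mul1r ?mul0r.
  by rewrite !H; case: x {H E}; case: y => /=; ring.
- case: u w su sw => [|x u] [|y w] //= [su] [sw].
  have E := IH false ev u w hN su sw.
  transitivity ((x == y)%:R * ker ev false false u w).
    by case: x; case: y; rewrite /= ?expr0 ?mul1r ?mul0r ?mulr0.
  rewrite E; case: (parse false ev) => [[k ops]|] /=; last by rewrite !mulr0.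
  by rewrite addn0 tlrun_delta_cons; ring.
- case: u w su sw => [|x u] [|y w] //= [su] [sw].
  have E := IH true ev u w hN su sw.
  transitivity ((x == y)%:R * (s * ker ev true true u w)).
    by case: x; case: y; rewrite /= ?expr0 ?expr1 ?mul1r ?mul0r ?mulr0.
  rewrite E; case: (parse true ev) => [[k ops]|] /=; last by rewrite !mulr0.
  by rewrite addn1 exprS tlrun_delta_cons; ring.
- case: u su => [|x [|y u]] //= [su].
  have E := IH false ev u w hN su sw.
  transitivity ((x != y)%:R * (alph x * ker ev false false u w)).
    by case: x; case: y; rewrite /alph /= ?expr0 ?expr1 ?mul1r ?mul0r ?mulr0.
  rewrite E; case: (parse false ev) => [[k ops]|] /=; last by rewrite !mulr0.
  by rewrite /tlstep /=; case: eqP => _ /=; ring.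
Qed.
End Transition.

(** * Cyclic products of transitions *)

Section CyclicTransitions.
Variables (R : comNzRingType) (s : R).
Implicit Types (ev : seq (bool * bool)) (evs : seq (seq (bool * bool)))
  (u w : seq bool).

Definition words L : seq (seq bool) := [seq tval t | t <- enum {: L.-tuple bool}].

Lemma mem_words L w : (w \in words L) = (size w == L).
Proof.
apply/mapP/eqP => [[t _ ->]|<-]; first by rewrite size_tuple.
by exists (in_tuple w); rewrite ?mem_enum.
Qed.

Lemma uniq_words L : uniq (words L).
Proof. by rewrite map_inj_uniq ?enum_uniq //; apply: val_inj. Qed.

Lemma big_words L (F : seq bool -> R) :
  \sum_(w <- words L) F w = \sum_(w : L.-tuple bool) F w.
Proof. by rewrite big_map big_enum. Qed.

Fixpoint evs_ok (L : nat) evs (L' : nat) : bool :=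
  if evs is ev :: evs' then
    (nsingle false ev == L) && evs_ok (nsingle true ev) evs' L'
  else L == L'.

Fixpoint kprod evs (ws : seq (seq bool)) : R :=
  match evs, ws with
  | ev :: evs', u :: ws' => ker s ev false false u (head [::] ws') * kprod evs' ws'
  | _, _ => 1
  end.

Fixpoint wlists (Ls : seq nat) : seq (seq (seq bool)) :=
  if Ls is L :: Ls' then [seq w :: ws | w <- words L, ws <- wlists Ls'] else [:: [::]].

(** The coefficient from u to w of the product of the transition matrices. *)
Fixpoint ksum evs u w : R :=
  if evs is ev :: evs' then
    \sum_(v <- words (nsingle true ev)) ker s ev false false u v * ksum evs' v w
  else (u == w)%:R.

Fixpoint parses evs : option (nat * seq (bool * nat)) :=
  if evs is ev :: evs' then
    match parse false ev, parses evs' with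
    | Some (k, ops), Some (k', ops') => Some ((k + k')%N, ops ++ ops')
    | _, _ => None
    end
  else Some (0%N, [::]).

Lemma parses_wf evs L L' k ops : evs_ok L evs L' -> parses evs = Some (k, ops) ->
  tlwf L ops /\ tlfin L ops = L'.
Proof.
elim: evs L k ops => [|ev evs IH] L k ops /=; first by move=> /eqP<- [_ <-].
case/andP => /eqP<- ok; case E : (parse false ev) => [[k1 o1]|] //.
case E' : (parses evs) => [[k2 o2]|] // -[_ <-].
have [wf1 fin1] := parse_wf E; have [wf2 fin2] := IH _ _ _ ok E'.
by rewrite tlwf_cat tlfin_cat wf1 fin1.
Qed.

Lemma ksum_parses evs L L' u w : evs_ok L evs L' -> size u = L -> size w = L' ->
  ksum evs u w = if parses evs is Some (k, ops)
    then s ^+ k * tlrun (alph s) ops (delta R w) u else 0.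
Proof.
elim: evs L u => [|ev evs IH] L u /=.
  by move=> _ _ _; rewrite /delta expr0 mul1r.
case/andP => /eqP<- ok su sw; rewrite big_words.
under eq_bigr => v _ do rewrite ker_parse ?size_tuple // (IH _ _ ok) ?size_tuple //.
case E : (parse false ev) => [[k1 o1]|]; last by rewrite big1 // => v _; rewrite mul0r.
case E' : (parses evs) => [[k2 o2]|]; last by rewrite big1 // => v _; rewrite mulr0.
have [wf1 fin1] := parse_wf E.
rewrite tlrun_cat (tlrun_expand _ _ su wf1) fin1 mulr_sumr; apply: eq_bigr => v _.
by rewrite exprD; ring.
Qed.

Lemma kprod_sum ev evs L L' u w : evs_ok L (ev :: evs) L' -> size w = L' ->
  \sum_(ws <- wlists (map (nsingle false) evs)) kprod (ev :: evs) (u :: rcons ws w)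
  = ksum (ev :: evs) u w.
Proof.
elim: evs ev L u => [|ev' evs IH] ev L u /=.
  case/andP => _ /eqP L'E sw; rewrite big_seq1 /= mulr1 L'E.
  rewrite (bigD1_seq w) ?uniq_words ?mem_words ?sw //= eqxx mulr1.
  by rewrite big1 ?addr0 // => v /negPf->; rewrite mulr0.
case/andP => LE ok sw; rewrite big_allpairs_dep /=.
have [/eqP LE' _] := andP ok; rewrite LE'; apply: eq_bigr => v _.
by rewrite -mulr_sumr (IH ev' (nsingle true ev)).
Qed.

Lemma count_mag (w : seq bool) p :
  (count_mem true w == p) = (mag w == (p.*2)%:Z - (size w)%:Z).
Proof.
have := count_predC (pred1 true) w.
rewrite (@eq_count _ (predC _) (pred1 false)); last by case.
by rewrite /mag => <-; apply/eqP/eqP; lia.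
Qed.

Lemma count_mag_false (w : seq bool) p :
  (count_mem false w == p) = (mag w == - ((p.*2)%:Z - (size w)%:Z)).
Proof.
have := count_predC (pred1 true) w.
rewrite (@eq_count _ (predC _) (pred1 false)); last by case.
by rewrite /mag => <-; apply/eqP/eqP; lia.
Qed.

(** In length L, having p letters true means excess 2p - L and having p letters false means the
    opposite excess, so that [tltrace_sym] applies. *)
Lemma ksum_sym evs L (p : nat) : evs_ok L evs L ->
  \sum_(u <- words L | count_mem true u == p) ksum evs u u
  = \sum_(u <- words L | count_mem false u == p) ksum evs u u.
Proof.
move=> ok; rewrite [LHS]big_mkcond [RHS]big_mkcond !big_words /=.
case E : (parses evs) => [[k ops]|]; last first.
  rewrite !big1 // => u _; rewrite (ksum_parses ok) ?size_tuple // E; by case: ifP.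
have [wf fin] := parses_wf ok E.
have := tltrace_sym (alph s) wf fin ((p.*2)%:Z - L%:Z) => /(congr1 ( *%R (s ^+ k))).
rewrite /tltrace !mulr_sumr => Es.
transitivity (\sum_(u : L.-tuple bool) s ^+ k * ((mag u == (p.*2)%:Z - L%:Z)%:R
    * tlrun (alph s) ops (delta R u) u)); last rewrite Es.
  apply: eq_bigr => u _; rewrite (ksum_parses ok) ?size_tuple // E count_mag size_tuple.
  by case: ifP => _; rewrite ?mul0r ?mulr0 // mul1r.
apply: eq_bigr => u _; rewrite (ksum_parses ok) ?size_tuple // E count_mag_false size_tuple.
by case: ifP => _; rewrite ?mul0r ?mulr0 // mul1r.
Qed.

(* Closing the first strand with a cup and a cap around it turns the weighted
   partial trace into a trace on words with one letter less. *)
Lemma ksum_sym_head evs L (p : nat) : evs_ok L.+1 evs L.+1 ->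
  \sum_(u <- words L | count_mem true u == p)
     (ksum evs (true :: u) (true :: u) + s ^+ 2 * ksum evs (false :: u) (false :: u))
  = \sum_(u <- words L | count_mem false u == p)
     (ksum evs (true :: u) (true :: u) + s ^+ 2 * ksum evs (false :: u) (false :: u)).
Proof.
move=> ok; rewrite [LHS]big_mkcond [RHS]big_mkcond !big_words /=.
case E : (parses evs) => [[k ops]|]; last first.
  rewrite !big1 // => u _; rewrite !(ksum_parses ok) /= ?size_tuple // E ?mulr0 ?addr0;
    by case: ifP.
have [wf fin] := parses_wf ok E.
pose cl := (true, 0%N) :: rcons (tlshift ops) (false, 0%N).
have wfc : tlwf L cl.
  rewrite /= -cats1 tlwf_cat tlwf_shift // tlfin_shift // fin /=.
  by rewrite /ook /olen /=.
have finc : tlfin L cl = L by rewrite /= -cats1 tlfin_cat /olen /= tlfin_shift // fin.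
have runE (u : L.-tuple bool) : tlrun (alph s) cl (delta R u) u =
   tlrun (alph s) ops (delta R (true :: u)) (true :: u)
   + s ^+ 2 * tlrun (alph s) ops (delta R (false :: u)) (false :: u).
  rewrite /cl /= -cats1 tlrun_cat /= {1}/tlstep /= !tlrun_shift.
  (* The cup inserts z and ~~ z; z is carried alongside [ops], and the final cap forces the inner
     strand to come back as ~~ z. The weight of z is thus paid twice, and s^2 goes with the words
     that start with false. *)
  have H z : tlrun (alph s) ops (fun t' => tlstep (alph s) (false, 0%N) (delta R u) (z ::
      t')) (~~ z :: u)
     = alph s z * tlrun (alph s) ops (delta R (~~ z :: u)) (~~ z :: u).
    rewrite -tlrunZ; apply: (@tlrun_ext _ _ _ _ _ _ L.+1) => //=; first by rewrite size_tuple.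
    case=> [|x t]; first by rewrite fin.
    move=> _; rewrite /tlstep /= /delta eqseq_cons.
    by case: z; case: x => /=; rewrite ?mulr0.
  by rewrite (H true) (H false) /=; ring.
have := tltrace_sym (alph s) wfc finc ((p.*2)%:Z - L%:Z) => /(congr1 ( *%R (s ^+ k))).
rewrite /tltrace !mulr_sumr => Es.
transitivity (\sum_(u : L.-tuple bool) s ^+ k * ((mag u == (p.*2)%:Z - L%:Z)%:R
    * tlrun (alph s) cl (delta R u) u)); last rewrite Es.
  apply: eq_bigr => u _; rewrite runE !(ksum_parses ok) /= ?size_tuple // E count_mag size_tuple.
  by case: ifP => _; rewrite ?mul0r ?mulr0 // mul1r; ring.
apply: eq_bigr => u _; rewrite runE !(ksum_parses ok) /= ?size_tuple //
    E count_mag_false size_tuple.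
by case: ifP => _; rewrite ?mul0r ?mulr0 // mul1r; ring.
Qed.
End CyclicTransitions.

(** The events of one colour, true being an opening: starting with a strand open or not according to
    [o], openings and closings alternate and nothing stays open. *)
Fixpoint alt (o : bool) (l : seq bool) : bool :=
  if l is b :: l' then (b != o) && alt b l' else ~~ o.

(** * Crossing weights of two colours *)

Section ColouredEvents.
Variables (Ev : Type) (isW c1 c2 : pred Ev).
Implicit Types E : seq Ev.

Definition single : pred Ev := fun e => ~~ (c1 e && c2 e).

(** [wtX] tests the state before the event and [wtY] the state after it: on alternating tracks, a
    point of both colours then contributes nothing, as in [ker]. *)
Fixpoint wtX (o1 : bool) E : nat :=
  if E is e :: E' then
    ([&& isW e, c2 e & o1] + wtX (if c1 e then isW e else o1) E')%N
  else 0%N.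

Fixpoint wtY (o2 : bool) E : nat :=
  if E is e :: E' then
    let o2' := if c2 e then isW e else o2 in
    ([&& ~~ isW e, c1 e & o2'] + wtY o2' E')%N
  else 0%N.

Definition track (c : pred Ev) E := [seq isW e | e <- E & c e].

Lemma ker_coloured (R : comNzRingType) (s : R) E o1 o2 :
  all (fun e => c1 e || c2 e) E ->
  ker s [seq (isW e, c1 e && c2 e) | e <- E] o1 o2
    [seq c1 e | e <- E & ~~ isW e && single e] [seq c1 e | e <- E & isW e && single e]
  = if alt o1 (track c1 E) && alt o2 (track c2 E) then s ^+ (wtX o1 E + wtY o2 E) else 0.
Proof.
elim: E o1 o2 => [|e E IH] o1 o2 /=; first by rewrite andbT; do 2 case: ifP => //=; case: o1;
    case: o2.
rewrite /track /= => /andP[ce cE]; have {}IH := fun o1 o2 => IH o1 o2 cE.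
rewrite /track in IH.
case E1 : (c1 e) ce => /=; case E2 : (c2 e) => //= _; case W : (isW e) => /=;
  rewrite /single ?E1 ?E2 /= ?W /= ?E1 /= ?IH.
- by case: o1; case: o2 => //=; rewrite ?andbF ?andbT.
- by case: o1; case: o2 => //=; rewrite ?andbF ?andbT.
- by case: o1; case: o2 => //=; rewrite ?mul1r //; case: ifP; rewrite ?mulr0.
- by case: o1; case: o2 => //=; case: ifP => _; rewrite ?mulr0 ?expr0 ?expr1 ?mul1r ?mulr0 //
    -exprS addnCA.
- by case: o1; case: o2 => //=; rewrite ?andbF //; case: ifP => _;
    rewrite ?mulr0 ?expr0 ?expr1 ?mul1r ?mulr0 // -exprS.
- by case: o1; case: o2 => //=; rewrite ?andbF //; case: ifP => _;
    rewrite ?mulr0 ?expr0 ?expr1 ?mul1r ?mulr0.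
Qed.

Fixpoint cnt2 (P Q : pred Ev) E : nat :=
  if E is e :: E' then (P e * count Q E' + cnt2 P Q E')%N else 0%N.

Let w1 e := isW e && c1 e. Let w2 e := isW e && c2 e.
Let u1 e := ~~ isW e && c1 e. Let u2 e := ~~ isW e && c2 e.

(** Alternation makes the state of the first colour equal to [o1] plus its openings minus its
    closings so far; this is summed over the openings of the second colour. *)
Lemma wtX_cnt o1 E : alt o1 (track c1 E) ->
  (wtX o1 E + cnt2 u1 w2 E = cnt2 w1 w2 E + o1 * count w2 E)%N.
Proof.
rewrite /track; elim: E o1 => [|e E IH] o1 //=; first by rewrite muln0.
rewrite /w1 /w2 /u1; case: (c1 e) => /=; last first.
  move=> /IH; rewrite !andbF /= /w1 /w2 /u1.
  by case: (isW e); case: (c2 e); case: o1 => //=; lia.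
case: o1 => /= /andP[]; case: (isW e) => //= _ /IH; rewrite /w1 /w2 /u1; lia.
Qed.

Lemma count_alt o2 E : alt o2 (track c2 E) -> (count w2 E + o2 = count u2 E)%N.
Proof.
rewrite /track /w2 /u2; elim: E o2 => [|e E IH] o2 /=; first by case: o2.
case: (c2 e) => /=; last by move=> /IH; rewrite !andbF.
by case: (isW e); case: o2 => //= /IH; rewrite ?addn0 ?add0n; lia.
Qed.

(** Dually, since nothing stays open, the state of the second colour after an event is the number of
    its later closings minus that of its later openings. *)
Lemma wtY_cnt o2 E : alt o2 (track c2 E) ->
  (wtY o2 E + cnt2 u1 w2 E = cnt2 u1 u2 E)%N.
Proof.
elim: E o2 => [|e E IH] o2 //= H.
have {}H : alt (if c2 e then isW e else o2) (track c2 E).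
  by move: H; rewrite /track /=; case: (c2 e) => //= /andP[].
move: (IH _ H) (count_alt H); set o2' := (if c2 e then _ else _).
by rewrite -![u1 e]/(~~ isW e && c1 e); case: (isW e) => /=; case: (c1 e) => /=; lia.
Qed.

End ColouredEvents.

(** * Merging two rows, and interlacing *)

Section MergedEvents.
Local Open Scope nat_scope.
Variables (disp : Order.disp_t) (T : orderType disp).
Notation Evt := (T *l bool)%type.
Implicit Types (A B : seq T) (E : seq Evt).

(* A closing of key a comes before an opening of the same key. *)
Definition uev (a : T) : Evt := (a, false).
Definition wev (b : T) : Evt := (b, true).

Lemma lt_uw a b : (uev a < wev b)%O = (a <= b)%O.
Proof. by rewrite ltxi_pair /=; case: (ltgtP a b). Qed.
Lemma lt_wu a b : (wev b < uev a)%O = (b < a)%O.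
Proof. by rewrite ltxi_pair /=; case: (ltgtP a b). Qed.
Lemma lt_uu a b : (uev a < uev b)%O = (a < b)%O.
Proof. by rewrite ltxi_pair /=; case: (ltgtP a b). Qed.
Lemma lt_ww a b : (wev a < wev b)%O = (a < b)%O.
Proof. by rewrite ltxi_pair /=; case: (ltgtP a b). Qed.

Definition evs A B : seq Evt := sort <=%O (map uev A ++ map wev B).

Lemma evs_sorted A B : sorted <%O A -> sorted <%O B -> sorted <%O (evs A B).
Proof.
move=> sA sB; rewrite sort_lt_sorted cat_uniq !map_inj_uniq; try by move=> ? ? [].
rewrite (lt_sorted_uniq sA) (lt_sorted_uniq sB) andbT /=.
by apply/hasPn => _ /mapP[b _ ->]; apply/mapP => -[a _ []].
Qed.

Definition us E : seq T := [seq e.1 | e <- E & ~~ e.2].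
Definition ws E : seq T := [seq e.1 | e <- E & e.2].

Lemma filter_evs (cA cB : pred T) A B :
  [seq e <- evs A B | (if e.2 then cB e.1 else cA e.1)]
  = evs [seq a <- A | cA a] [seq b <- B | cB b].
Proof.
rewrite /evs filter_sort //; [|exact: (@le_total _ Evt)|exact: (@le_trans _ Evt)].
by rewrite filter_cat !filter_map.
Qed.

Lemma evs_nilr A : sorted <%O A -> evs A [::] = map uev A.
Proof.
move=> sA; rewrite /evs cats0; apply: sort_le_id; apply: (sub_sorted (@ltW _ Evt)).
by rewrite (homo_sorted _ _ sA) // => a b; rewrite lt_uu.
Qed.

Lemma evs_nill B : sorted <%O B -> evs [::] B = map wev B.
Proof.
move=> sB; rewrite /evs /=; apply: sort_le_id; apply: (sub_sorted (@ltW _ Evt)).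
by rewrite (homo_sorted _ _ sB) // => a b; rewrite lt_ww.
Qed.

Lemma us_evs A B (c : pred Evt) : sorted <%O A -> 
  [seq e <- evs A B | ~~ e.2 & c e] = [seq uev a | a <- A & c (uev a)].
Proof.
move=> sA; have := filter_evs (fun a => c (uev a)) xpred0 A B.
rewrite filter_pred0 evs_nilr ?lt_sorted_filter // => <-.
by apply: eq_filter => -[a []].
Qed.

Lemma ws_evs A B (c : pred Evt) : sorted <%O B -> 
  [seq e <- evs A B | e.2 & c e] = [seq wev b | b <- B & c (wev b)].
Proof.
move=> sB; have := filter_evs xpred0 (fun b => c (wev b)) A B.
rewrite filter_pred0 evs_nill ?lt_sorted_filter // => <-.
by apply: eq_filter => -[a []].
Qed.

Fixpoint zigzag A B : seq Evt :=
  match A, B with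
  | a :: A', b :: B' => wev b :: uev a :: zigzag A' B'
  | _, _ => [::]
  end.

(** This amounts to B_0 < A_0 <= B_1 < A_1 <= ..., the weak inequalities coming from closings that
    precede openings of the same key. *)
Definition interlace A B := (size A == size B) && sorted <%O (zigzag A B).

Lemma alt_zigzag A B : size A = size B -> alt false [seq e.2 | e <- zigzag A B].
Proof. by elim: A B => [|a A IH] [|b B] //= [/IH]. Qed.

Lemma zigzag_perm A B : size A = size B ->
  perm_eq (zigzag A B) (map uev A ++ map wev B).
Proof.
elim: A B => [|a A IH] [|b B] //= [/IH /permP H].
by apply/permP => P; rewrite /= H !count_cat /=; lia.
Qed.

Lemma alt_zigzagP E : alt false [seq e.2 | e <- E] ->
  E = zigzag (us E) (ws E) /\ size (us E) = size (ws E).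
Proof.
have [N] := ubnP (size E); elim: N E => // N IH [|[b [] [|[a [] E]]]] //= hN H.
have hE : (size E < N)%N by move: hN; rewrite !ltnS => /ltnW.
have [EE sz] := IH E hE H; split; last by rewrite /us /ws /= -/(us E) -/(ws E) sz.
by rewrite [in LHS]EE.
Qed.

Lemma alt_interlace A B : sorted <%O A -> sorted <%O B ->
  alt false [seq e.2 | e <- evs A B] = interlace A B.
Proof.
move=> sA sB; have sE := evs_sorted sA sB.
have uE : us (evs A B) = A.
  rewrite /us (_ : [seq _ <- _ | _] = [seq uev a | a <- A & true]).
    by rewrite filter_predT -map_comp map_id.
  by rewrite -(@us_evs A B xpredT) //; apply: eq_filter => e; rewrite /= andbT.
have wE : ws (evs A B) = B.
  rewrite /ws (_ : [seq _ <- _ | _] = [seq wev a | a <- B & true]).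
    by rewrite filter_predT -map_comp map_id.
  by rewrite -(@ws_evs A B xpredT) //; apply: eq_filter => e; rewrite /= andbT.
apply/idP/andP => [/alt_zigzagP[]|[/eqP sz sz2]].
  by rewrite uE wE => EE ->; rewrite -EE eqxx.
suff -> : evs A B = zigzag A B by apply: alt_zigzag.
apply: lt_sorted_eq => //; apply: perm_mem.
by rewrite /evs perm_sort perm_sym zigzag_perm.
Qed.

Lemma cnt2_sorted (P Q : pred Evt) E : sorted <%O E ->
  cnt2 P Q E = \sum_(e <- E | P e) count (fun e' => Q e' && (e < e')%O) E.
Proof.
elim: E => [|e E IH] /=; first by rewrite big_nil.
move=> pE; rewrite big_cons IH ?(path_sorted pE) //.
have min : all (fun e' => e < e')%O E by apply: order_path_min => //; apply: lt_trans.
have -> : \sum_(j <- E | P j) count (fun e' => Q e' && (j < e')%O) (e :: E)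
   = \sum_(j <- E | P j) count (fun e' => Q e' && (j < e')%O) E.
  rewrite big_seq_cond [RHS]big_seq_cond; apply: eq_bigr => j /andP[jE _] /=.
  by rewrite (lt_gtF (allP min j jE)) andbF.
rewrite /= ltxx andbF add0n.
have -> : count (fun e' => Q e' && (e < e')%O) E = count Q E.
  by apply: eq_in_count => j /(allP min)->; rewrite andbT.
by case: (P e) => /=; rewrite ?mul1n.
Qed.

Definition ninv A B : nat := \sum_(a <- A) count (fun b => a < b)%O B.
Definition nle A B : nat := \sum_(a <- A) count (fun b => a <= b)%O B.

(** Only a closing followed by an opening compares keys weakly, hence the single [nle]. *)
Lemma cnt2_evs (PA QA PB QB : pred T) A B : sorted <%O A -> sorted <%O B ->
  let A1 := filter PA A in let B1 := filter PB B in
  let A2 := filter QA A in let B2 := filter QB B in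
  cnt2 (fun e => if e.2 then PB e.1 else PA e.1) (fun e => if e.2 then QB e.1 else QA e.1) (evs A B)
  = (ninv A1 A2 + nle A1 B2 + ninv B1 A2 + ninv B1 B2)%N.
Proof.
move=> sA sB A1 B1 A2 B2; rewrite cnt2_sorted ?evs_sorted //.
have permE : perm_eq (evs A B) (map uev A ++ map wev B) by rewrite perm_sort.
under eq_bigr => e _ do rewrite (permP permE) count_cat !count_map.
rewrite big_split /= !(perm_big _ permE) !big_cat !big_map /= addnACA -[RHS]addnA.
rewrite /ninv /nle !big_filter; congr (_ + _ + (_ + _))%N;
  apply: eq_bigr => x _; rewrite count_filter; apply: eq_count => y /=;
      rewrite andbC ?lt_uw ?lt_wu ?lt_uu ?lt_ww //.
Qed.
End MergedEvents.

(** * The kernel of a transition between coloured rows *)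

Section TransitionWeight.
Variables (disp : Order.disp_t) (T : orderType disp).
Notation Evt := (T *l bool)%type.
Local Open Scope nat_scope.

Definition shape (dA dB : pred T) (A B : seq T) : seq (bool * bool) :=
  [seq (e.2, (if e.2 then dB e.1 else dA e.1)) | e : Evt <- evs A B].

(** The truncated subtraction is exact when both colours interlace, by [nle_trweight]. The cross
    term is doubled because it arises once in [wtX] and once in [wtY]. *)
Definition trweight (A1 A2 B1 B2 : seq T) : nat :=
  ninv A1 A2 + ninv B1 B2 - (nle A1 B2).*2.

Lemma ninv0l (B : seq T) : ninv [::] B = 0.
Proof. by rewrite /ninv big_nil. Qed.
Lemma ninv0r (A : seq T) : ninv A [::] = 0.
Proof. by rewrite /ninv big1. Qed.
Lemma nle0l (B : seq T) : nle [::] B = 0.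
Proof. by rewrite /nle big_nil. Qed.
Lemma nle0r (A : seq T) : nle A [::] = 0.
Proof. by rewrite /nle big1. Qed.

Variables (A B : seq T) (dA dB cA1 cA2 cB1 cB2 : pred T).
Hypotheses (sA : sorted <%O A) (sB : sorted <%O B)
  (cA : {in A, forall a, cA1 a || cA2 a}) (cB : {in B, forall b, cB1 b || cB2 b})
  (dAE : {in A, forall a, dA a = cA1 a && cA2 a})
  (dBE : {in B, forall b, dB b = cB1 b && cB2 b}).
Let A1 := [seq a <- A | cA1 a]. Let A2 := [seq a <- A | cA2 a].
Let B1 := [seq b <- B | cB1 b]. Let B2 := [seq b <- B | cB2 b].
Let c1 (e : Evt) := if e.2 then cB1 e.1 else cA1 e.1.
Let c2 (e : Evt) := if e.2 then cB2 e.1 else cA2 e.1.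
Let isW (e : Evt) := e.2.

Lemma mem_evs (e : Evt) : (e \in evs A B) = (e.1 \in (if e.2 then B else A)).
Proof.
case: e => a b; rewrite mem_sort mem_cat /=.
have uinj : injective (@uev _ T) by move=> ? ? [].
have winj : injective (@wev _ T) by move=> ? ? [].
case: b; rewrite -?[(a, true)]/(wev a) -?[(a, false)]/(uev a) mem_map // ?orbF.
  by case: mapP => // -[? _ []].
by rewrite orbC; case: mapP => // -[? _ []].
Qed.

Let trackE1 : track isW c1 (evs A B) = [seq e.2 | e <- evs A1 B1].
Proof. by rewrite /track filter_evs. Qed.
Let trackE2 : track isW c2 (evs A B) = [seq e.2 | e <- evs A2 B2].
Proof. by rewrite /track filter_evs. Qed.

Lemma wt_trweight : interlace A1 B1 -> interlace A2 B2 ->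
  wtX isW c1 c2 false (evs A B) + wtY isW c1 c2 false (evs A B) + (nle A1 B2).*2
  = ninv A1 A2 + ninv B1 B2.
Proof.
rewrite -!alt_interlace ?lt_sorted_filter // -trackE1 -trackE2 =>
    /wtX_cnt-/(_ c2) HX /wtY_cnt-/(_ c1).
move: HX; rewrite mul0n addn0.
have -> : cnt2 (fun e => ~~ isW e && c1 e) (fun e => isW e && c2 e) (evs A B) = nle A1 B2.
  have := @cnt2_evs _ T cA1 xpred0 xpred0 cB2 A B sA sB.
  rewrite /= !filter_pred0 !ninv0l ninv0r add0n !addn0 => <-.
  by congr cnt2; apply/funext => -[a []]; rewrite /isW /c1 /c2 /=.
have -> : cnt2 (fun e => isW e && c1 e) (fun e => isW e && c2 e) (evs A B) = ninv B1 B2.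
  have := @cnt2_evs _ T xpred0 xpred0 cB1 cB2 A B sA sB.
  rewrite /= !filter_pred0 !ninv0l nle0l ninv0r !add0n => <-.
  by congr cnt2; apply/funext => -[a []]; rewrite /isW /c1 /c2 /=.
have -> : cnt2 (fun e => ~~ isW e && c1 e) (fun e => ~~ isW e && c2 e) (evs A B) = ninv A1 A2.
  have := @cnt2_evs _ T cA1 cA2 xpred0 xpred0 A B sA sB.
  rewrite /= !filter_pred0 !ninv0l nle0r !addn0 => <-.
  by congr cnt2; apply/funext => -[a []]; rewrite /isW /c1 /c2 /=.
lia.
Qed.

Lemma nle_trweight : interlace A1 B1 -> interlace A2 B2 ->
  trweight A1 A2 B1 B2 + (nle A1 B2).*2 = ninv A1 A2 + ninv B1 B2.
Proof. by move=> i1 i2; rewrite /trweight; have := wt_trweight i1 i2; lia. Qed.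

Lemma ker_transition (R : comNzRingType) (s : R) :
  ker s (shape dA dB A B) false false [seq cA1 a | a <- A & ~~ dA a]
    [seq cB1 b | b <- B & ~~ dB b]
  = (if interlace A1 B1 && interlace A2 B2 then s ^+ trweight A1 A2 B1 B2 else 0)%R.
Proof.
have call : all (fun e => c1 e || c2 e) (evs A B).
  apply/allP => -[a []]; rewrite mem_evs /c1 /c2 /=; [exact: cB | exact: cA].
have := ker_coloured isW s false false call.
rewrite trackE1 trackE2 !alt_interlace ?lt_sorted_filter //.
rewrite us_evs // ws_evs // -!map_comp.
have -> : [seq (isW e, c1 e && c2 e) | e <- evs A B] = shape dA dB A B.
  apply/eq_in_map => -[a []]; rewrite mem_evs /isW /c1 /c2 /= => ain; first by rewrite dBE.
  by rewrite dAE.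
rewrite [filter (fun a => single c1 c2 (uev a)) A](_ : _ = [seq a <- A | ~~ dA a]); last first.
  by apply: eq_in_filter => a ain; rewrite dAE.
rewrite [filter (fun a => single c1 c2 (wev a)) B](_ : _ = [seq a <- B | ~~ dB a]); last first.
  by apply: eq_in_filter => a ain; rewrite dBE.
move=> E; refine (etrans E _).
case: ifP => // /andP[i1 i2]; congr (s ^+ _)%R.
by have := wt_trweight i1 i2; rewrite /trweight; lia.
Qed.
End TransitionWeight.

(** * Cyclic parking functions as sequences of points *)

Section PathWords.
Implicit Types (p : point2) (w : seq bool) (es : seq nat).

(* The word of a path whose y-th north step is followed by [nth 0 es y] east
   steps. *)
Definition pathword es : seq bool := flatten [seq true :: nseq e false | e <- es].

Lemma pathwordP w : exists k es, w = nseq k false ++ pathword es.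
Proof.
elim: w => [|b w [k [es ->]]]; first by exists 0%N, [::].
case: b; first by exists 0%N, (k :: es).
by exists k.+1, es.
Qed.

Lemma head_pathword w : head false w -> exists es, w = pathword es.
Proof. by have [[|k] [es ->]] := pathwordP w => //= _; exists es. Qed.

Lemma count_true_pathword es : count_mem true (pathword es) = size es.
Proof. by elim: es => //= e es IH; rewrite count_cat IH count_nseq. Qed.

Lemma count_false_pathword es : count_mem false (pathword es) = sumn es.
Proof. by elim: es => //= e es IH; rewrite count_cat IH count_nseq /= mul1n. Qed.

Lemma last_pathword es b : es != [::] -> last b (pathword es) = (last 0%N es == 0%N).
Proof.
case/lastP: es => // es e _; rewrite last_rcons /pathword map_rcons flatten_rcons last_cat /=.
by case: e => //= e; elim: e.
Qed.

Definition walk_end p w : point2 := foldl step_end p w.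

Lemma walk_cat p w1 w2 : walk p (w1 ++ w2) = walk p w1 ++ walk (walk_end p w1) w2.
Proof. by elim: w1 p => //= d w1 IH p; rewrite IH. Qed.

Lemma walk_endE p w :
  walk_end p w = (p.1 + (count_mem false w)%:Z, p.2 + (count_mem true w)%:Z).
Proof.
elim: w p => [|d w IH] p; first by rewrite /= !addr0; case: p.
by rewrite /= IH; case: d => /=; rewrite ?add0n ?add1n ?intS !addrA.
Qed.

Lemma iota0S k : iota 0 k.+1 = 0%N :: map S (iota 0 k).
Proof. by rewrite /= (iotaDl 1 0). Qed.

Lemma walk_nseq p k :
  walk p (nseq k false) = [seq ((p.1 + i%:Z, p.2), false) | i <- iota 0 k].
Proof.
elim: k p => //= k IH [x y]; rewrite IH addr0 (iotaDl 1 0) -map_comp; congr cons.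
by apply: eq_map => i /=; rewrite PoszD addrA.
Qed.

Lemma walk_pathword p e es : walk p (pathword (e :: es)) =
  (p, true) :: [seq ((p.1 + i%:Z, p.2 + 1), false) | i <- iota 0 e]
  ++ walk (p.1 + e%:Z, p.2 + 1) (pathword es).
Proof.
rewrite /= walk_cat walk_nseq walk_endE !count_nseq /= mul1n mul0n addr0.
by case: p.
Qed.

(* The abscissa of the i-th north step of a path starting at abscissa x. *)
Definition xpart (x : int) es i : int := x + (sumn (take i es))%:Z.

Lemma xpart0 x es : xpart x es 0 = x.
Proof. by rewrite /xpart take0 addr0. Qed.

Lemma xpartS x e es i : xpart x (e :: es) i.+1 = xpart (x + e%:Z) es i.
Proof. by rewrite /xpart /= PoszD addrA. Qed.

Lemma xpart_next x es i : (i < size es)%N -> xpart x es i.+1 = xpart x es i + (nth 0%N es i)%:Z.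
Proof.
by move=> h; rewrite /xpart (take_nth 0%N) // -cats1 sumn_cat /= addn0 PoszD addrA.
Qed.

Lemma xpart_size x es : xpart x es (size es) = x + (sumn es)%:Z.
Proof. by rewrite /xpart take_size. Qed.

Lemma norths_pathword p es : [seq s.1 | s <- walk p (pathword es) & s.2]
  = [seq (xpart p.1 es i, p.2 + i%:Z) | i <- iota 0 (size es)].
Proof.
elim: es p => // e es IH p; rewrite walk_pathword [filter _ _]/= filter_cat map_cons map_cat.
rewrite (@eq_in_filter _ _ xpred0) ?filter_pred0; last by move=> _ /mapP[i _ ->].
rewrite IH -[size (e :: es)]/(size es).+1 iota0S map_cons xpart0 addr0 -map_comp /=.
case: p => x y /=; congr cons.
by apply: eq_map => i /=; rewrite xpartS intS addrA.
Qed.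

Lemma mem_easts_pathword p es x z :
  ((x, z) \in [seq s.1 | s <- walk p (pathword es) & ~~ s.2]) <->
  exists2 i, (i < size es)%N & z = p.2 + i.+1%:Z /\ xpart p.1 es i <= x < xpart p.1 es i.+1.
Proof.
elim: es p => [|e es IH] p; first by split=> // -[].
rewrite walk_pathword [filter _ _]/= filter_cat map_cat mem_cat.
rewrite (@eq_in_filter _ _ xpredT) ?filter_predT; last by move=> _ /mapP[i _ ->].
split.
  case/orP => [/mapP[_ /mapP[j + ->]] [-> ->]|/IH[i hi [zE xE]]].
    rewrite mem_iota => /= hj; exists 0%N => //; split=> //.
    by rewrite xpart0 xpartS xpart0; lia.
  by exists i.+1 => //; rewrite !xpartS; split=> //; rewrite zE /=; lia.
case=> -[|i] /= hi [zE]; rewrite !xpartS ?xpart0 => xE.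
  apply/orP; left; apply/mapP; exists ((x, z), false) => //.
  apply/mapP; exists (absz (x - p.1)%R); rewrite ?mem_iota; first lia.
  by rewrite zE; congr ((_, _), _); lia.
apply/orP; right; apply/IH; exists i => //; split=> //; rewrite zE /=; lia.
Qed.

Lemma mem_vertices_pathword a es v :
  (v \in vertices (a, pathword es)) <->
  v = (- a%:Z, 0) \/
  exists2 i, (i < size es)%N & v.2 = i.+1%:Z /\
    xpart (- a%:Z) es i <= v.1 <= xpart (- a%:Z) es i.+1.
Proof.
rewrite /vertices /path_steps /path_start /= inE.
suff H : forall p : point2, (v \in [seq step_end s.1 s.2 | s <- walk p (pathword es)]) <->
  exists2 i, (i < size es)%N & v.2 = p.2 + i.+1%:Z /\
    xpart p.1 es i <= v.1 <= xpart p.1 es i.+1.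
  have H0 := H (- a%:Z, 0); split.
    by case/orP => [/eqP|/H0[i hi]]; [left|right; exists i; rewrite // -[v.2]add0r].
  case=> [->|[i hi hv]]; first by rewrite eqxx.
  by apply/orP; right; apply/H0; exists i; rewrite //= add0r.
elim: es => [|e es IH] p; first by split=> // -[].
rewrite walk_pathword map_cons map_cat inE mem_cat; split.
  case/or3P => [/eqP->|/mapP[_ /mapP[j + ->] ->]|/IH[i hi [zE xE]]].
  - by exists 0%N => //=; rewrite xpart0 xpartS xpart0; split=> //; lia.
  - rewrite mem_iota => /= hj; exists 0%N => //; rewrite xpart0 xpartS xpart0; split=> //=; lia.
  - by exists i.+1 => //; rewrite !xpartS; split=> //; rewrite zE /=; lia.
case: v {IH} (IH (p.1 + e%:Z, p.2 + 1)) => x z IH.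
case=> -[|i] /= hi [zE]; rewrite !xpartS ?xpart0 => xE.
  have [xp|xp] := eqVneq x p.1; first by rewrite xp zE; case: (p) => ? ?; rewrite eqxx.
  apply/or3P/Or32/mapP; exists ((x - 1, z), false); last by congr pair; rewrite /= subrK.
  apply/mapP; exists (absz (x - 1 - p.1)%R); rewrite ?mem_iota; first lia.
  by rewrite zE; congr ((_, _), _); lia.
apply/or3P/Or33/IH; exists i => //; split=> //; rewrite zE /=; lia.
Qed.

End PathWords.

Section CyclicPoints.
Variables m n : nat.
Hypotheses (m_gt0 : (0 < m)%N) (n_gt0 : (0 < n)%N).

Lemma is_cpfE a es ls : is_cpf m n ((a, pathword es), ls) <->
  [/\ [/\ size es = n, sumn es = m & size ls = n],
      all (leq 1) ls,
      forall i, (i < n)%N -> n%:Z * xpart (- a%:Z) es i <= m%:Z * i%:Z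
    & forall i, (i < n)%N -> nth 0%N es i = 0%N ->
        (nth 0%N ls i < nth 0%N ls (i.+1 %% n))%N].
Proof.
rewrite /is_cpf /is_lattice_path /= count_true_pathword count_false_pathword.
have [szE|szN] := eqVneq (size es) n; last first.
  by rewrite andbF; split=> // -[[]] // szE; rewrite szE eqxx in szN.
have es0 : es != [::] by rewrite -size_eq0 szE -lt0n.
have hd : head false (pathword es) by case: (es) es0.
rewrite hd last_pathword //=.
have [smE|smN] := eqVneq (sumn es) m; last first.
  by rewrite andbF; split=> // -[[_ smE]]; rewrite smE eqxx in smN.
have [slE|slN] := eqVneq (size ls) n; last first.
  by rewrite !andbF; split=> // -[[_ _ slE]]; rewrite slE eqxx in slN.
have vE : all (fun v : point2 => n%:Z * v.1 <= m%:Z * v.2) (vertices (a, pathword es))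
   <-> (forall i, (i < n)%N -> n%:Z * xpart (- a%:Z) es i <= m%:Z * i%:Z).
  split=> [/allP H i hi|H].
    apply: (H (xpart (- a%:Z) es i, i%:Z)); apply/mem_vertices_pathword.
    case: i hi => [|i] hi; first by left; rewrite xpart0.
    right; exists i; first by rewrite szE ltnW.
    rewrite /= lexx andbT xpart_next ?szE 1?ltnW //; split=> //; lia.
  apply/allP => v /mem_vertices_pathword[->|[i hi [v2 /andP[_ v1]]]] /=.
    by have := H 0%N n_gt0; rewrite xpart0.
  (* A vertex of height i + 1 is not to the right of the next north step; at height n, the bound is
     the one at the start, translated by (m, n). *)
  rewrite szE in hi; have [hi'|hi'] := ltnP i.+1 n.
    by rewrite v2; apply: le_trans (H _ hi'); rewrite ler_wpM2l.
  have iE : i.+1 = n by apply/eqP; rewrite eqn_leq hi hi'.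
  have := H 0%N n_gt0; rewrite xpart0 mulr0 => H0.
  move: v1; rewrite v2 iE -szE xpart_size smE szE => v1.
  apply: (@le_trans _ _ (n%:Z * (- a%:Z + m%:Z))); first by rewrite ler_wpM2l.
  by rewrite mulrDr [m%:Z * _]mulrC gerDr.
have nE : zip (norths (a, pathword es)) ls =
   [seq ((xpart (- a%:Z) es i, i%:Z), nth 0%N ls i) | i <- iota 0 n].
  rewrite /norths /path_steps norths_pathword szE /= -[in LHS](mkseq_nth 0%N ls) /mkseq slE.
  by rewrite zip_map; apply: eq_map => i; rewrite add0r.
have lE : all (fun p : (point2 * nat) * (point2 * nat) =>
             (step_end p.1.1 true == p.2.1) ==> (p.1.2 < p.2.2)%N)
          [seq (s, s') | s <- zip (norths (a, pathword es)) ls,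
                         s' <- zip (norths (a, pathword es)) ls]
   <-> (forall i, (i.+1 < n)%N -> nth 0%N es i = 0%N ->
        (nth 0%N ls i < nth 0%N ls i.+1)%N).
  rewrite nE; split=> [/allP H i hi ei|H].
    have iin : i \in iota 0 n by rewrite mem_iota /=; lia.
    have iin' : i.+1 \in iota 0 n by rewrite mem_iota /=; lia.
    have := H _ (allpairs_f (fun s s' => (s, s')) (map_f _ iin) (map_f _ iin')).
    move/implyP; apply; rewrite /= xpart_next ?szE 1?ltnW // ei addr0.
    by apply/eqP; congr pair; lia.
  apply/allP => _ /allpairsP[[s s'] /= [/mapP[i iin ->] /mapP[j jin ->] ->]] /=.
  apply/implyP => /eqP[xE jE]; move: iin jin; rewrite !mem_iota /= => iin jin.
  have {jE} jE : j = i.+1 by lia.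
  subst j; apply: H => //; move: xE; rewrite xpart_next ?szE //; lia.
have ndE : last 0%N es = nth 0%N es n.-1 by rewrite -nth_last szE.
have ldE : last 0%N ls = nth 0%N ls n.-1 by rewrite -nth_last slE.
rewrite ndE ldE -nth0; split.
  move=> /and4P[v _ _ /and3P[pos l la]]; split=> //; first exact: (proj1 vE v).
  move=> i hi ei; have [hi'|hi'] := ltnP i.+1 n.
    by rewrite modn_small //; apply: (proj1 lE l).
  have iE : i = n.-1 by lia.
  by move: la; rewrite -iE ei eqxx (_ : i.+1 = n) ?modnn //; lia.
case=> _ pos v H; apply/and4P; split=> //; first exact: (proj2 vE v).
apply/and3P; split=> //.
  by apply: (proj2 lE) => i hi ei; have := H i (ltnW hi) ei; rewrite modn_small.
by apply/implyP => /eqP ei; have := H n.-1; rewrite prednK // modnn; apply.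
Qed.
End CyclicPoints.

(* A labelled north step is recorded as (content, label); larger labels come
   first among steps of equal content. *)
Notation pnt := (nat *l nat^d)%type.

Lemma lt_pnt (v v' : pnt) :
  (v < v')%O = (v.1 < v'.1)%N || (v.1 == v'.1) && ((v'.2 : nat) < v.2)%N.
Proof. by case: v v' => [c l] [c' l']; rewrite ltxi_pair !leEnat /=; case: (ltngtP c c'). Qed.

Lemma le_pnt (v v' : pnt) :
  (v <= v')%O = (v.1 < v'.1)%N || (v.1 == v'.1) && ((v'.2 : nat) <= v.2)%N.
Proof. by case: v v' => [c l] [c' l']; rewrite lexi_pair !leEnat /=; case: (ltngtP c c'). Qed.

Section Points.
Variables m n : nat.
Hypotheses (m_gt0 : (0 < m)%N) (n_gt0 : (0 < n)%N).
Local Notation cPF := (cPF m n).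
Implicit Types pi : cPF.

(* The content of the end of the north step v, with the label of v. *)
Definition shp (v : pnt) : pnt := ((v.1 + m)%N, v.2).

Lemma lt_shp v v' : (shp v < shp v')%O = (v < v')%O.
Proof. by rewrite !lt_pnt /= ltn_add2r eqn_add2r. Qed.

Definition xs pi y : int := (nth origin (norths (cpath pi)) y).1.
Definition lab pi y : nat := nth 0%N (labels pi) y.
Definition pt pi y : pnt := (absz (m%:Z * y%:Z - n%:Z * xs pi y)%R, lab pi y).

(* At y = n, the first north step of the next period. *)
Definition xs' pi y : int := if (y < n)%N then xs pi y else xs pi 0 + m%:Z.

Lemma cpf_pathword pi : exists a es,
  [/\ cpf_val pi = ((a, pathword es), labels pi), size es = n, sumn es = m,
      forall y, (y < n)%N -> xs pi y = xpart (- a%:Z) es y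
    & forall y, (y <= n)%N -> xs' pi y = xpart (- a%:Z) es y].
Proof.
have := cpf_valP pi; case E : (cpf_val pi) => [[a w] ls] ok.
have /head_pathword[es wE] : head false w by case/and3P: ok => /and3P[].
subst w; exists a, es; have [[szE smE slE] _ _ _] := (is_cpfE m_gt0 n_gt0 _ _ _).1 ok.
have xE y : (y < n)%N -> xs pi y = xpart (- a%:Z) es y.
  move=> yn; rewrite /xs /cpath E /norths /path_steps norths_pathword.
  by rewrite (nth_map 0%N) ?size_iota ?szE // nth_iota ?szE.
split=> //; first by rewrite /labels E.
move=> y yn; rewrite /xs'; case: ltnP => hy; first exact: xE.
have -> : y = size es by rewrite szE; apply/eqP; rewrite eqn_leq hy yn.
by rewrite xpart_size smE xE // xpart0.
Qed.

Lemma ptE pi y : (y < n)%N -> (pt pi y).1%:Z = m%:Z * y%:Z - n%:Z * xs pi y.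
Proof.
move=> yn; have [a [es [E szE smE xE _]]] := cpf_pathword pi.
have := cpf_valP pi; rewrite E => /(is_cpfE m_gt0 n_gt0)[_ _ H _].
rewrite /= gez0_abs // subr_ge0 xE //; exact: H.
Qed.

Lemma size_labels pi : size (labels pi) = n.
Proof.
have [a [es [E _ _ _ _]]] := cpf_pathword pi.
by have := cpf_valP pi; rewrite E => /(is_cpfE m_gt0 n_gt0)[[]].
Qed.

Lemma xs'_le pi y : (y < n)%N -> xs pi y <= xs' pi y.+1.
Proof.
move=> yn; have [a [es [E szE smE xE xE']]] := cpf_pathword pi.
by rewrite xE // xE' // xpart_next ?szE //; lia.
Qed.

Lemma norths_cpf pi : norths (cpath pi) = [seq (xs pi y, y%:Z) | y <- iota 0 n].
Proof.
have [a [es [E szE smE xE _]]] := cpf_pathword pi.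
rewrite /cpath E /norths /path_steps norths_pathword szE.
by apply/eq_in_map => y; rewrite mem_iota /= => yn; rewrite xE // add0r.
Qed.

Lemma lnorths_cpf pi : lnorths pi = [seq ((xs pi y, y%:Z), lab pi y) | y <- iota 0 n].
Proof.
rewrite /lnorths norths_cpf -[in LHS](mkseq_nth 0%N (labels pi)) /mkseq size_labels.
by rewrite zip_map.
Qed.

Lemma mem_easts_cpf pi x z : (x, z) \in easts (cpath pi) <->
  exists2 y, (y < n)%N & z = y.+1%:Z /\ xs pi y <= x < xs' pi y.+1.
Proof.
have [a [es [E szE smE xE xE']]] := cpf_pathword pi.
rewrite /cpath E; split.
  case/mem_easts_pathword => y; rewrite szE => yn [-> h]; exists y => //.
  by rewrite xE // xE' //= add0r.
case=> y yn [-> h]; apply/mem_easts_pathword; exists y; rewrite ?szE //=.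
by rewrite -xE // -xE' // add0r.
Qed.

Lemma thru_originE pi : thru_origin pi = ((pt pi 0).1 == 0%N).
Proof.
have [a [es [E szE smE xE xE']]] := cpf_pathword pi.
rewrite /pt /= xE // xpart0 mulr0 sub0r.
apply/idP/eqP => [|h]; rewrite /thru_origin /cpath E.
  by case/mem_vertices_pathword => [[h]|[i _ []]] //; rewrite -h mulr0.
apply/mem_vertices_pathword; left; congr pair; nia.
Qed.

Lemma pt_mod pi y : (y < n)%N -> (pt pi y).1 = m * y %[mod n].
Proof.
move=> /(ptE pi) E; apply/eqP.
suff : ((pt pi y).1%:Z == (m * y)%N%:Z %[mod n])%Z by rewrite -eqz_nat !modz_nat.
by rewrite E eqz_mod_dvd PoszM; apply/dvdzP; exists (- xs pi y); ring.
Qed.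

Lemma pt_pos pi y : (y < n)%N -> (0 < lab pi y)%N.
Proof.
move=> yn; have [a [es [E _ _ _ _]]] := cpf_pathword pi.
have := cpf_valP pi; rewrite E => /(is_cpfE m_gt0 n_gt0)[_ /allP H _ _].
by apply: H; apply: mem_nth; rewrite size_labels.
Qed.

Lemma xs'_mod pi y : (y < n)%N ->
  ((pt pi (y.+1 %% n)).1%:Z = m%:Z * y.+1%:Z - n%:Z * xs' pi y.+1) *
  ((pt pi (y.+1 %% n)).2 = lab pi (y.+1 %% n)).
Proof.
move=> yn; split=> //; rewrite ptE ?ltn_mod // /xs'; case: ltnP => h.
  by rewrite modn_small.
have -> : y.+1 = n by apply/eqP; rewrite eqn_leq h yn.
by rewrite modnn; ring.
Qed.

(** After the shift by m, the contents differ by n times the opposite difference of abscissas. *)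
Lemma content_step_cmp (c c' y : nat) (x x' : int) :
  c%:Z = m%:Z * y%:Z - n%:Z * x -> c'%:Z = m%:Z * y.+1%:Z - n%:Z * x' ->
  (((c + m)%N < c')%N = (x' < x)) * (((c + m)%N == c') = (x' == x)).
Proof.
move=> E E'.
have D : c'%:Z - (c + m)%N%:Z = n%:Z * (x - x') by rewrite PoszD E E' intS; ring.
have n0 : 0 < n%:Z by [].
split.
  by rewrite -[x' < x]subr_gt0 -(pmulr_rgt0 _ n0) -D subr_gt0 ltz_nat.
rewrite [x' == x]eq_sym -[x == x']subr_eq0.
have -> : (x - x' == 0) = (n%:Z * (x - x') == 0) by rewrite mulf_eq0 (gt_eqF n0).
by rewrite -D subr_eq0 eqz_nat eq_sym.
Qed.

Lemma shp_leE pi pi' y : (y < n)%N ->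
  (shp (pt pi y) <= pt pi' (y.+1 %% n))%O = (xs' pi' y.+1 < xs pi y) ||
    (xs' pi' y.+1 == xs pi y) && (lab pi' (y.+1 %% n) <= lab pi y)%N.
Proof.
move=> yn; have [E1 E2] := content_step_cmp (ptE pi yn) (xs'_mod pi' yn).1.
by rewrite le_pnt E1 E2.
Qed.

Lemma shp_gtE pi pi' y : (y < n)%N ->
  (pt pi' (y.+1 %% n) < shp (pt pi y))%O = (xs pi y < xs' pi' y.+1) ||
    (xs' pi' y.+1 == xs pi y) && (lab pi y < lab pi' (y.+1 %% n))%N.
Proof.
move=> yn; rewrite ltNge shp_leE // negb_or negb_and -leNgt -ltnNge.
by case: (ltgtP (xs pi y)).
Qed.

(** East steps between the two rows lower the content; if there are none the label increases, which
    lowers the point at equal content. *)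
Lemma pt_next pi y : (y < n)%N -> (pt pi (y.+1 %% n) < shp (pt pi y))%O.
Proof.
move=> yn; rewrite shp_gtE //; have [a [es [E szE smE xE xE']]] := cpf_pathword pi.
have := cpf_valP pi; rewrite E => /(is_cpfE m_gt0 n_gt0)[_ _ _ /(_ _ yn) H].
rewrite xE' // xE // xpart_next ?szE //.
have [e0|e0] := eqVneq (nth 0%N es y) 0%N; last by apply/orP; left; lia.
by rewrite e0 addr0 eqxx H ?orbT.
Qed.

Lemma cyclic_lnorths_cpf pi : cyclic_lnorths pi =
  [seq ((xs' pi y, y%:Z), lab pi (y %% n)) | y <- iota 0 n.+1].
Proof.
have -> : iota 0 n.+1 = iota 0 n ++ [:: n] by rewrite -addn1 iotaD.
rewrite /cyclic_lnorths lnorths_cpf map_cat; congr (_ ++ _).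
  by apply/eq_in_map => y; rewrite mem_iota /= /xs' => yn; rewrite yn modn_small.
rewrite -map_take (_ : take 1 (iota 0 n) = [:: 0%N]); last by case: (n) n_gt0 => //= k _;
    rewrite take0.
by rewrite /= /xs' ltnn modnn add0r.
Qed.

(** Row y + 1 of pi' cannot be to the right of row y of pi: the east step of pi that leaves the top
    of its north step in row y would then be shared. Labels decide when the abscissas agree. *)
Lemma precP pi pi' : reflect
  (forall y, (y < n)%N -> (shp (pt pi y) <= pt pi' (y.+1 %% n))%O) (prec pi pi').
Proof.
have wlE : reflect (forall y, (y < n)%N -> xs pi' y <= xs pi y)
    (weakly_left (cpath pi') (cpath pi)).
  rewrite /weakly_left !norths_cpf; apply: (iffP idP) => [|H].
    rewrite all2E zip_map => /andP[_ /allP H] y yn.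
    by apply: (H ((xs pi' y, y%:Z), (xs pi y, y%:Z))); apply: map_f; rewrite mem_iota.
  rewrite all2E zip_map !size_map eqxx /=; apply/allP => _ /mapP[y + ->].
  by rewrite mem_iota /=; apply: H.
have lbE : reflect (forall y, (y < n)%N -> xs' pi' y.+1 = xs pi y ->
      (lab pi' (y.+1 %% n) <= lab pi y)%N)
    (all (fun p : (point2 * nat) * (point2 * nat) =>
             (step_end p.1.1 true == p.2.1) ==> (p.2.2 <= p.1.2)%N)
          [seq (N, N') | N <- lnorths pi, N' <- cyclic_lnorths pi']).
  rewrite lnorths_cpf cyclic_lnorths_cpf.
  have := mem_iota 0 n.+1; move: (iota 0 n.+1) => r mem_r; apply: (iffP allP) => H.
    move=> y yn xE.
    have yin : y \in iota 0 n by rewrite mem_iota.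
    have yin' : y.+1 \in r by rewrite mem_r.
    have := H _ (allpairs_f (fun s s' => (s, s')) (map_f _ yin) (map_f _ yin')).
    by move/implyP; apply; rewrite /= xE; apply/eqP; congr pair; lia.
  move=> _ /allpairsP[[s s'] /= [hs hs' ->]] /=.
  case/mapP: hs => i iin ->; case/mapP: hs' => j jin ->; rewrite /=.
  apply/implyP => /eqP[xE jE]; move: iin jin; rewrite mem_iota mem_r /= => iin jin.
  have {jE} jE : j = i.+1 by lia.
  by subst j; apply: H.
apply: (iffP and3P) => [[/wlE wl /hasPn ne /lbE lb] y yn|H].
  rewrite shp_leE //; case: ltgtP => [//|lt|xE] /=; last exact: lb.
  have wl' : xs' pi' y.+1 <= xs' pi y.+1.
    by rewrite /xs'; case: ltnP => h; [exact: wl|rewrite lerD2r; exact: wl].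
  have /ne : (xs pi y, y.+1%:Z) \in easts (cpath pi').
    by apply/mem_easts_cpf; exists y => //; rewrite wl.
  case/negP; apply/mem_easts_cpf; exists y => //.
  by rewrite lexx (lt_le_trans lt).
have le1 y : (y < n)%N -> xs' pi' y.+1 <= xs pi y.
  by move=> yn; have := H y yn; rewrite shp_leE // => /orP[/ltW//|/andP[/eqP-> _]].
split.
- apply/wlE => y yn; have [->|y0] := posnP y.
    have yn' : (n.-1 < n)%N by rewrite prednK.
    have := le1 _ yn'; have := xs'_le pi yn'; rewrite prednK // /xs' ltnn.
    by move=> h1 h2; have := le_trans h2 h1; rewrite lerD2r.
  have yn' : (y.-1 < n)%N by apply: leq_ltn_trans (leq_pred _) yn.
  have := le1 _ yn'; have := xs'_le pi yn'; rewrite prednK // /xs' yn.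
  by move=> h1 h2; apply: le_trans h2 h1.
- apply/hasPn => -[x z] /mem_easts_cpf[y yn [-> /andP[_ lt]]].
  apply/negP => /mem_easts_cpf[y' yn' [yE /andP[le _]]].
  have {yE} yE : y' = y by lia.
  by subst y'; have := lt_le_trans lt (le1 _ yn); rewrite ltNge le.
- apply/lbE => y yn xE; have := H y yn.
  by rewrite shp_leE // xE ltxx eqxx.
Qed.

Lemma cpf_inj pi pi' : (forall y, (y < n)%N -> pt pi y = pt pi' y) -> pi = pi'.
Proof.
move=> H; apply: val_inj => /=.
have [a [es [E szE smE xE xE']]] := cpf_pathword pi.
have [b [fs [F szF smF yE yE']]] := cpf_pathword pi'.
have xx y : (y < n)%N -> xs pi y = xs pi' y.
  move=> yn; have := ptE pi yn; rewrite H // (ptE pi' yn) => /addrI/oppr_inj h.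
  have n0 : n%:Z != 0 by rewrite eqz_nat -lt0n.
  exact/esym/(mulfI n0 h).
have xx' y : (y <= n)%N -> xs' pi y = xs' pi' y.
  by move=> yn; rewrite /xs' (xx 0%N) //; case: ltnP => // h; rewrite xx.
rewrite E F; have -> : labels pi = labels pi'.
  apply: (@eq_from_nth _ 0%N) => [|y]; rewrite size_labels ?size_labels // => yn.
  by case: (H y yn).
have ab : a = b by have := xx _ n_gt0; rewrite xE // yE // !xpart0; lia.
have -> : es = fs.
  apply: (@eq_from_nth _ 0%N) => [|y]; rewrite szE ?szF // => yn.
  have := xx' _ yn; rewrite xE' // yE' // !xpart_next ?szE ?szF //.
  by have := xx _ yn; rewrite xE // yE //; lia.
by rewrite ab.
Qed.

(** The congruence makes the abscissas integers, and the inequality makes them weakly increasing, so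
    that their differences are the numbers of east steps; in row n the abscissa is that of row 0
    plus m. *)
Lemma cpf_of_points (v : nat -> pnt) :
  (forall y, (y < n)%N -> [/\ (v y).1 = m * y %[mod n], (0 < ((v y).2 : nat))%N
     & (v (y.+1 %% n)%N < shp (v y))%O]) ->
  exists pi : cPF, forall y, (y < n)%N -> pt pi y = v y.
Proof.
move=> H.
pose x y : int := if (y < n)%N then (((m * y)%N%:Z - (v y).1%:Z) %/ n%:Z)%Z
                  else - ((v 0).1 %/ n)%N%:Z + m%:Z.
have xE y : (y < n)%N -> (v y).1%:Z = m%:Z * y%:Z - n%:Z * x y.
  move=> yn; rewrite /x yn; have [vm _ _] := H _ yn.
  have /dvdzP[k kE] : (n%:Z %| (m * y)%N%:Z - (v y).1%:Z)%Z.
    by rewrite -eqz_mod_dvd !modz_nat vm.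
  rewrite kE mulzK ?eqz_nat -?lt0n //; move: kE; rewrite PoszM; lia.
have xn : x n = x 0%N + m%:Z.
  rewrite /x ltnn n_gt0 muln0 sub0r; congr (_ + _).
  have /dvdnP[k ->] : (n %| (v 0).1)%N.
    by have [/eqP + _ _] := H _ n_gt0; rewrite muln0 mod0n.
  by rewrite mulnK // PoszM -mulNr mulzK ?eqz_nat -?lt0n.
have xS y : (y < n)%N -> (v (y.+1 %% n)%N).1%:Z = m%:Z * y.+1%:Z - n%:Z * x y.+1.
  move=> yn; have [h|h] := ltnP y.+1 n; first by rewrite modn_small // xE.
  have -> : y.+1 = n by apply/eqP; rewrite eqn_leq h yn.
  by rewrite modnn xE // xn; ring.
have xle y : (y < n)%N -> x y <= x y.+1.
  move=> yn; have [_ _] := H y yn; rewrite ltNge le_pnt negb_or => /andP[+ _].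
  by rewrite (content_step_cmp (xE _ yn) (xS _ yn)).1 -leNgt.
pose es := [seq absz (x y.+1 - x y) | y <- iota 0 n].
pose ls : seq nat := [seq ((v y).2 : nat) | y <- iota 0 n].
pose a := absz (x 0%N).
have szE : size es = n by rewrite size_map size_iota.
have slE : size ls = n by rewrite size_map size_iota.
have x0 : - a%:Z = x 0%N.
  by have := xE 0%N n_gt0; rewrite /a; nia.
have esE y : (y < n)%N -> (nth 0%N es y)%:Z = x y.+1 - x y.
  move=> yn; rewrite (nth_map 0%N) ?size_iota // nth_iota // add0n.
  by rewrite gez0_abs // subr_ge0 xle.
have lsE y : (y < n)%N -> nth 0%N ls y = (v y).2.
  by move=> yn; rewrite (nth_map 0%N) ?size_iota // nth_iota.
have xpE y : (y <= n)%N -> xpart (- a%:Z) es y = x y.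
  elim: y => [|y IH] yn; first by rewrite xpart0.
  by rewrite xpart_next ?szE // IH 1?ltnW // esE // addrC subrK.
have ok : is_cpf m n ((a, pathword es), ls).
  apply/(is_cpfE m_gt0 n_gt0); split=> //.
  - split=> //; have := xpart_size (- a%:Z) es; rewrite szE xpE // xn x0; lia.
  - by apply/allP => _ /mapP[y + ->]; rewrite mem_iota /= => yn; have [] := H y yn.
  - by move=> y yn; rewrite xpE 1?ltnW // -subr_ge0 -xE.
  move=> y yn ey; rewrite !lsE ?ltn_mod //; have := esE y yn; rewrite ey => e0.
  have [_ _] := H y yn; rewrite lt_pnt /=.
  have /eqP <- : ((v y).1 + m)%N == (v (y.+1 %% n)%N).1.
    by rewrite (content_step_cmp (xE _ yn) (xS _ yn)).2 -subr_eq0 -e0.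
  by rewrite ltnn eqxx.
exists (CPF ok) => y yn.
have xsE : xs (CPF ok) y = x y.
  rewrite /xs /cpath /= /norths /path_steps norths_pathword szE.
  by rewrite (nth_map 0%N) ?size_iota // nth_iota // xpE 1?ltnW.
rewrite [LHS]surjective_pairing [RHS]surjective_pairing; congr pair; last first.
  by rewrite /pt /= /lab /labels /= lsE.
by rewrite /pt /= xsE -xE.
Qed.
End Points.

Arguments pt {m n} pi y : simpl never.

(** * The statistic as a sum over pairs of north steps *)

Section Statistic.
Variables m n : nat.
Hypotheses (m_gt0 : (0 < m)%N) (n_gt0 : (0 < n)%N) (co_mn : coprime m n).
Local Notation cPF := (cPF m n).
Local Notation shp := (shp m).
Implicit Types (pi : cPF) (t : seq cPF).

Lemma walk_telescope (K : point2 -> int) p w :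
  \sum_(s <- walk p w) (K (step_end s.1 s.2) - K s.1) = K (walk_end p w) - K p.
Proof.
elim: w p => [|d w IH] p; first by rewrite big_nil subrr.
by rewrite /= big_cons IH /= addrC addrA subrK.
Qed.

Definition cont (v : point2) : int := m%:Z * v.2 - n%:Z * v.1.

(** Both ends of the path have the same content, being (m, n)-translates. So the variations of H
    (cont - m) along the east steps, which lower the content by n, and along the north steps, which
    raise it by m, cancel. *)
Lemma easts_telescope pi (H : int -> int) :
  \sum_(E <- easts (cpath pi)) (H (cont E - m%:Z) - H (cont E - m%:Z - n%:Z))
  = \sum_(y <- iota 0 n) (H (pt pi y).1%:Z - H ((pt pi y).1%:Z - m%:Z)).
Proof.
have := walk_telescope (fun v => H (cont v - m%:Z)) (path_start (cpath pi)) (cpath pi).2.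
have [a [es [E szE smE xE xE']]] := cpf_pathword m_gt0 n_gt0 pi.
have wE : (cpath pi).2 = pathword es by rewrite /cpath E.
have cfE : count_mem false (cpath pi).2 = m by rewrite wE count_false_pathword.
have ctE : count_mem true (cpath pi).2 = n by rewrite wE count_true_pathword.
rewrite walk_endE cfE ctE.
rewrite [X in _ = X -> _](_ : _ = 0); last first.
  apply/eqP; rewrite subr_eq0; apply/eqP; congr (H _); rewrite /cont /path_start /=; ring.
rewrite -/(path_steps (cpath pi)) (bigID (fun s : point2 * bool => s.2)) /= => /eqP.
rewrite addrC addr_eq0 => /eqP E1.
rewrite /easts big_map big_filter -[LHS]opprK -sumrN.
rewrite (eq_bigr (fun s : point2 * bool => H (cont (step_end s.1 s.2) - m%:Z) - H
    (cont s.1 - m%:Z))); last first.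
  move=> [v []] //= _; rewrite opprB; congr (H _ - _).
  rewrite /cont /=; ring.
rewrite E1 opprK.
have -> : \sum_(y <- iota 0 n) (H (pt pi y).1%:Z - H ((pt pi y).1%:Z - m%:Z))
    = \sum_(v <- norths (cpath pi)) (H (cont v) - H (cont v - m%:Z)).
  rewrite norths_cpf // big_map; apply: eq_big_seq => y; rewrite mem_iota /= => yn.
  by rewrite ptE.
rewrite /norths big_map big_filter; apply: eq_bigr => -[v []] //= _; congr (H _ - _).
rewrite /cont /=; ring.
Qed.

(* The number of contents congruent to x modulo n strictly between 0 and x. *)
Definition bnd (x : int) : int := if 0 < x then ((x - 1) %/ n%:Z)%Z else 0.

(** [bnd] sums the indicator of positive integers along steps of n. Through [easts_telescope], this
    turns the east steps of [pdinv] into north steps. *)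
Lemma bnd_addn x : bnd (x + n%:Z) - bnd x = (0 < x)%R%:Z.
Proof.
rewrite /bnd; case: (ltP 0 x) => x0.
  rewrite ifT; last by lia.
  have -> : x + n%:Z - 1 = 1 * n%:Z + (x - 1) by ring.
  by rewrite divzMDl ?eqz_nat -?lt0n // addrK.
rewrite subr0; case: ifP => // h; rewrite divz_small //; apply/andP; split; lia.
Qed.

Lemma bnd_succ (x : int) : bnd (x + 1) - bnd x = ((0 < x)%R && (n%:Z %| x)%Z)%:Z.
Proof.
rewrite /bnd; case: (ltP 0 x) => x0 /=; last first.
  rewrite subr0; case: ifP => // h; have -> : x = 0 by lia.
  by rewrite add0r subrr div0z.
rewrite ifT; last by lia.
rewrite addrK; have n0 : n%:Z != 0 by rewrite eqz_nat -lt0n.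
case: (boolP (n%:Z %| x)%Z) => [/dvdzP[k kE]|nd].
  subst x; have -> : k * n%:Z - 1 = (k - 1) * n%:Z + (n%:Z - 1) by ring.
  rewrite mulzK // divzMDl // (@divz_small (n%:Z - 1)) ?addr0; first by rewrite opprB addrC subrK.
  by apply/andP; split; lia.
have nz : (x %% n%:Z)%Z != 0 by apply: contra nd => /eqP/dvdz_mod0P.
have ge := modz_ge0 x n0; have np : 0 < n%:Z by rewrite ltz_nat.
have lt := ltz_pmod x np.
rewrite {2}(divz_eq x n%:Z) -addrA divzMDl // (@divz_small (_ - 1)) ?addr0 ?subrr //.
by apply/andP; split; lia.
Qed.

(* [b1] and [b2] tell whether the sheet of v is before, resp. after, the sheet
   of v'. *)
Definition pairwt (b1 b2 : bool) (v v' : pnt) : int :=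
  let d := v'.1%:Z - v.1%:Z in
  bnd (d + b1%:Z) - bnd (d - m%:Z + b1%:Z)
  + [&& 0 < d + b1%:Z, d < m%:Z + b2%:Z & ((v'.2 : nat) <= v.2)%N]%:Z.

Definition pairwts b1 b2 pi pi' : int :=
  \sum_(y <- iota 0 n) \sum_(y' <- iota 0 n) pairwt b1 b2 (pt pi y) (pt pi' y').

Lemma mem_sheets t s : s \in sheets t -> (s.1 < size t)%N /\ s.2 \in t.
Proof.
rewrite /sheets => st; split; last first.
  have := map_f snd st; rewrite -/(unzip2 _) unzip2_zip ?size_iota //.
have := map_f fst st; rewrite -/(unzip1 _) unzip1_zip ?size_iota //.
by rewrite mem_iota.
Qed.

(** Sheet indices are smaller than k, so that they only break ties. *)
Lemma sheet_lt (k i j : nat) (c e : int) : (i < k)%N -> (j < k)%N ->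
  (k%:Z * c + i%:Z < k%:Z * e + j%:Z) = (0 < e - c + (i < j)%N%:Z).
Proof. by move=> ik jk; apply/idP/idP; case: (ltnP i j) => ij /=; nia. Qed.

Lemma count_allpairs (S S' : Type) (P : pred (S * S')) (r : seq S) (r' : seq S') :
  (count P [seq (x, y) | x <- r, y <- r'])%:Z
  = \sum_(x <- r) \sum_(y <- r') (P (x, y))%:Z.
Proof.
elim: r => [|x r IH]; first by rewrite big_nil.
rewrite /= big_cons count_cat PoszD IH; congr (_ + _).
by elim: r' {IH} => [|y r' IH]; rewrite /= ?big_nil // big_cons PoszD IH.
Qed.

Lemma sum_tuple_norths t (F : int * nat -> int) :
  \sum_(N <- tuple_norths t) F N = \sum_(s <- sheets t) \sum_(y <- iota 0 n)
    F ((size t)%:Z * (pt s.2 y).1%:Z + s.1%:Z, lab s.2 y).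
Proof.
rewrite /tuple_norths big_allpairs_dep; apply: eq_bigr => s _.
rewrite lnorths_cpf // big_map; apply: eq_big_seq => y; rewrite mem_iota /= => yn.
by rewrite ptE.
Qed.

Lemma sum_tuple_easts t (F : int -> int) :
  \sum_(E <- tuple_easts t) F E = \sum_(s <- sheets t) \sum_(E <- easts (cpath s.2))
    F ((size t)%:Z * (cont E - m%:Z - n%:Z) + s.1%:Z).
Proof.
rewrite /tuple_easts big_allpairs_dep; apply: eq_bigr => s _; apply: eq_bigr => E _.
by congr F; rewrite /econtent /content /cont /=; ring.
Qed.

Lemma pdinv_ldinv t : (pdinv t)%:Z + (ldinv t)%:Z =
  \sum_(s <- sheets t) \sum_(s' <- sheets t)
     pairwts (s.1 < s'.1)%N (s'.1 < s.1)%N s.2 s'.2.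
Proof.
rewrite /pdinv /ldinv !count_allpairs !sum_tuple_norths -big_split /=.
apply: eq_big_seq => s /mem_sheets[sk _]; rewrite -big_split /= /pairwts.
rewrite [RHS]exchange_big; apply: eq_bigr => y _.
rewrite sum_tuple_easts sum_tuple_norths -big_split /=.
apply: eq_big_seq => s' /mem_sheets[sk' _].
pose b := (s.1 < s'.1)%N%:Z.
have -> : \sum_(E <- easts (cpath s'.2)) ((size t)%:Z * (pt s.2 y).1%:Z + s.1%:Z
      < (size t)%:Z * (cont E - m%:Z - n%:Z) + s'.1%:Z)%R%:Z
   = \sum_(y' <- iota 0 n) (bnd ((pt s'.2 y').1%:Z - (pt s.2 y).1%:Z + b)
        - bnd ((pt s'.2 y').1%:Z - m%:Z - (pt s.2 y).1%:Z + b)).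
  rewrite -(easts_telescope s'.2 (fun x => bnd (x - (pt s.2 y).1%:Z + b))).
  apply: eq_bigr => E _; rewrite sheet_lt // -bnd_addn; congr (bnd _ - bnd _); ring.
rewrite -big_split; apply: eq_bigr => y' _; rewrite /pairwt /=.
rewrite [_ - m%:Z - _]addrAC; congr (_ + _).
rewrite sheet_lt // /b; congr (Posz (nat_of_bool [&& _, _ & _])).
rewrite PoszM -[X in _ < X]addrA [s.1%:Z + _]addrC addrA -mulrDr sheet_lt //.
move: (nat_of_bool (s'.1 < s.1)%N) => z; by apply/idP/idP; lia.
Qed.

(** Coprimality enters here: the residue of a content modulo n determines its row. *)
Lemma row_eqmod y y' : (y < n)%N -> (y' < n)%N ->
  (n%:Z %| (m * y')%N%:Z - (m * y)%N%:Z)%Z = (y == y').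
Proof.
move=> yn yn'; rewrite !PoszM -mulrBr Gauss_dvdzr; last by rewrite coprimezE /= coprime_sym.
apply/idP/eqP => [/dvdzP[k kE]|->]; last by rewrite subrr dvdz0.
have : k = 0 by nia.
by move=> k0; move: kE; rewrite k0 mul0r; lia.
Qed.

Lemma pt_dvd pi pi' y y' : (y < n)%N -> (y' < n)%N ->
  (n%:Z %| (pt pi' y').1%:Z - (pt pi y).1%:Z)%Z = (y == y').
Proof.
move=> yn yn'; rewrite -row_eqmod // -!eqz_mod_dvd !modz_nat.
by rewrite (pt_mod m_gt0 n_gt0 pi' yn') (pt_mod m_gt0 n_gt0 pi yn).
Qed.

Lemma pt_dvd_next pi pi' y y' : (y < n)%N -> (y' < n)%N ->
  (n%:Z %| (pt pi' y').1%:Z - (pt pi y).1%:Z - m%:Z)%Z = ((y.+1 %% n)%N == y').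
Proof.
move=> yn yn'; rewrite -row_eqmod ?ltn_mod // -addrA -opprD -PoszD -!eqz_mod_dvd !modz_nat.
rewrite (pt_mod m_gt0 n_gt0 pi' yn') modnMmr mulnS.
by rewrite -modnDml (pt_mod m_gt0 n_gt0 pi yn) modnDml addnC.
Qed.

(** With d the difference of contents, exchanging the sheets shifts the arguments of [bnd] by 1,
    which [bnd_succ] sees only if n divides d (equal rows) or d - m (consecutive rows). It also
    moves the bounds of the label condition, at d = 0 and d = m; together these give the comparisons
    of points. *)
Lemma pairwt_swap pi pi' y y' : (y < n)%N -> (y' < n)%N ->
  pairwt true false (pt pi y) (pt pi' y') = pairwt false true (pt pi y) (pt pi' y')
  + (((y == y') && (pt pi y <= pt pi' y')%O)%:Z
     - (((y.+1 %% n)%N == y') && (shp (pt pi y) <= pt pi' y')%O)%:Z).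
Proof.
move=> yn yn'; rewrite /pairwt.
have := pt_dvd pi pi' yn yn'; have := pt_dvd_next pi pi' yn yn'.
rewrite !le_pnt -[(shp _).1]/(_ + m)%N -[(shp _).2]/((pt pi y).2).
move: (pt pi y).1 (pt pi' y').1 => c c'; rewrite /=.
move: (_ <= _)%N => L.
have -> : (c < c')%N = (0 < c'%:Z - c%:Z) by apply/idP/idP; lia.
have -> : (c == c') = (c'%:Z - c%:Z == 0) by apply/eqP/eqP; lia.
have -> : (c + m < c')%N = (m%:Z < c'%:Z - c%:Z) by apply/idP/idP; lia.
have -> : ((c + m)%N == c') = (c'%:Z - c%:Z == m%:Z) by apply/eqP/eqP; lia.
move: (c'%:Z - c%:Z) => d {c c'}.
have d0 : d = 0 -> (n%:Z %| d)%Z by move=> ->; rewrite dvdz0.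
have dm : d = m%:Z -> (n%:Z %| d - m%:Z)%Z by move=> ->; rewrite subrr dvdz0.
move: (bnd_succ d) (bnd_succ (d - m%:Z)) d0 dm; rewrite !addr0 => B1 B2 d0 dm E2 E1.
move: B1 B2 d0 dm; rewrite E1 E2 {E1 E2}.
move: (_ == y') (_ == y') => e2 e1.
move: (bnd (d + 1)) (bnd d) (bnd (d - m%:Z + 1)) (bnd (d - m%:Z)) => b1 b2 b3 b4.
have m0 : 0 < m%:Z by [].
have -> : (0 < d + 1) = (0 <= d) by apply/idP/idP; lia.
have -> : (d < m%:Z + 1) = (d <= m%:Z) by apply/idP/idP; lia.
have -> : (0 < d - m%:Z) = (m%:Z < d) by apply/idP/idP; lia.
move=> B1 B2 d0 dm; move: B1 B2.
case: (ltgtP d 0) d0 => [dl|dg|dE] d0; case: (ltgtP d m%:Z) dm => [el|eg|eE] dm;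
  try (by exfalso; lia);
  (have {d0} e1E : e1 || (d != 0) by case: eqP => [/d0->//|_]; rewrite orbT);
  (have {dm} e2E : e2 || (d != m%:Z) by case: eqP => [/dm->//|_]; rewrite orbT);
  case: L; case: e1 e1E => /= e1E; case: e2 e2E => /= e2E B1 B2; lia.
Qed.

(** The two sides could only differ at contents exactly m apart, where [pt_next] rules out the label
    condition. *)
Lemma pairwt_diag pi y y' : (y < n)%N -> (y' < n)%N ->
  pairwt false false (pt pi y) (pt pi y') = pairwt false true (pt pi y) (pt pi y').
Proof.
move=> yn yn'; rewrite /pairwt; congr (_ + (nat_of_bool _)%:Z).
apply/and3P/and3P => -[h0 h1 h2]; split=> //; first by lia.
rewrite addr0 lt_neqAle; apply/andP; split; last by lia.
apply/eqP => dm.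
have : (y.+1 %% n)%N == y' by rewrite -(pt_dvd_next pi pi yn yn') dm subrr dvdz0.
move/eqP => yE; have := pt_next m_gt0 n_gt0 pi yn.
have E : (pt pi y').1 = ((pt pi y).1 + m)%N by lia.
by rewrite yE lt_pnt -[(shp _).1]/(_ + m)%N E ltnn eqxx /= ltnNge h2.
Qed.

(* The part of the statistic that depends on the order of the two sheets. *)
Definition sheetinv pi pi' : int :=
  \sum_(y <- iota 0 n) ((pt pi y <= pt pi' y)%O%:Z
     - (shp (pt pi y) <= pt pi' (y.+1 %% n))%O%:Z).

Fixpoint sheetinvs t : int :=
  if t is pi :: t' then \sum_(pi' <- t') sheetinv pi pi' + sheetinvs t' else 0.

(** Every ordered pair is weighed as if its first entry lay in the later sheet, so that the order of
    the tuple does not matter. *)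
Definition symwt t : int := \sum_(pi <- t) \sum_(pi' <- t) pairwts false true pi pi'.

Definition statbase (k : nat) : int :=
  (((m%:Z * k%:Z - 1) * (n%:Z * k%:Z - 1) + k%:Z - 1) %/ 2)%Z.

Lemma sum_iota_pred1 (P : pred nat) y : (y < n)%N ->
  \sum_(y' <- iota 0 n) ((y == y') && P y')%:Z = (P y)%:Z.
Proof.
move=> yn; rewrite (bigD1_seq y) ?mem_iota ?iota_uniq //= eqxx big1 ?addr0 //.
by move=> y'; rewrite eq_sym => /negPf->.
Qed.

Lemma pairwts_swap pi pi' :
  pairwts true false pi pi' = pairwts false true pi pi' + sheetinv pi pi'.
Proof.
rewrite /pairwts /sheetinv -big_split; apply: eq_big_seq => y; rewrite mem_iota /= => yn.
rewrite -(sum_iota_pred1 (fun y' => pt pi y <= pt pi' y')%O yn).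
have y1n : (y.+1 %% n < n)%N by rewrite ltn_mod.
rewrite -(sum_iota_pred1 (fun y' => shp (pt pi y) <= pt pi' y')%O y1n).
rewrite -sumrB -big_split; apply: eq_big_seq => y'; rewrite mem_iota /= => yn'.
exact: pairwt_swap.
Qed.

Lemma pairwts_diag pi : pairwts false false pi pi = pairwts false true pi pi.
Proof.
apply: eq_big_seq => y; rewrite mem_iota /= => yn.
by apply: eq_big_seq => y'; rewrite mem_iota /= => yn'; apply: pairwt_diag.
Qed.

Lemma sheets_inj t s s' : s \in sheets t -> s' \in sheets t -> s.1 = s'.1 -> s = s'.
Proof.
move=> /(nthP s)[i + <-] /(nthP s)[j + <-].
rewrite !size_zip !size_iota minnn => ik jk.
by case: s => a pi; rewrite !nth_zip ?size_iota // !nth_iota //= !add0n => ->.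
Qed.

Lemma sum_sheets t (F : cPF -> int) : \sum_(s <- sheets t) F s.2 = \sum_(pi <- t) F pi.
Proof. by rewrite -(big_map snd xpredT) -/(unzip2 _) unzip2_zip ?size_iota. Qed.

Lemma sum_sheetinvs t : \sum_(s <- sheets t) \sum_(s' <- sheets t)
  (s.1 < s'.1)%N%:Z * sheetinv s.2 s'.2 = sheetinvs t.
Proof.
rewrite /sheets; move: 0%N; elim: t => [|pi t IH] i; first by rewrite /= big_nil.
rewrite /= !big_cons /= ltnn mul0r add0r; congr (_ + _).
  rewrite -[t in RHS](@unzip2_zip _ _ (iota i.+1 (size t))) ?size_iota // big_map.
  apply: eq_big_seq => -[j pi'] /(map_f fst); rewrite -/(unzip1 _) unzip1_zip ?size_iota //.
  by rewrite mem_iota /= => /andP[-> _]; rewrite mul1r.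
rewrite -(IH i.+1); apply: eq_big_seq => -[j pi'] /(map_f fst).
rewrite -/(unzip1 _) unzip1_zip ?size_iota // mem_iota /= big_cons /= => /andP[ij _].
by rewrite ltnNge (ltnW ij) mul0r add0r.
Qed.

Lemma statE t : stat t = statbase (size t) - symwt t - sheetinvs t.
Proof.
have E : (pdinv t)%:Z + (ldinv t)%:Z = symwt t + sheetinvs t.
  rewrite pdinv_ldinv -sum_sheetinvs /symwt.
  rewrite -(sum_sheets t (fun pi => \sum_(pi' <- t) pairwts false true pi pi')) -big_split.
  apply: eq_big_seq => s sin; rewrite -(sum_sheets t (pairwts false true s.2)) -big_split.
  apply: eq_big_seq => s' sin' /=; case: (ltngtP s.1 s'.1) => [_|_|ss].
  - by rewrite pairwts_swap mul1r.
  - by rewrite mul0r addr0.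
  by rewrite (sheets_inj sin sin' ss) pairwts_diag mul0r addr0.
rewrite /stat; case: eqP => [/size0nil->|_].
  rewrite /symwt big_nil !subr0 /statbase.
  have -> : (m%:Z * 0%N%:Z - 1) * (n%:Z * 0%N%:Z - 1) + 0%N%:Z - 1 = 0 by ring.
  by rewrite div0z.
by rewrite -[RHS]addrA -opprD -E opprD addrA.
Qed.
End Statistic.

(** * Chains as interlacing rows *)

Lemma interlaceP (disp : Order.disp_t) (T : orderType disp) (x0 : T) (A B : seq T) :
  reflect [/\ size A = size B,
     forall i, (i < size A)%N -> (nth x0 B i < nth x0 A i)%O
   & forall i, (i.+1 < size A)%N -> (nth x0 A i <= nth x0 B i.+1)%O] (interlace A B).
Proof.
rewrite /interlace; have [szE|szN] := eqVneq (size A) (size B); last first.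
  by constructor=> -[szE]; rewrite szE eqxx in szN.
rewrite /=; apply: (@equivP (forall i, (i < size A)%N ->
    (nth x0 B i < nth x0 A i)%O /\ ((i.+1 < size A)%N -> (nth x0 A i <= nth x0 B i.+1)%O))).
  elim: A B szE => [|a A IH] [|b B] //=; first by constructor.
  move=> [szE]; rewrite lt_wu; apply: (equivP andP).
  have [->|nzA] := eqVneq A [::].
    rewrite /=; split=> [[ba _]|H]; last by split=> //; exact: (H 0%N isT).1.
    by case.
  have -> : path <%O (uev a) (zigzag A B) = (a <= head x0 B)%O && sorted <%O (zigzag A B).
    by case: (A) (B) szE nzA => [|a' A'] [|b' B'] //= _ _; rewrite lt_uw.
  split=> [[ba /andP[ab /(IH _ szE) H]] [|i] hi /=|H]; last split.
  - split=> // _; case: (B) ab => //=.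
  - exact: H.
  - exact: (H 0%N isT).1.
  apply/andP; split; last by apply/(IH _ szE) => i hi; exact: (H i.+1 hi).
  have := (H 0%N isT).2; rewrite /= nth0; apply.
  by case: (A) nzA.
split=> [H|[_ H1 H2] i hi]; last by split; [exact: H1|exact: H2].
by split=> // i hi; [exact: (H i hi).1|exact: (H i (ltnW hi)).2].
Qed.

Lemma interlace_sorted (disp : Order.disp_t) (T : orderType disp) (A B : seq T) :
  interlace A B -> sorted <%O A /\ sorted <%O B.
Proof.
case: A => [|x0 A0]; first by case/andP => /eqP/esym/size0nil->.
move=> /(interlaceP x0)[szE H1 H2]; split; apply/(sortedP x0) => i hi.
  by apply: le_lt_trans (H2 i hi) (H1 _ hi).
by rewrite -szE in hi; apply: lt_le_trans (H1 i (ltnW hi)) (H2 i hi).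
Qed.

Section Chains.
Variables m n : nat.
Hypotheses (m_gt0 : (0 < m)%N) (n_gt0 : (0 < n)%N) (co_mn : coprime m n).
Local Notation cPF := (cPF m n).
Local Notation shp := (shp m).
Implicit Types (pi : cPF) (t : seq cPF) (y : nat).

Definition chain t := sorted (@prec m n) t.
Definition rowp y t : seq pnt := [seq pt pi y | pi <- t].

Lemma size_rowp y t : size (rowp y t) = size t.
Proof. exact: size_map. Qed.

Lemma rowp_cat y t t' : rowp y (t ++ t') = rowp y t ++ rowp y t'.
Proof. exact: map_cat. Qed.

Lemma nth_rowp x0 pi0 y t i : (i < size t)%N -> nth x0 (rowp y t) i = pt (nth pi0 t i) y.
Proof. by move=> it; rewrite (nth_map pi0). Qed.

Lemma chainP t : chain t <->
  forall y, (y < n)%N -> interlace [seq shp v | v <- rowp y t] (rowp (y.+1 %% n) t).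
Proof.
case: t => [|pi0 t']; first by split.
set t := pi0 :: t'; pose x0 : pnt := (0%N, 0%N).
have E y i : (i < size t)%N -> nth x0 (rowp y t) i = pt (nth pi0 t i) y by apply: nth_rowp.
have E' y i : (i < size t)%N -> nth x0 [seq shp v | v <- rowp y t] i = shp (pt (nth pi0 t i) y).
  by move=> it; rewrite (nth_map x0) ?size_rowp // E.
split=> [/(sortedP pi0) H y yn|H].
  apply/(interlaceP x0); rewrite size_map !size_rowp; split=> // i hi.
    by rewrite E // E' //; apply: pt_next.
  by rewrite E // E' 1?ltnW //; apply: (precP m_gt0 n_gt0 _ _ (H i hi)).
apply/(sortedP pi0) => i hi; apply/(precP m_gt0 n_gt0) => y yn.
have /(interlaceP x0)[_ _] := H y yn; rewrite size_map size_rowp => /(_ i hi).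
by rewrite E // E' 1?ltnW.
Qed.

Lemma sorted_map_shp (A : seq pnt) : sorted <%O [seq shp v | v <- A] = sorted <%O A.
Proof. by rewrite sorted_map; apply: eq_sorted => u v; rewrite /= lt_shp. Qed.

Lemma chain_sorted t y : chain t -> (y < n)%N -> sorted <%O (rowp y t).
Proof.
by move=> /chainP H yn; have [] := interlace_sorted (H y yn); rewrite sorted_map_shp.
Qed.

Lemma chain_cons_lt pi t pi' y : chain (pi :: t) -> pi' \in t -> (y < n)%N ->
  (pt pi y < pt pi' y)%O /\ (shp (pt pi y) <= pt pi' (y.+1 %% n))%O.
Proof.
move=> ch pin yn; split.
  have := chain_sorted ch yn; rewrite /= => /(order_path_min lt_trans)/allP; apply.
  exact: map_f.
case: t pin ch => // pi1 t pin ch.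
have y1n : (y.+1 %% n < n)%N by rewrite ltn_mod.
have /andP[pp ch1] : prec pi pi1 && chain (pi1 :: t) by exact: ch.
apply: le_trans (precP m_gt0 n_gt0 _ _ pp y yn) _.
move: pin; rewrite inE => /orP[/eqP->|pin]; first exact: lexx.
have := chain_sorted ch1 y1n; rewrite /= => /(order_path_min lt_trans)/allP/(_ (pt pi'
    (y.+1 %% n))).
by move=> /(_ (map_f _ pin)) /ltW.
Qed.

Lemma chain_behead pi t : chain (pi :: t) -> chain t.
Proof. exact: path_sorted. Qed.

(** In a chain both comparisons of [sheetinv] hold for all pairs and rows, and cancel. *)
Lemma sheetinvs_chain t : chain t -> sheetinvs t = 0.
Proof.
elim: t => //= pi t IH ch; rewrite IH ?addr0; last exact: chain_behead ch.
rewrite big_seq big1 // => pi' pin; rewrite /sheetinv big_seq big1 // => y.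
rewrite mem_iota /= => yn; have [/ltW-> ->] := chain_cons_lt ch pin yn.
by rewrite subrr.
Qed.

(** Contents of row y are congruent to m y modulo n, so that content 0 can only occur in row 0. *)
Definition zeros t : nat := count (fun v : pnt => v.1 == 0%N) (rowp 0 t).

Lemma zeros_chain_cons pi t : chain (pi :: t) -> zeros (pi :: t) = thru_origin pi.
Proof.
move=> ch; rewrite /zeros /= thru_originE //.
suff -> : count (fun v : pnt => v.1 == 0%N) (rowp 0 t) = 0%N by rewrite addn0.
apply/eqP; rewrite -leqn0 leqNgt -has_count; apply/hasPn => _ /mapP[pi' pin ->].
(* The last row of the first entry, shifted by m > 0, bounds row 0 of every later entry from below,
   so that the contents there are positive. *)
have n1 : (n.-1 < n)%N by rewrite prednK.
have [_] := chain_cons_lt ch pin n1; rewrite prednK // modnn le_pnt /=.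
by rewrite -lt0n => /orP[|/andP[/eqP<- _]]; lia.
Qed.

Lemma HbarE a (t : a.-tuple cPF) : @Hbar m n a t <-> chain t /\ zeros t = 1%N.
Proof.
rewrite /Hbar /Hset /=; case: t => -[|pi t] _ /=; first by split=> -[].
by split=> -[ch]; rewrite zeros_chain_cons //; case: thru_origin.
Qed.

Lemma zeros_chain t : chain t -> (zeros t <= 1)%N.
Proof. by case: t => // pi t ch; rewrite zeros_chain_cons ?leq_b1. Qed.

Lemma HhatE a (t : a.-tuple cPF) : @Hhat m n a t <-> chain t /\ zeros t = 0%N.
Proof.
rewrite /Hhat /=; split=> [[ch nb]|[ch z0]]; split=> //.
  have := zeros_chain ch; case E : (zeros t) => [|[|k]] // _.
  by case: nb; apply/HbarE.
by case/HbarE => _; rewrite z0.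
Qed.

(** The row fixes the residue of the content modulo n, so that the quotient and the label determine
    the point: a skeleton amounts to a multiset of points in each row. *)
Definition rvar y (v : pnt) : nat * nat * nat := (y.+1, (v.1 %/ n)%N, v.2 : nat).

Lemma aseq_pt pi y : (y < n)%N -> aseq m n (cpath pi) y.+1 = ((pt pi y).1 %/ n)%N.
Proof.
move=> yn; rewrite /aseq /= -[_.1]/(xs pi y).
have E := ptE m_gt0 n_gt0 pi yn.
have -> : ((m * y) %/ n)%N%:Z - xs pi y = ((pt pi y).1 %/ n)%N%:Z; last by [].
have n0 : n%:Z != 0 by rewrite eqz_nat -lt0n.
rewrite -!divz_nat E (_ : m%:Z * y%:Z - n%:Z * xs pi y = (- xs pi y) * n%:Z + (m * y)%N%:Z);
    last first.
  by rewrite PoszM; ring.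
by rewrite divzMDl // addrC.
Qed.

Lemma skel1E pi : skel1 pi = \big[@mmul _/@mone _]_(y <- iota 0 n) ucm (rvar y (pt pi y)).
Proof.
rewrite /skel1 big_add1 /= /index_iota subn0.
by apply: eq_big_seq => y; rewrite mem_iota /= => yn; rewrite aseq_pt.
Qed.

Lemma skelE t : skel t =
  \big[@mmul _/@mone _]_(y <- iota 0 n) \big[@mmul _/@mone _]_(v <- rowp y t) ucm (rvar y v).
Proof.
rewrite /skel (eq_bigr _ (fun pi _ => skel1E pi)) exchange_big /=.
by apply: eq_bigr => y _; rewrite big_map.
Qed.

End Chains.

Lemma big_mmul_coef (I : choiceType) (J : Type) (r : seq J) (F : J -> {cmonom I}) x :
  (\big[@mmul _/@mone _]_(j <- r) F j) x = (\sum_(j <- r) F j x)%N.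
Proof.
elim: r => [|j r IH]; first by rewrite !big_nil cm1.
by rewrite !big_cons cmM IH.
Qed.

(** * Skeletons and the exponents of q *)

Section Skeletons.
Variables m n : nat.
Hypotheses (m_gt0 : (0 < m)%N) (n_gt0 : (0 < n)%N) (co_mn : coprime m n).
Local Notation cPF := (cPF m n).
Local Notation shp := (shp m).
Implicit Types (pi : cPF) (t : seq cPF) (y : nat).

Lemma rowp_mem t y v : (y < n)%N -> v \in rowp y t ->
  v.1 = m * y %[mod n] /\ (0 < (v.2 : nat))%N.
Proof.
move=> yn /mapP[pi _ ->]; split; first exact: pt_mod.
exact: pt_pos.
Qed.

Lemma rvar_inj y y' v v' : (y < n)%N -> v.1 = m * y %[mod n] -> v'.1 = m * y %[mod n] ->
  rvar n y v = rvar n y' v' -> y = y' /\ v = v'.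
Proof.
move=> yn; case: v v' => [c l] [c' l'] /= cm cm' [-> dE ->]; split=> //.
by rewrite (divn_eq c n) (divn_eq c' n) dE cm cm'.
Qed.

Lemma skel_coef t x : skel t x = (\sum_(y <- iota 0 n) count (fun v => rvar n y v == x)
    (rowp y t))%N.
Proof.
rewrite skelE // big_mmul_coef; apply: eq_bigr => y _; rewrite big_mmul_coef -sum1_count.
by rewrite [RHS]big_mkcond; apply: eq_bigr => v _; rewrite cmU; case: eqP.
Qed.

Lemma skel_count t y v : (y < n)%N -> v.1 = m * y %[mod n] ->
  skel t (rvar n y v) = count_mem v (rowp y t).
Proof.
move=> yn vm; rewrite skel_coef (bigD1_seq y) ?mem_iota ?iota_uniq //=.
rewrite big1_seq ?addn0.
  apply: eq_in_count => u ut /=; apply/eqP/eqP => [|-> //].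
  by have [um _] := rowp_mem yn ut; case/(rvar_inj yn um vm).
move=> y' /andP[ny]; rewrite mem_iota /= => yn'; apply/eqP; rewrite -leqn0 leqNgt -has_count.
by apply/hasPn => u _; apply: contra ny => /eqP[->].
Qed.

Lemma skel_eqP t t' : skel t = skel t' <->
  forall y, (y < n)%N -> perm_eq (rowp y t) (rowp y t').
Proof.
split=> [E y yn|H].
  rewrite /perm_eq; apply/allP => v; rewrite mem_cat => vin.
  have [vm _] : v.1 = m * y %[mod n] /\ (0 < (v.2 : nat))%N.
    by case/orP: vin; apply: rowp_mem.
  by rewrite /= -!skel_count // E.
rewrite !skelE //; apply: eq_big_seq => y; rewrite mem_iota /= => yn.
exact: perm_big (H y yn).
Qed.

Lemma skel_size t t' : skel t = skel t' -> size t = size t'.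
Proof. by move=> /skel_eqP/(_ 0%N n_gt0)/perm_size; rewrite !size_rowp. Qed.

Lemma symwtE t : symwt t = \sum_(y <- iota 0 n) \sum_(y' <- iota 0 n)
  \sum_(v <- rowp y t) \sum_(v' <- rowp y' t) pairwt m n false true v v'.
Proof.
rewrite /symwt /pairwts; under eq_bigr do rewrite exchange_big.
rewrite exchange_big; apply: eq_bigr => y _ /=.
under eq_bigr do rewrite exchange_big.
rewrite exchange_big; apply: eq_bigr => y' _ /=.
by rewrite [RHS]big_map; apply: eq_bigr => pi _; rewrite big_map.
Qed.

Definition crossinv t t' : int := \sum_(pi <- t) \sum_(pi' <- t') sheetinv pi pi'.

Lemma crossinvE t t' : crossinv t t' = \sum_(y <- iota 0 n)
  ((nle (rowp y t) (rowp y t'))%:Z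
   - (nle [seq shp v | v <- rowp y t] (rowp (y.+1 %% n) t'))%:Z).
Proof.
rewrite /crossinv /sheetinv; under eq_bigr do rewrite exchange_big.
rewrite exchange_big; apply: eq_bigr => y _ /=.
have nleE (A B : seq pnt) : (nle A B)%:Z = \sum_(a <- A) \sum_(b <- B) (a <= b)%O%:Z.
  rewrite /nle; elim: A => [|a A IH]; first by rewrite !big_nil.
  rewrite !big_cons PoszD IH; congr (_ + _).
  by elim: B {IH} => [|b B IH]; rewrite ?big_nil //= big_cons PoszD IH.
rewrite !nleE !big_map -sumrB; apply: eq_bigr => pi _.
by rewrite !big_map sumrB.
Qed.

Lemma perm_nle (A A' B B' : seq pnt) : perm_eq A A' -> perm_eq B B' -> nle A B = nle A' B'.
Proof.
move=> pA pB; rewrite /nle (perm_big _ pA); apply: eq_bigr => a _.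
exact: (permP pB).
Qed.

Lemma crossinv_skel t (u : seq cPF) t' (u' : seq cPF) : skel t = skel u -> skel t' = skel u' ->
  crossinv t t' = crossinv u u'.
Proof.
move=> /skel_eqP pt /skel_eqP pt'; rewrite !crossinvE; apply: eq_big_seq => y.
rewrite mem_iota /= => yn; congr (_%:Z - _%:Z); apply: perm_nle.
- exact: pt.
- exact: pt'.
- exact/perm_map/pt.
by apply: pt'; rewrite ltn_mod.
Qed.

Lemma symwt_skel t (u : seq cPF) : skel t = skel u -> symwt t = symwt u.
Proof.
move=> /skel_eqP pt; rewrite !symwtE.
apply: eq_big_seq => y; rewrite mem_iota /= => yn.
apply: eq_big_seq => y'; rewrite mem_iota /= => yn'.
rewrite (perm_big _ (pt y yn)); apply: eq_bigr => v _.
exact: perm_big (pt y' yn').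
Qed.

(** The part of stat (t ++ t') - stat t that depends on the two skeletons only. *)
Definition crosswt t t' : int := statbase m n (size t + size t') - statbase m n (size t)
  - symwt (t ++ t') + symwt t - crossinv t t'.

Lemma crosswt_skel t (u : seq cPF) t' (u' : seq cPF) : skel t = skel u -> skel t' = skel u' ->
  crosswt t t' = crosswt u u'.
Proof.
move=> E E'; rewrite /crosswt (skel_size E) (skel_size E') (symwt_skel E) (crossinv_skel E E').
by rewrite (@symwt_skel (t ++ t') (u ++ u')) // !skel_cat E E'.
Qed.

Lemma sheetinvs_cat t t' : sheetinvs (t ++ t') = sheetinvs t + sheetinvs t' + crossinv t t'.
Proof.
elim: t => [|pi t IH]; first by rewrite /crossinv big_nil addr0 add0r.
by rewrite /= IH /crossinv big_cons big_cat /=; ring.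
Qed.

Lemma stat_cat t t' : stat (t ++ t') - stat t = crosswt t t' - sheetinvs t'.
Proof.
rewrite !statE // size_cat sheetinvs_cat /crosswt; ring.
Qed.

Lemma hexpE t t' : hexp (skel t) t' = crosswt t t' - sheetinvs t'.
Proof.
rewrite /hexp stat_cat; congr (_ - _); apply: crosswt_skel => //.
rewrite /tuple_of_mon; case: xgetP => [u _ /= ->//|].
by move=> /(_ t) /=.
Qed.

(** Once t and the skeleton of p ++ s are fixed, the exponent depends on the two chains through
    [crossinv p s] alone. *)
Lemma hexp_comp t (p s : seq cPF) : chain p -> chain s ->
  hexp (skel (t ++ p)) s + hexp (skel t) p = crosswt t (p ++ s) - crossinv p s.
Proof.
move=> cp cs; have E : forall t t' : seq cPF, crosswt t t' - sheetinvs t' = stat (t ++ t') - stat t.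
  by move=> *; rewrite stat_cat.
rewrite !hexpE !E addrA subrK -catA stat_cat sheetinvs_cat.
by rewrite (sheetinvs_chain m_gt0 n_gt0 cp) (sheetinvs_chain m_gt0 n_gt0 cs) !add0r.
Qed.
End Skeletons.

(** * Pairs of chains as 2-colourings *)

Lemma nsingle_shape (disp : Order.disp_t) (T : orderType disp) (dA dB : pred T) A B :
  nsingle false (shape dA dB A B) = size [seq a <- A | ~~ dA a] /\
  nsingle true (shape dA dB A B) = size [seq b <- B | ~~ dB b].
Proof.
have pe : perm_eq (evs A B) (map (@uev _ T) A ++ map (@wev _ T) B) by rewrite perm_sort.
rewrite /nsingle /shape !count_map !(permP pe) !count_cat !count_map !size_filter.
split.
  rewrite [X in (_ + X)%N](_ : _ = 0%N) ?addn0; last by rewrite -[RHS](count_pred0 B);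
      apply: eq_count.
  by apply: eq_count => a /=; rewrite xpair_eqE /= eqbF_neg.
rewrite [X in (X + _)%N](_ : _ = 0%N) ?add0n; last by rewrite -[RHS](count_pred0 A);
    apply: eq_count.
by apply: eq_count => a /=; rewrite xpair_eqE /= eqbF_neg.
Qed.

Lemma mem_wlists Ls (ws : seq (seq bool)) : (ws \in wlists Ls) = (map size ws == Ls).
Proof.
elim: Ls ws => [|L Ls IH] [|w ws] //=.
  by apply/negP => /allpairsPdep[? [? []]].
apply/allpairsPdep/eqP => [[u [us [uin usin [-> ->]]]]|[E1 E2]].
  move: uin usin; rewrite mem_words => /eqP-> usin; congr cons.
  by apply/eqP; rewrite -IH.
by exists w, ws; split; rewrite ?mem_words ?IH ?E1 ?E2.
Qed.

Lemma uniq_wlists Ls : uniq (wlists Ls).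
Proof.
elim: Ls => //= L Ls IH; apply: allpairs_uniq_dep => [|w _|]; rewrite ?uniq_words //.
by move=> [w ws] [w' ws'] _ _ [-> ->].
Qed.

Lemma kprodE (R : comNzRingType) (s : R) evs ws : size ws = (size evs).+1 ->
  kprod s evs ws = \prod_(i <- iota 0 (size evs))
    ker s (nth [::] evs i) false false (nth [::] ws i) (nth [::] ws i.+1).
Proof.
elim: evs ws => [|ev evs IH] [|w ws] // [sz]; first by rewrite big_nil.
by rewrite [LHS]/= IH // iota0S big_cons big_map nth0.
Qed.

Lemma prod_if (R : comNzRingType) (s : R) (r : seq nat) (b : pred nat) (N : nat -> nat) :
  \prod_(y <- r) (if b y then s ^+ N y else 0) = if all b r then s ^+ (\sum_(y <- r) N y)%N else 0.
Proof.
elim: r => [|y r IH]; first by rewrite !big_nil.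
by rewrite !big_cons IH /=; case: (b y); rewrite ?mul0r //=; case: all; rewrite ?mulr0 // exprD.
Qed.

Section Colourings.
Variables m n : nat.
Hypotheses (m_gt0 : (0 < m)%N) (n_gt0 : (0 < n)%N) (co_mn : coprime m n).
Local Notation cPF := (cPF m n).
Local Notation shp := (shp m).
Implicit Types (pi : cPF) (t : seq cPF) (y : nat) (v : pnt).
Variable X : mon.

Definition rowX y : seq pnt :=
  sort <=%O [seq (((n * x.1.2 + (m * y) %% n)%N, x.2) : pnt)
            | x <- finsupp X & x.1.1 == y.+1].

(** A necessary condition for X to be the skeleton of a pair of chains, each of which contains a
    point at most once in its row. *)
Definition goodX := forall x, X x != 0%N -> [/\ (0 < x.1.1 <= n)%N, (0 < x.2)%N & (X x <= 2)%N].

Lemma mem_rowX y v :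
  (v \in rowX y) = (v.1 == m * y %[mod n]) && (X (rvar n y v) != 0%N).
Proof.
rewrite mem_sort; apply/mapP/andP => [[x]|[/eqP vm Xv]].
  rewrite mem_filter -cmE_neq0 => /andP[/eqP xy Xx] -> /=; split.
    by rewrite mulnC modnMDl modn_mod.
  by rewrite /rvar /= mulnC divnMDl // divn_small ?ltn_mod // addn0 -xy; case: (x) Xx => -[].
exists (rvar n y v); first by rewrite mem_filter -cmE_neq0 Xv eqxx.
by rewrite /rvar /= -vm mulnC -divn_eq; case: (v).
Qed.

Lemma rowX_sorted y : sorted <%O (rowX y).
Proof.
rewrite sort_lt_sorted map_inj_in_uniq ?filter_uniq ?fset_uniq //.
move=> [[i j] l] [[i' j'] l']; rewrite !mem_filter /= => /andP[/eqP-> _] /andP[/eqP-> _] [].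
by move=> /addIn/eqP; rewrite eqn_pmul2l // => /eqP-> ->.
Qed.

(* A point of multiplicity 2 belongs to both chains and is not coloured. *)
Definition dbl y v : bool := X (rvar n y v) == 2%N.
Definition sing y : seq pnt := [seq v <- rowX y | ~~ dbl y v].
Definition unshp (v : pnt) : pnt := ((v.1 - m)%N, v.2).
Lemma shpK : cancel shp unshp.
Proof. by case=> c l; rewrite /unshp /= addnK. Qed.

Local Notation nxt y := (y.+1 %% n)%N.

(** The last transition leads back to row 0, contents being invariant under the (m,
    n)-translation. *)
Definition evX y := shape (fun a => dbl y (unshp a)) (dbl (nxt y)) [seq shp v | v <- rowX y]
    (rowX (nxt y)).

Definition evsX := [seq evX y | y <- iota 0 n].

Lemma filter_shp (P : pred pnt) (A : seq pnt) :
  [seq a <- [seq shp v | v <- A] | P (unshp a)] = [seq shp v | v <- A & P v].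
Proof. by rewrite filter_map; congr map; apply: eq_filter => v; rewrite /= shpK. Qed.

Lemma nsingle_evX y : nsingle false (evX y) = size (sing y) /\
  nsingle true (evX y) = size (sing (nxt y)).
Proof.
have [-> ->] := nsingle_shape (fun a => dbl y (unshp a)) (dbl (nxt y)) [seq shp v |
    v <- rowX y] (rowX (nxt y)).
by rewrite (filter_shp (fun v => ~~ dbl y v)) size_map.
Qed.

Lemma evsX_ok : evs_ok (size (sing 0)) evsX (size (sing 0)).
Proof.
suff H k y : (y + k = n)%N -> evs_ok (size (sing (y %% n))) [seq evX z | z <- iota y k]
    (size (sing 0)).
  by have := H n 0%N (add0n n); rewrite mod0n.
elim: k y => [|k IH] y /= yk; first by move: yk; rewrite addn0 => ->; rewrite modnn.
have yn : (y < n)%N by rewrite -yk -[X in (X < _)%N]addn0 ltn_add2l.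
have [-> ->] := nsingle_evX y; rewrite modn_small // eqxx /=.
by apply: IH; rewrite addSnnS.
Qed.

Definition col y (w : seq bool) v : bool := nth false w (index v (sing y)).
Definition col1 y w v : bool := dbl y v || col y w v.
Definition col2 y w v : bool := dbl y v || ~~ col y w v.
Definition part1 y w := [seq v <- rowX y | col1 y w v].
Definition part2 y w := [seq v <- rowX y | col2 y w v].

Lemma uniq_sing y : uniq (sing y).
Proof. by apply: filter_uniq; apply: lt_sorted_uniq (rowX_sorted y). Qed.

Lemma col_sing y w : size w = size (sing y) -> [seq col1 y w v | v <- sing y] = w.
Proof.
move=> sw; apply: (@eq_from_nth _ false); first by rewrite size_map.
move=> i; rewrite size_map => hi; case E : (sing y) (hi) => [|v0 r] //; rewrite -E => _.
rewrite (nth_map v0) // /col1 /col index_uniq ?uniq_sing //.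
suff /negPf-> : ~~ dbl y (nth v0 (sing y) i) by [].
by have := mem_nth v0 hi; rewrite mem_filter => /andP[].
Qed.

Lemma ker_evX (R : comNzRingType) (s : R) y w w' :
  size w = size (sing y) -> size w' = size (sing (nxt y)) ->
  ker s (evX y) false false w w' =
  if interlace [seq shp v | v <- part1 y w] (part1 (nxt y) w')
     && interlace [seq shp v | v <- part2 y w] (part2 (nxt y) w')
  then s ^+ trweight [seq shp v | v <- part1 y w] [seq shp v | v <- part2 y w]
         (part1 (nxt y) w') (part2 (nxt y) w') else 0.
Proof.
move=> sw sw'.
have sA : sorted <%O [seq shp v | v <- rowX y] by rewrite sorted_map_shp rowX_sorted.
have := @ker_transition _ pnt [seq shp v | v <- rowX y] (rowX (nxt y))
  (fun a => dbl y (unshp a)) (dbl (nxt y))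
  (fun a => col1 y w (unshp a)) (fun a => col2 y w (unshp a)) (col1 (nxt y) w') (col2 (nxt y) w')
  sA (rowX_sorted _).
rewrite -/(evX y) !filter_shp (filter_shp (fun v => ~~ dbl y v)) -map_comp.
rewrite (eq_map (g := col1 y w)); last by move=> v; rewrite /= shpK.
rewrite !col_sing // => ->.
- by [].
- by move=> a _; rewrite /col1 /col2; case: dbl; case: col.
- by move=> a _; rewrite /col1 /col2; case: dbl; case: col.
- by move=> a _; rewrite /col1 /col2; case: dbl; case: col.
- by move=> a _; rewrite /col1 /col2; case: dbl; case: col.
Qed.

Definition sizesX := [seq size (sing y) | y <- iota 0 n].
Definition cword (ws : seq (seq bool)) y := nth [::] ws y.
Definition validX ws := all (fun y =>
     interlace [seq shp v | v <- part1 y (cword ws y)] (part1 (nxt y) (cword ws (nxt y)))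
  && interlace [seq shp v | v <- part2 y (cword ws y)] (part2 (nxt y) (cword ws (nxt y))))
      (iota 0 n).
Definition weightX ws : nat := (\sum_(y <- iota 0 n)
  trweight [seq shp v | v <- part1 y (cword ws y)] [seq shp v | v <- part2 y (cword ws y)]
         (part1 (nxt y) (cword ws (nxt y))) (part2 (nxt y) (cword ws (nxt y))))%N.

Lemma size_cword ws y : ws \in wlists sizesX -> (y < n)%N -> size (cword ws y) = size (sing y).
Proof.
rewrite mem_wlists => /eqP E yn; have szw : size ws = n.
  by rewrite -(size_map size) E size_map size_iota.
rewrite /cword -(nth_map [::] 0%N) ?szw // E (nth_map 0%N) ?size_iota // nth_iota //.
Qed.

Lemma size_wlistsX ws : ws \in wlists sizesX -> size ws = n.
Proof. by rewrite mem_wlists => /eqP E; rewrite -(size_map size) E size_map size_iota. Qed.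

Lemma kprodX (R : comNzRingType) (s : R) ws : ws \in wlists sizesX ->
  kprod s evsX (rcons ws (cword ws 0)) = if validX ws then s ^+ weightX ws else 0.
Proof.
move=> wsin; have szw := size_wlistsX wsin.
have szE : size evsX = n by rewrite size_map size_iota.
rewrite kprodE ?size_rcons ?szw ?szE // -prod_if.
apply: eq_big_seq => y; rewrite mem_iota /= => yn.
have y1n : (nxt y < n)%N by rewrite ltn_mod.
have -> : nth [::] (rcons ws (cword ws 0)) y.+1 = cword ws (nxt y).
  rewrite nth_rcons szw; case: ltngtP => [lt|gt|yE]; first by rewrite modn_small.
    by move: gt; rewrite ltnNge yn.
  by rewrite yE modnn.
rewrite nth_rcons szw yn (nth_map 0%N) ?size_iota // nth_iota // add0n.
by rewrite ker_evX // size_cword.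
Qed.

Lemma ksumX (R : comNzRingType) (s : R) (C : pred (seq bool)) :
  \sum_(u <- words (size (sing 0)) | C u) ksum s evsX u u
  = \sum_(ws <- wlists sizesX | C (cword ws 0)) (if validX ws then s ^+ weightX ws else 0).
Proof.
rewrite big_mkcond [RHS]big_mkcond.
rewrite [RHS](eq_big_seq (fun ws => if C (cword ws 0) then kprod s evsX (rcons ws
    (cword ws 0)) else 0)); last first.
  by move=> ws wsin; rewrite kprodX.
have := evsX_ok; rewrite /evsX /sizesX -(prednK n_gt0) iota0S; set r := map S _.
rewrite [map evX _]/= [map (fun y => size (sing y)) _]/=.
set evs := map evX r => ok; rewrite [RHS]big_allpairs_dep.
apply: eq_big_seq => u; rewrite mem_words => /eqP su.
case: ifP => Cu; last by rewrite big1.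
rewrite -(kprod_sum s u ok su) -[map (nsingle false) evs]map_comp.
by apply: congr_big => //; congr wlists; apply: eq_map => y; rewrite /= (nsingle_evX y).1.
Qed.
End Colourings.

Lemma count_split (T : Type) (a b : pred T) (r : seq T) :
  count a r = (count (fun x => b x && a x) r + count (fun x => ~~ b x && a x) r)%N.
Proof. by elim: r => //= x r ->; case: (a x); case: (b x) => /=; lia. Qed.

Lemma sum_cyclic (V : zmodType) n (f : nat -> V) : (0 < n)%N ->
  \sum_(y <- iota 0 n) f (y.+1 %% n)%N = \sum_(y <- iota 0 n) f y.
Proof.
case: n => // k _; rewrite [RHS]/= big_cons -[X in iota 0 X]addn1 iotaD big_cat big_seq1 /= addrC.
congr (_ + _); first by rewrite add0n modnn.
rewrite (iotaDl 1 0) big_map; apply: eq_big_seq => y; rewrite mem_iota /= => yk.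
by rewrite modn_small.
Qed.

Lemma nle_ninv (disp : Order.disp_t) (T : orderType disp) (A B : seq T) : uniq B ->
  nle A B = (ninv A B + count [in B] A)%N.
Proof.
move=> uB; rewrite /nle /ninv; elim: A => [|a A IH]; first by rewrite !big_nil.
rewrite !big_cons IH /= addnACA; congr (_ + _)%N.
have -> : (a \in B) = count (pred1 a) B :> nat by rewrite count_uniq_mem.
elim: B {uB IH} => //= b B ->; rewrite le_eqVlt [a == b]eq_sym.
by case: (ltgtP a b) => /=; lia.
Qed.

Section ChainPairs.
Variables m n : nat.
Hypotheses (m_gt0 : (0 < m)%N) (n_gt0 : (0 < n)%N) (co_mn : coprime m n).
Local Notation cPF := (cPF m n).
Local Notation shp := (shp m).
Local Notation nxt y := (y.+1 %% n)%N.
Implicit Types (pi : cPF) (t p s : seq cPF) (y : nat) (v : pnt).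

Lemma rowp_inj t t' : (forall y, (y < n)%N -> rowp y t = rowp y t') -> t = t'.
Proof.
move=> H; have szE : size t = size t' by rewrite -(size_rowp 0) H // size_rowp.
elim: t t' szE H => [|pi t IH] [|pi' t'] //= [sz] H.
rewrite (IH t' sz); last by move=> y yn; exact: (congr1 behead (H y yn)).
congr cons; apply: cpf_inj => // y yn.
exact: (congr1 (head (pt pi y)) (H y yn)).
Qed.

(** The i-th entry of the chain takes the i-th point of every row. *)
Lemma chain_of_rows (r : nat -> seq pnt) :
  (forall y, (y < n)%N -> interlace [seq shp v | v <- r y] (r (nxt y))) ->
  (forall y v, (y < n)%N -> v \in r y -> v.1 = m * y %[mod n] /\ (0 < (v.2 : nat))%N) ->
  exists t, chain t /\ forall y, (y < n)%N -> rowp y t = r y.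
Proof.
move=> il ok; pose x0 : pnt := (0%N, 0%N).
have szE y : (y < n)%N -> size (r y) = size (r 0%N).
  elim: y => // y IH yn; have /(interlaceP x0)[+ _ _] := il y (ltnW yn).
  by rewrite size_map modn_small // IH // ltnW.
have /choice[f fE] : forall i : 'I_(size (r 0%N)), exists pi : cPF,
    forall y, (y < n)%N -> pt pi y = nth x0 (r y) i.
  move=> i.
  apply: cpf_of_points => // y yn.
  have [h1 h2] := ok y (nth x0 (r y) i) yn (mem_nth _ (etrans (congr1 _ (szE y yn)) (ltn_ord i))).
  split=> //; have /(interlaceP x0)[_ + _] := il y yn.
  rewrite size_map szE // => /(_ i (ltn_ord i)).
  by rewrite (nth_map x0) ?szE.
pose t := [seq f i | i <- enum 'I_(size (r 0%N))].
have tE y : (y < n)%N -> rowp y t = r y.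
  move=> yn; rewrite /rowp /t -map_comp (eq_map (g := nth x0 (r y) \o val)); last first.
    by move=> i /=; rewrite fE.
  by rewrite map_comp val_enum_ord -(szE y yn) -/(mkseq _ _) mkseq_nth.
exists t; split=> //; apply/chainP => // y yn; rewrite !tE ?ltn_mod //; exact: il.
Qed.

Variable X : mon.
Local Notation part1X := (part1 m n X).
Local Notation part2X := (part2 m n X).
Local Notation sing := (sing m n X).
Local Notation rowX := (rowX m n X).
Local Notation dblX := (dbl n X).

Definition numdbl y : nat := count (dblX y) (rowX y).

Lemma size_part1 y w : size w = size (sing y) -> size (part1X y w) =
    (count_mem true w + numdbl y)%N.
Proof.
move=> sw; rewrite -[in RHS](col_sing n_gt0 sw) count_map count_filter size_filter.
rewrite /numdbl addnC (count_split _ (dblX y)) /col1; congr (_ + _)%N; apply: eq_count => v /=.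
  by case: (dblX y v).
by case: (dblX y v) => /=; rewrite ?andbT ?andbF ?eqb_id.
Qed.

Lemma size_part2 y w : size w = size (sing y) -> size (part2X y w) =
    (count_mem false w + numdbl y)%N.
Proof.
move=> sw; rewrite -[in RHS](col_sing n_gt0 sw) count_map count_filter size_filter.
rewrite /numdbl addnC (count_split _ (dblX y)) /col2 /col1; congr (_ + _)%N;
    apply: eq_count => v /=.
  by case: (dblX y v).
by case: (dblX y v) => /=; rewrite ?andbT ?andbF ?eqbF_neg.
Qed.

Definition word_of y t := [seq v \in rowp y t | v <- sing y].

Definition colouring (ps : seq cPF * seq cPF) := [seq word_of y ps.1 | y <- iota 0 n].

Lemma colouringE ps y : (y < n)%N -> cword (colouring ps) y = word_of y ps.1.
Proof. by move=> yn; rewrite /cword (nth_map 0%N) ?size_iota // nth_iota. Qed.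

Lemma colouring_in ps : colouring ps \in wlists (sizesX m n X).
Proof.
rewrite mem_wlists /colouring /sizesX -map_comp; apply/eqP/eq_map => y /=.
exact: size_map.
Qed.

Lemma col_word y t v : v \in sing y -> col m n X y (word_of y t) v = (v \in rowp y t).
Proof. by move=> vin; rewrite /col (nth_map v) ?index_mem // nth_index. Qed.

Section Pair.
Variables p s : seq cPF.
Hypotheses (cp : chain p) (cs : chain s) (psX : mmul (skel p) (skel s) = X).

Lemma pair_count y v : (y < n)%N -> v.1 = m * y %[mod n] ->
  X (rvar n y v) = ((v \in rowp y p) + (v \in rowp y s))%N.
Proof.
move=> yn vm; rewrite -psX cmM !skel_count //.
have u1 : uniq (rowp y p) by apply: lt_sorted_uniq; apply: chain_sorted cp yn.
have u2 : uniq (rowp y s) by apply: lt_sorted_uniq; apply: chain_sorted cs yn.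
by rewrite !count_uniq_mem.
Qed.

Lemma part1_pair y : (y < n)%N -> part1X y (word_of y p) = rowp y p.
Proof.
move=> yn; apply: lt_sorted_eq; [by apply: lt_sorted_filter;
    apply: rowX_sorted|exact: chain_sorted|].
move=> v; rewrite mem_filter /col1; case: (boolP (v \in rowX y)) => [vX|]; last first.
  rewrite andbF mem_rowX // negb_and negbK => h; apply/esym/negP => vp.
  have [vm _] := rowp_mem m_gt0 n_gt0 yn vp.
  by move: h; rewrite vm eqxx /= pair_count // vp.
rewrite andbT; move: (vX); rewrite mem_rowX // => /andP[/eqP vm _].
case: (boolP (dblX y v)) => /= dv.
  by move: dv; rewrite /dbl pair_count //; do 2 case: (v \in _).
by rewrite col_word // mem_filter dv.
Qed.

Lemma part2_pair y : (y < n)%N -> part2X y (word_of y p) = rowp y s.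
Proof.
move=> yn; apply: lt_sorted_eq; [by apply: lt_sorted_filter;
    apply: rowX_sorted|exact: chain_sorted|].
move=> v; rewrite mem_filter /col2; case: (boolP (v \in rowX y)) => [vX|]; last first.
  rewrite andbF mem_rowX // negb_and negbK => h; apply/esym/negP => vp.
  have [vm _] := rowp_mem m_gt0 n_gt0 yn vp.
  by move: h; rewrite vm eqxx /= pair_count // vp addn1.
rewrite andbT; move: (vX); rewrite mem_rowX // => /andP[/eqP vm Xv].
case: (boolP (dblX y v)) => /= dv.
  by move: dv; rewrite /dbl pair_count //; do 2 case: (v \in _).
rewrite col_word // ?mem_filter ?dv //.
by move: dv Xv; rewrite /dbl pair_count //; do 2 case: (v \in _).
Qed.

Lemma colouring_valid : validX m n X (colouring (p, s)).
Proof.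
apply/allP => y; rewrite mem_iota /= => yn; have y1n : (nxt y < n)%N by rewrite ltn_mod.
rewrite !colouringE // !part1_pair // !part2_pair //.
by rewrite !(iffLR (chainP _ _ _)).
Qed.

(** The inversions of a row occur in the transitions before and after it, hence the factor 2. A
    point of both chains is counted by [nle] and not by [ninv], hence the second term. *)
Lemma crossinv_weightX : crossinv p s *+ 2
  = (weightX m n X (colouring (p, s)))%:Z + (\sum_(y <- iota 0 n) numdbl y)%N%:Z *+ 2.
Proof.
have valid := colouring_valid.
rewrite crossinvE -sumrMnl /weightX.
have sumZ (F : nat -> nat) : (\sum_(y <- iota 0 n) F y)%N%:Z = \sum_(y <- iota 0 n) (F y)%:Z.
  by elim: (iota 0 n) => [|y r IH]; rewrite ?big_nil // !big_cons PoszD IH.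
rewrite !sumZ -sumrMnl.
pose f y : int := (ninv (rowp y p) (rowp y s))%:Z.
transitivity (\sum_(y <- iota 0 n) (f y + f y + (numdbl y)%:Z *+ 2
   - (nle [seq shp v | v <- rowp y p] (rowp (nxt y) s))%:Z *+ 2)).
  apply: eq_big_seq => y; rewrite mem_iota /= => yn; rewrite mulrnBl; congr (_ - _).
  have uy : uniq (rowp y s) by apply: lt_sorted_uniq; apply: chain_sorted cs yn.
  rewrite nle_ninv // PoszD mulrnDl mulr2n; congr (_ + _%:Z *+ _).
  rewrite -(part1_pair yn) -(part2_pair yn) count_filter.
  apply: eq_in_count => v vX; rewrite /= mem_filter vX andbT /col1 /col2.
  by case: (dblX y v); case: (col _ _ _ _ _ _).
(* One copy of f is reindexed to the next row, so that each transition carries the inversions of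
   both of its rows. *)
rewrite !big_split /= -{1}(sum_cyclic f n_gt0) -!big_split /=.
apply: eq_big_seq => y; rewrite mem_iota /= => yn; have y1n : (nxt y < n)%N by rewrite ltn_mod.
have /andP[] := allP valid y (etrans (mem_iota 0 n y) yn).
have sA : sorted <%O [seq shp v | v <- rowX y] by rewrite sorted_map_shp rowX_sorted.
have := @nle_trweight _ pnt [seq shp v | v <- rowX y] (rowX (nxt y))
  (fun a => col1 m n X y (cword (colouring (p, s)) y) (unshp m a))
  (fun a => col2 m n X y (cword (colouring (p, s)) y) (unshp m a))
  (col1 m n X (nxt y) (cword (colouring (p, s)) (nxt y)))
  (col2 m n X (nxt y) (cword (colouring (p, s)) (nxt y))) sA (rowX_sorted m n_gt0 X _).
rewrite !filter_shp => H i1 i2; have {}H := H i1 i2.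
have ninv_shp (A B : seq pnt) : ninv [seq shp v | v <- A] [seq shp v | v <- B] = ninv A B.
  rewrite /ninv big_map; apply: eq_bigr => a _; rewrite count_map.
  by apply: eq_count => b; rewrite /= lt_shp.
move: H; rewrite ninv_shp !colouringE //.
rewrite -/(part1X y (word_of y p)) -/(part1X (nxt y) (word_of (nxt y) p)).
rewrite -/(part2X y (word_of y p)) -/(part2X (nxt y) (word_of (nxt y) p)).
rewrite !part1_pair // !part2_pair // /f !mulr2n.
move: (trweight _ _ _ _) (nle _ _) (ninv _ _) (ninv _ _) (numdbl y) => a b c d e.
by clear; lia.
Qed.
End Pair.

Lemma colouring_surj ws : goodX n X -> ws \in wlists (sizesX m n X) -> validX m n X ws ->
  exists ps, [/\ chain ps.1, chain ps.2, mmul (skel ps.1) (skel ps.2) = X & colouring ps = ws].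
Proof.
move=> gX wsin valid.
have rowOK y v : (y < n)%N -> v \in rowX y -> v.1 = m * y %[mod n] /\ (0 < (v.2 : nat))%N.
  move=> yn; rewrite mem_rowX // => /andP[/eqP vm Xv]; split=> //.
  by have [_ + _] := gX _ Xv.
have [|y v yn|p [cp pE]] := @chain_of_rows (fun y => part1X y (cword ws y)).
- by move=> y yn; have /andP[] := allP valid y (etrans (mem_iota 0 n y) yn).
- by rewrite mem_filter => /andP[_]; apply: rowOK.
have [|y v yn|s [cs sE]] := @chain_of_rows (fun y => part2X y (cword ws y)).
- by move=> y yn; have /andP[] := allP valid y (etrans (mem_iota 0 n y) yn).
- by rewrite mem_filter => /andP[_]; apply: rowOK.
exists (p, s); split=> //=.
- apply/eqP/cmP => x; rewrite cmM.
  have [Xx|Xx] := eqVneq (X x) 0%N.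
    rewrite Xx !skel_coef // !big1_seq // => y; rewrite mem_iota /= => yn; apply/eqP;
      rewrite -leqn0 leqNgt -has_count; apply/hasPn => v.
      rewrite sE // mem_filter mem_rowX // => /and3P[_ _]; apply: contra => /eqP->.
      by rewrite Xx.
    rewrite pE // mem_filter mem_rowX // => /and3P[_ _]; apply: contra => /eqP->.
    by rewrite Xx.
  have [/andP[x1 xn] x2 Xle] := gX x Xx.
  pose y := x.1.1.-1; have yn : (y < n)%N by rewrite prednK.
  pose v : pnt := ((n * x.1.2 + (m * y) %% n)%N, x.2).
  have vm : v.1 = m * y %[mod n] by rewrite /= mulnC modnMDl modn_mod.
  have xE : x = rvar n y v.
    rewrite /rvar /= mulnC divnMDl // divn_small ?ltn_mod // addn0 prednK //.
    by case: (x) => -[].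
  have vX : v \in rowX y by rewrite mem_rowX // vm eqxx -xE.
  have uq c : uniq [seq v <- rowX y | c v] by rewrite filter_uniq // lt_sorted_uniq // rowX_sorted.
  rewrite xE !skel_count // pE // sE // /part1 /part2 !count_uniq_mem // !mem_filter vX !andbT -xE.
  rewrite /col1 /col2 /dbl -xE; move: Xx Xle.
  by case: (X x) => [|[|[|k]]] //= _ _; case: (col _ _ _ _ _ _).
apply: (@eq_from_nth _ [::]); first by rewrite size_map size_iota (size_wlistsX wsin).
move=> y; rewrite size_map size_iota => yn; rewrite -/(cword _ y) colouringE //=.
rewrite /word_of pE // -[RHS](@col_sing m n n_gt0 X y) ?(size_cword wsin) //.
apply/eq_in_map => v; rewrite mem_filter => /andP[_ vX].
by rewrite mem_filter vX andbT.
Qed.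
End ChainPairs.

(** * Generating functions of colourings *)

Section GeneratingFunctions.
Variables (K : fieldType) (q : K).
Hypothesis q0 : q != 0.

(* Substitutes q^(-1/2) for the variable, on even polynomials. *)
Definition halve (P : {poly K}) : K := (even_poly P).[q^-1].

Lemma halve_sum (I : Type) (r : seq I) (C : pred I) (F : I -> {poly K}) :
  halve (\sum_(i <- r | C i) F i) = \sum_(i <- r | C i) halve (F i).
Proof. by rewrite /halve raddf_sum horner_sum. Qed.

Lemma halveX k : halve 'X^(k.*2) = q ^- k.
Proof.
rewrite /halve (_ : even_poly _ = 'X^k).
  by rewrite hornerXn exprVn.
by apply/polyP => i; rewrite coef_even_poly !coefXn (inj_eq double_inj).
Qed.

Lemma halve_mulX2 P : halve ('X^2 * P) = q^-1 * halve P.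
Proof.
rewrite /halve mulrC exprS expr1 mulrA even_polyMX odd_polyMX hornerM hornerX mulrC //.
Qed.

Lemma halveD P Q : halve (P + Q) = halve P + halve Q.
Proof. by rewrite /halve even_polyD hornerD. Qed.

Section Bridge.
Variables m n : nat.
Hypotheses (m_gt0 : (0 < m)%N) (n_gt0 : (0 < n)%N) (co_mn : coprime m n).
Variable X : mon.
Local Notation cPF := (cPF m n).

Definition doubles : nat := (\sum_(y <- iota 0 n) numdbl m n X y)%N.

(* The colourings with a and b points of the two colours in each row. *)
Definition gf a b (C : pred (seq bool)) : {poly K} :=
  \sum_(u <- words (size (sing m n X 0)) | [&& (count_mem true u + numdbl m n X 0 == a)%N,
     (count_mem false u + numdbl m n X 0 == b)%N & C u]) ksum 'X (evsX m n X) u u.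

Lemma gfE a b (C : pred (seq bool)) (ps : seq (seq cPF * seq cPF)) : goodX n X -> uniq ps ->
  (forall p, p \in ps = `[< [/\ chain p.1 /\ size p.1 = a, chain p.2 /\ size p.2 = b,
      mmul (skel p.1) (skel p.2) = X & C (word_of X 0 p.1)] >]) ->
  \sum_(p <- ps) q ^ (- crossinv p.1 p.2) = q ^- doubles * halve (gf a b C).
Proof.
move=> gX ups psE; rewrite /gf ksumX // -big_mkcondr /= halve_sum.
pose P ws := [&& (count_mem true (cword ws 0) + numdbl m n X 0 == a)%N,
  (count_mem false (cword ws 0) + numdbl m n X 0 == b)%N & C (cword ws 0)] && validX m n X ws.
rewrite (eq_bigl P) //.
have wE (p : seq cPF * seq cPF) : cword (colouring X p) 0 = word_of X 0 p.1 by rewrite colouringE.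
have permE : perm_eq [seq colouring X p | p <- ps] [seq ws <- wlists (sizesX m n X) | P ws].
  apply: uniq_perm; last 1 first.
  - move=> ws; rewrite mem_filter; apply/mapP/andP =>
      [[[p s] pin ->]|[/andP[/and3P[a_ b_ c_] v] win]].
      move: pin; rewrite psE => /asboolP/= [[cp sp] [cs ss] psX Cp].
      split; last exact: colouring_in.
      rewrite /P wE /= colouring_valid // Cp !andbT -size_part1 ?size_map //.
      rewrite -size_part2 ?size_map // (part1_pair m_gt0 n_gt0 cp cs psX) //.
      by rewrite (part2_pair m_gt0 n_gt0 cp cs psX) // !size_rowp sp ss !eqxx.
    have [p [cp cs psX pE]] := colouring_surj m_gt0 n_gt0 gX win v.
    exists p; rewrite ?pE // psE; apply/asboolP.
    move: a_ b_ c_; rewrite -pE wE -size_part1 ?size_map // -size_part2 ?size_map //.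
    rewrite (part1_pair m_gt0 n_gt0 cp cs psX) // (part2_pair m_gt0 n_gt0 cp cs psX) //.
    by rewrite !size_rowp => /eqP-> /eqP-> Cp; split.
  - rewrite map_inj_in_uniq // => -[p s] [p' s']; rewrite !psE.
    move=> /asboolP/= [[cp _] [cs _] psX _] /asboolP/= [[cp' _] [cs' _] psX' _] E.
    have wE' y : (y < n)%N -> word_of X y p = word_of X y p'.
      by move=> yn; rewrite -[LHS](colouringE X (p, s) yn) E colouringE.
    congr pair; apply: rowp_inj => // y yn.
      rewrite -(part1_pair m_gt0 n_gt0 cp cs psX) // -(part1_pair m_gt0 n_gt0 cp' cs' psX') //.
      by rewrite wE'.
    rewrite -(part2_pair m_gt0 n_gt0 cp cs psX) // -(part2_pair m_gt0 n_gt0 cp' cs' psX') //.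
    by rewrite wE'.
  - by rewrite filter_uniq // uniq_wlists.
rewrite -[X in _ = _ * X]big_filter -(perm_big _ permE) big_map mulr_sumr.
apply: eq_big_seq => -[p s]; rewrite psE => /asboolP/= [[cp sp] [cs ss] psX Cp].
have := crossinv_weightX m_gt0 n_gt0 cp cs psX; rewrite -/doubles.
move: (weightX _ _ _ _) (crossinv p s) doubles => N c d E.
(* The weight is even because twice the integer [crossinv] is the weight plus an even number. *)
have [k NE cE] : exists2 k, N = k.*2 & c = (k + d)%N%:Z.
  by exists N./2; move: E; rewrite !mulr2n; lia.
by rewrite NE cE halveX -exprnN addnC exprD invfM.
Qed.
End Bridge.
End GeneratingFunctions.

(** * Symmetry of the generating functions *)

Section Symmetry.
Variables (K : fieldType) (q : K).
Hypothesis q0 : q != 0.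
Variables m n : nat.
Hypotheses (m_gt0 : (0 < m)%N) (n_gt0 : (0 < n)%N).
Variable X : mon.

Lemma count_words L (u : seq bool) (d a b : nat) : u \in words L ->
  (count_mem true u + d == a)%N && (count_mem false u + d == b)%N =
  [&& (L + d.*2 == a + b)%N, (d <= a)%N & (count_mem true u == a - d)%N].
Proof.
rewrite mem_words => /eqP<-; have := count_predC (pred1 true) u.
rewrite (@eq_count _ (predC _) (pred1 false)); last by case.
by move=> <-; apply/idP/idP; lia.
Qed.

Lemma count_words' L (u : seq bool) (d a b : nat) : u \in words L ->
  (count_mem true u + d == b)%N && (count_mem false u + d == a)%N =
  [&& (L + d.*2 == a + b)%N, (d <= a)%N & (count_mem false u == a - d)%N].
Proof.
rewrite mem_words => /eqP<-; have := count_predC (pred1 true) u.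
rewrite (@eq_count _ (predC _) (pred1 false)); last by case.
by move=> <-; apply/idP/idP; lia.
Qed.

Lemma words_swap L d a b (F : seq bool -> {poly K}) :
  (forall p : nat, \sum_(u <- words L | count_mem true u == p) F u =
     \sum_(u <- words L | count_mem false u == p) F u) ->
  \sum_(u <- words L | (count_mem true u + d == a)%N && (count_mem false u + d == b)%N) F u
  = \sum_(u <- words L | (count_mem true u + d == b)%N && (count_mem false u + d == a)%N) F u.
Proof.
move=> H.
have E1 : \sum_(u <- words L | (count_mem true u + d == a)%N && (count_mem false u + d == b)%N) F u
   = if (L + d.*2 == a + b)%N && (d <= a)%N then \sum_(u <- words L | count_mem true u ==
       (a - d)%N) F u
     else 0.
  rewrite big_seq_cond; case: ifP => c.
    rewrite [RHS]big_seq_cond; apply: eq_bigl => u.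
    by case: (boolP (u \in words L)) => //= uL; rewrite (count_words d a b uL) andbA c.
  rewrite big1 // => u /andP[uL]; rewrite (count_words d a b uL) andbA c //.
have E2 : \sum_(u <- words L | (count_mem true u + d == b)%N && (count_mem false u + d == a)%N) F u
   = if (L + d.*2 == a + b)%N && (d <= a)%N then \sum_(u <- words L | count_mem false u ==
       (a - d)%N) F u
     else 0.
  rewrite big_seq_cond; case: ifP => c.
    rewrite [RHS]big_seq_cond; apply: eq_bigl => u.
    by case: (boolP (u \in words L)) => //= uL; rewrite (count_words' d a b uL) andbA c.
  rewrite big1 // => u /andP[uL]; rewrite (count_words' d a b uL) andbA c //.
by rewrite E1 E2 H.
Qed.

Lemma gf_sym (a b : nat) : gf K m n X a b xpredT = gf K m n X b a xpredT.
Proof.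
have := words_swap (numdbl m n X 0) a b (fun p => ksum_sym 'X p (evsX_ok m n X)).
by rewrite /gf => H; under eq_bigl do rewrite andbT; under [RHS]eq_bigl do rewrite andbT.
Qed.

Lemma big_words_cons L (C : pred (seq bool)) (F : seq bool -> {poly K}) (x : bool) :
  \sum_(u <- words L.+1 | C u && (head false u == x)) F u
  = \sum_(u <- words L | C (x :: u)) F (x :: u).
Proof.
rewrite -big_filter -[RHS]big_filter.
have -> : \sum_(u <- [seq u <- words L | C (x :: u)]) F (x :: u)
    = \sum_(u <- [seq x :: u | u <- words L & C (x :: u)]) F u by rewrite big_map.
apply: perm_big; apply: uniq_perm.
- by rewrite filter_uniq // uniq_words.
- by rewrite map_inj_uniq ?filter_uniq ?uniq_words // => u u' [].
move=> u; rewrite mem_filter mem_words; apply/andP/mapP => [[/andP[Cu]]|[v]].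
  case: u Cu => [|z u] //= Cu /eqP zx /eqP[su]; subst z.
  by exists u => //; rewrite mem_filter Cu mem_words su eqxx.
by rewrite mem_filter mem_words => /andP[Cv /eqP sv] ->; rewrite Cv /= eqxx sv eqxx.
Qed.

(** The scalar s^2 of [ksum_sym_head] becomes 1/q; multiplying by q moves it to the words that start
    with true. The first letter adds one to the count of its colour, hence the shifted indices. *)
Lemma gf_sym_head L a b : size (sing m n X 0) = L.+1 ->
  q * halve q (gf K m n X a.+1 b (fun u => head false u))
    + halve q (gf K m n X a b.+1 (fun u => ~~ head false u))
  = halve q (gf K m n X b a.+1 (fun u => ~~ head false u))
    + q * halve q (gf K m n X b.+1 a (fun u => head false u)).
Proof.
move=> szE; pose d := numdbl m n X 0.
have gfT a' b' : gf K m n X a'.+1 b' (fun u => head false u) =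
    \sum_(u <- words L | (count_mem true u + d == a')%N && (count_mem false u + d == b')%N)
       ksum 'X (evsX m n X) (true :: u) (true :: u).
  rewrite /gf szE.
  have := big_words_cons L (fun u => (count_mem true u + d == a'.+1)%N &&
      (count_mem false u + d == b')%N)
    (fun u => ksum 'X (evsX m n X) u u) true.
  under [RHS]eq_bigl do rewrite /= add1n addSn eqSS add0n.
  by move=> <-; apply: eq_bigl => u; rewrite andbA eqb_id.
have gfF a' b' : gf K m n X a' b'.+1 (fun u => ~~ head false u) =
    \sum_(u <- words L | (count_mem true u + d == a')%N && (count_mem false u + d == b')%N)
       ksum 'X (evsX m n X) (false :: u) (false :: u).
  rewrite /gf szE.
  have := big_words_cons L (fun u => (count_mem true u + d == a')%N &&
      (count_mem false u + d == b'.+1)%N)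
    (fun u => ksum 'X (evsX m n X) u u) false.
  under [RHS]eq_bigl do rewrite /= add1n addSn eqSS add0n.
  by move=> <-; apply: eq_bigl => u; rewrite andbA eqbF_neg.
have ok : evs_ok L.+1 (evsX m n X) L.+1 by rewrite -szE; apply: evsX_ok.
have := words_swap d a b (fun p => ksum_sym_head 'X p ok).
rewrite !big_split /= -!mulr_sumr -!gfT -!gfF => /(congr1 (halve q)).
rewrite !halveD !halve_mulX2 => /(congr1 ( *%R q)); rewrite !mulrDr !mulrA divff // !mul1r.
by move=> ->; rewrite addrC.
Qed.
End Symmetry.

(** * Composition of the operators *)

Lemma mmul_cancel (A B x : mon) : mmul A x = mmul B x -> A = B.
Proof.
move=> E; apply/eqP/cmP => i; have := congr1 (fun M : mon => M i) E.
by rewrite !cmM => /addIn.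
Qed.

Definition dvm (x M : mon) : bool := `[< exists M', mmul M' x = M >].
Definition quo (M x : mon) : mon := xget (@mone _) [set M' | mmul M' x = M].

Lemma quoK M x : dvm x M -> mmul (quo M x) x = M.
Proof. by move=> /asboolP[M' E]; rewrite /quo; case: xgetP => [y _ //|/(_ M')]. Qed.

Lemma quo_mul M x : quo (mmul M x) x = M.
Proof. by apply: (@mmul_cancel _ _ x); rewrite quoK //; apply/asboolP; exists M. Qed.

Fixpoint listsof (T : Type) (Ls : seq (seq T)) : seq (seq T) :=
  if Ls is L :: Ls' then [seq x :: s | x <- L, s <- listsof Ls'] else [:: [::]].

Lemma mem_listsof (T : eqType) (Ls : seq (seq T)) s :
  all2 (fun x L => x \in L) s Ls -> s \in listsof Ls.
Proof.
elim: Ls s => [|L Ls IH] [|x s] //= /andP[xL /IH sL].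
by apply/allpairsPdep; exists x, s.
Qed.

Section Enumeration.
Variables m n : nat.
Hypotheses (m_gt0 : (0 < m)%N) (n_gt0 : (0 < n)%N) (co_mn : coprime m n).
Local Notation cPF := (cPF m n).
Implicit Types (t : seq cPF) (M X : mon).

Definition rows t := [seq rowp y t | y <- iota 0 n].

Lemma rows_inj : injective rows.
Proof.
move=> t t' E; apply: rowp_inj => // y yn.
have := congr1 (nth [::] ^~ y) E.
by rewrite !(nth_map 0%N) ?size_iota // nth_iota.
Qed.

(** If the skeleton of a tuple divides M, its points are taken from the rows of M; as its rows
    determine it, the list is finite and [xget] recovers it. *)
Definition tuples k M : seq (seq cPF) :=
  undup [seq t <- [seq xget [::] [set t | rows t = g]
      | g <- listsof [seq listsof (nseq k (rowX m n M y)) | y <- iota 0 n]]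
    | (size t == k) && dvm (skel t) M].

Lemma mem_tuples k M t : (t \in tuples k M) = (size t == k) && dvm (skel t) M.
Proof.
rewrite mem_undup mem_filter; case: (boolP (_ && dvm _ _)) => //= /andP[/eqP sk /asboolP[M' E]].
apply/mapP; exists (rows t).
  apply: mem_listsof; rewrite all2E !size_map eqxx zip_map; apply/allP => _ /mapP[y + ->].
  rewrite mem_iota /= => yn; apply: mem_listsof.
  rewrite all2E size_rowp size_nseq sk eqxx /=; apply/allP => -[v L] /= vL.
  have /(nthP (v, L))[i] := vL.
  rewrite size_zip size_rowp size_nseq sk minnn => ik; rewrite nth_zip ?size_rowp ?size_nseq //.
  rewrite nth_nseq ik => -[vE <-].
  have vin : v \in rowp y t by rewrite -vE mem_nth // size_rowp sk.
  have [vm _] := rowp_mem m_gt0 n_gt0 yn vin.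
  rewrite mem_rowX // vm eqxx -E cmM skel_count // addn_eq0 negb_and orbC.
  by rewrite -lt0n -has_count has_pred1 vin.
case: xgetP => [u _ /= E'|/(_ t) /= /(_ erefl) //].
exact/rows_inj/esym.
Qed.

Lemma uniq_tuples k M : uniq (tuples k M).
Proof. exact: undup_uniq. Qed.

Lemma tuples0 M : tuples 0 M = [:: [::]].
Proof.
apply: perm_small_eq => //; apply: uniq_perm; rewrite ?uniq_tuples // => t.
rewrite mem_tuples inE size_eq0; case: eqP => //= ->.
by apply/asboolP; exists M; rewrite /skel big_nil mulm1.
Qed.

Variable R : realType.
Local Notation K := (Cqt R).
Local Notation q := (qvar R).
Local Notation V := (V R m n).
Implicit Types (F : V) (P : pred (seq cPF)).

Definition opsum P a (F : mon -> K^o) M : K :=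
  \sum_(t <- tuples a M | P t) q ^ hexp (quo M (skel t)) t * F (quo M (skel t)).

Lemma hop_opsum a (A : set (a.-tuple cPF)) P F M :
  (forall t : a.-tuple cPF, A t <-> P t) -> hop A F M = opsum P a F M.
Proof.
move=> AP; rewrite /= /hop_fun /opsum.
pose tt : seq (a.-tuple cPF) := pmap insub [seq t <- tuples a M | P t].
have ttE : map val tt = [seq t <- tuples a M | P t].
  rewrite /tt pmap_filter; last exact: insubK.
  apply/all_filterP/allP => t; rewrite mem_filter mem_tuples => /and3P[_ st _].
  by rewrite isSome_insub.
have utt : uniq tt by apply: pmap_sub_uniq; rewrite filter_uniq // uniq_tuples.
pose r : seq (mon * a.-tuple cPF) := [seq (quo M (skel (val t)), t) | t : a.-tuple cPF <- tt].
have ur : uniq r by rewrite map_inj_uniq // => t t' [].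
transitivity (\sum_(p <- r) q ^ hexp p.1 p.2 * F p.1).
  rewrite [RHS]fsbig_seq //; apply: eq_fsbigl; apply/seteqP; split=> -[M' t] /=.
    case=> At E; apply/mapP; exists t.
      rewrite mem_pmap_sub mem_filter mem_tuples size_tuple eqxx /=.
      by apply/andP; split; [apply/AP|apply/asboolP; exists M'].
    by rewrite -E quo_mul.
  move=> /mapP[u]; rewrite mem_pmap_sub mem_filter mem_tuples => /and3P[Pu _ du] [-> ->].
  by split; [apply/AP|rewrite quoK].
by rewrite big_map -[RHS]big_filter -ttE big_map.
Qed.

End Enumeration.

Lemma big_group (T : Type) (S : eqType) (V : zmodType) (r : seq T) (vals : seq S) (g : T ->
    S) (F : T -> V) :
  uniq vals -> all (fun p => g p \in vals) r ->
  \sum_(p <- r) F p = \sum_(x <- vals) \sum_(p <- r | g p == x) F p.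
Proof.
move=> uv; elim: r => [|p r IH] /=; first by rewrite big_nil big1 // => x _; rewrite big_nil.
move=> /andP[gp /IH E]; rewrite big_cons E.
under [RHS]eq_bigr do rewrite big_cons.
rewrite [RHS](bigD1_seq (g p)) //= eqxx -addrA [in LHS](bigD1_seq (g p)) //=; congr (_ + (_ + _)).
by apply: eq_bigr => x; rewrite eq_sym => /negPf->.
Qed.

Lemma qvar_neq0 (R : realType) : qvar R != 0.
Proof. by rewrite /qvar tofrac_eq0 polyC_eq0 polyX_eq0. Qed.

Section Composition.
Variables (R : realType) (m n : nat).
Hypotheses (m_gt0 : (0 < m)%N) (n_gt0 : (0 < n)%N) (co_mn : coprime m n).
Local Notation K := (Cqt R).
Local Notation q := (qvar R).
Local Notation V := (V R m n).
Local Notation cPF := (cPF m n).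
Implicit Types (F : V) (P : pred (seq cPF)) (t : seq cPF) (M X : mon).

Definition pskel (p : seq cPF * seq cPF) : mon := mmul (skel p.1) (skel p.2).

(* The pairs of chains that contribute to a composite of two operators; the
   first entry belongs to the operator that is applied first. *)
Definition pairs b a P P' X : seq (seq cPF * seq cPF) :=
  [seq p <- [seq (t', t) | t' <- tuples m n b X, t <- tuples m n a X]
     | [&& P p.1, P' p.2 & pskel p == X]].

Lemma mem_pairs b a P P' X p : (p \in pairs b a P P' X) =
  [&& size p.1 == b, size p.2 == a, P p.1, P' p.2 & pskel p == X].
Proof.
rewrite mem_filter; apply/andP/and5P =>
    [[/and3P[h1 h2 h3] /allpairsP[[u v] /= [uin vin E]]]|[s1 s2 h1 h2 h3]].
  rewrite E /= in h1 h2 h3 *; move: uin vin; rewrite !mem_tuples //.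
  by move=> /andP[-> _] /andP[-> _].
split; first exact/and3P.
apply/allpairsP; exists p; split; last by case: p {s1 s2 h1 h2 h3}.
  rewrite mem_tuples // s1; apply/asboolP; exists (skel p.2).
  by rewrite mulmC; apply/eqP.
by rewrite mem_tuples // s2; apply/asboolP; exists (skel p.1); apply/eqP.
Qed.

Lemma uniq_pairs b a P P' X : uniq (pairs b a P P' X).
Proof.
rewrite filter_uniq //; apply: allpairs_uniq; rewrite ?uniq_tuples //.
by move=> [u v] [u' v'] _ _ [-> ->].
Qed.

Definition pairsum b a P P' X : K := \sum_(p <- pairs b a P P' X) q ^ (- crossinv p.1 p.2).

Definition pairfactor F M X : K :=
  q ^ crosswt (tuple_of_mon m n (quo M X)) (tuple_of_mon m n X) * F (quo M X).

Lemma tuple_of_monK t : skel (tuple_of_mon m n (skel t)) = skel t.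
Proof. by rewrite /tuple_of_mon; case: xgetP => [u _ /= ->//|/(_ t) /(_ erefl)]. Qed.

(** Pairs are grouped by their skeleton X. By [hexp_comp], what multiplies [pairsum] depends on F, M
    and X only, so that relations between composites can be checked for each X. The list [vals] is
    left free in order that several composites share it. *)
Lemma opsum_comp b a P P' (F G : V) M (vals : seq mon) :
  (forall t, P t -> chain t) -> (forall t, P' t -> chain t) ->
  (forall M', G M' = opsum P b F M') ->
  uniq vals -> all (fun X => dvm X M) vals ->
  (forall p, size p.1 = b -> size p.2 = a -> P p.1 -> P' p.2 -> dvm (pskel p) M ->
      pskel p \in vals) ->
  opsum P' a G M = \sum_(X <- vals) pairfactor F M X * pairsum b a P P' X.
Proof.
move=> Pch P'ch GE uv /allP vM vin.
pose Q := [seq (t', t) | t <- [seq t <- tuples m n a M | P' t],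
                         t' <- [seq t' <- tuples m n b (quo M (skel t)) | P t']].
have memQ p : (p \in Q) = [&& size p.1 == b, size p.2 == a, P p.1, P' p.2 & dvm (pskel p) M].
  apply/allpairsPdep/and5P => [[t [t' [+ + ->]]]|[/eqP s1 /eqP s2 h1 h2 /asboolP[M2 E]]].
    rewrite !mem_filter !mem_tuples //= => /and3P[-> -> d] /and3P[-> -> d'].
    split=> //; apply/asboolP; exists (quo (quo M (skel t)) (skel t')).
    by rewrite /pskel /= mulmA !quoK.
  have E2 : M = mmul (mmul M2 (skel p.1)) (skel p.2) by rewrite -E mulmA.
  exists p.2, p.1; rewrite !mem_filter !mem_tuples // h1 h2 s1 s2 !eqxx /=.
  split; [|  |by case: (p)].
    by apply/asboolP; exists (mmul M2 (skel p.1)).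
  by apply/asboolP; exists M2; rewrite E2 quo_mul.
have uQ : uniq Q.
  apply: allpairs_uniq_dep => [|t _|[t t'] [u u'] _ _ /= [-> ->] //].
    by rewrite filter_uniq // uniq_tuples.
  by rewrite filter_uniq // uniq_tuples.
transitivity (\sum_(p <- Q) pairfactor F M (pskel p) * q ^ (- crossinv p.1 p.2)).
  rewrite /opsum /Q -big_filter [RHS]big_allpairs_dep /=. apply: eq_big_seq => t.
  rewrite mem_filter mem_tuples // => /and3P[Pt st dt].
  rewrite GE /opsum -[in LHS]big_filter mulr_sumr; apply: eq_big_seq => t'.
  rewrite mem_filter mem_tuples // => /and3P[Pt' st' dt'] /=.
  set M2 := quo (quo M (skel t)) (skel t').
  have E1 : quo M (skel t) = mmul M2 (skel t') by rewrite /M2 quoK.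
  have E2 : quo M (pskel (t', t)) = M2.
    by rewrite -[M in LHS](quoK dt) E1 -mulmA quo_mul.
  (* Where F does not vanish, M2 is the skeleton of a tuple and [hexp_comp] applies. *)
  rewrite /pairfactor E2 E1; have [->|F0] := eqVneq (F M2) 0; first by rewrite !mulr0 mul0r.
  have /asboolP[r Fr] : coef F \in @inV R m n by case: (F).
  have [tau _ tauE] := Fr M2 F0; rewrite -tauE -skel_cat.
  have := hexp_comp m_gt0 n_gt0 co_mn tau (Pch _ Pt') (P'ch _ Pt).
  rewrite (@crosswt_skel _ _ m_gt0 n_gt0 _ (tuple_of_mon m n (skel tau)) _ (tuple_of_mon m n
      (pskel (t', t)))).
  - move=> E; rewrite mulrA [RHS]mulrAC -!expfzDr ?qvar_neq0 // E //.
  - by rewrite tuple_of_monK.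
  by rewrite /pskel /= -skel_cat tuple_of_monK.
rewrite (big_group (g := pskel) _ uv); last first.
  by apply/allP => p; rewrite memQ => /and5P[/eqP s1 /eqP s2 h1 h2 d]; apply: vin.
apply: eq_big_seq => X Xin; rewrite /pairsum mulr_sumr -big_filter.
rewrite (perm_big (pairs b a P P' X)).
  by apply: eq_big_seq => p; rewrite mem_pairs => /and5P[_ _ _ _ /eqP->].
apply: uniq_perm; rewrite ?uniq_pairs ?filter_uniq // => p.
rewrite mem_filter memQ mem_pairs; case: (pskel p =P X) => [->|_]; last by rewrite !andbF.
by rewrite vM.
Qed.
End Composition.

(** * Relations between sums over pairs of chains *)

Section PairSums.
Variables (R : realType) (m n : nat).
Hypotheses (m_gt0 : (0 < m)%N) (n_gt0 : (0 < n)%N) (co_mn : coprime m n).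
Local Notation q := (qvar R).
Local Notation cPF := (cPF m n).
Implicit Types (P : pred (seq cPF)) (t : seq cPF) (X : mon) (p : seq cPF * seq cPF).

Definition chain_hat t := chain t && (zeros t == 0%N).
Definition chain_bar t := chain t && (zeros t == 1%N).
Definition zerosX X := zeros (tuple_of_mon m n X).

Lemma zeros_pskel p X : pskel p = X -> (zeros p.1 + zeros p.2 = zerosX X)%N.
Proof.
move=> <-; rewrite /zerosX /pskel -skel_cat /zeros -count_cat -rowp_cat.
apply/permP; have /skel_eqP -> // : skel (p.1 ++ p.2) = skel (tuple_of_mon m n (skel (p.1 ++ p.2))).
by rewrite tuple_of_monK.
Qed.

Lemma chain_pair_good p X : chain p.1 -> chain p.2 -> pskel p = X -> goodX n X.
Proof.
move=> c1 c2 E x; rewrite -E cmM => nz.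
have [[y yn [v vin xE]]|no] := pselect (exists2 y, (y < n)%N &
    exists2 v : pnt, v \in rowp y p.1 ++ rowp y p.2 & x = rvar n y v).
  have [vm vpos] : v.1 = m * y %[mod n] /\ (0 < (v.2 : nat))%N.
    by move: vin; rewrite mem_cat => /orP[]; apply: rowp_mem.
  rewrite xE; split=> //=; rewrite -cmM -[mmul _ _]/(pskel p).
  rewrite (pair_count m_gt0 n_gt0 c1 c2 erefl yn vm).
  by do 2 case: (v \in _).
case/negP: nz; rewrite !skel_coef // !big1_seq // => y; rewrite mem_iota /= => yn; apply/eqP;
  rewrite -leqn0 leqNgt -has_count; apply/negP => /hasP[v vin /eqP xE]; apply: no;
  by exists y => //; exists v => //; rewrite mem_cat vin ?orbT.
Qed.

Lemma pairs_eq b a P P' Q Q' X :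
  (forall p, pskel p = X -> P p.1 && P' p.2 = Q p.1 && Q' p.2) ->
  pairs b a P P' X = pairs b a Q Q' X.
Proof.
move=> H; apply: eq_filter => p.
by apply/and3P/and3P => -[h1 h2 /eqP E]; have := H p E; rewrite h1 h2;
  [move=> /esym/andP[]|move=> /andP[]]; split=> //; exact/eqP.
Qed.

Lemma pairs_nil b a P P' X : (forall p, pskel p = X -> P p.1 -> P' p.2 -> False) ->
  pairs b a P P' X = [::].
Proof.
move=> H; case E : (pairs b a P P' X) => [//|p ps].
have : p \in pairs b a P P' X by rewrite E mem_head.
by rewrite mem_pairs // => /and5P[_ _ h1 h2 /eqP/H]; case.
Qed.

Lemma pairsum_gf b a X : goodX n X ->
  pairsum R b a (@chain m n) (@chain m n) X
  = q ^- doubles m n X * halve q (gf _ m n X b a xpredT).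
Proof.
move=> gX; rewrite /pairsum; apply: gfE => //; [exact: qvar_neq0|exact: uniq_pairs|].
move=> p; rewrite mem_pairs //; apply/and5P/asboolP => [[/eqP-> /eqP-> -> -> /eqP]|].
  by split.
by case=> -[-> ->] [-> ->] E _; split=> //; apply/eqP.
Qed.

Lemma pairsum_sym b a X : pairsum R b a (@chain m n) (@chain m n) X
  = pairsum R a b (@chain m n) (@chain m n) X.
Proof.
have [gX|bX] := pselect (goodX n X); first by rewrite !pairsum_gf // (gf_sym (qvar_neq0 R)).
by rewrite /pairsum !pairs_nil // => p E c1 c2; apply: bX; exact: chain_pair_good c1 c2 E.
Qed.

(** X determines the number of points of content 0, so that the condition on the pairs is either
    automatic or impossible. *)
Lemma pairsum_hat_sym b a X : pairsum R b a chain_hat chain_hat X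
  = pairsum R a b chain_hat chain_hat X.
Proof.
have [z0|z0] := eqVneq (zerosX X) 0%N.
  suff E b' a' : pairs b' a' chain_hat chain_hat X = pairs b' a' (@chain m n) (@chain m n) X.
    by have := pairsum_sym b a X; rewrite /pairsum !E.
  apply: pairs_eq => p /zeros_pskel; rewrite z0 /chain_hat => /eqP.
  by rewrite addn_eq0 => /andP[-> ->]; rewrite !andbT.
rewrite /pairsum !pairs_nil // => p /zeros_pskel E /andP[_ /eqP z1] /andP[_ /eqP z2];
  by case/eqP: z0; rewrite -E z1 z2.
Qed.

(** A chain has at most one point of content 0, so that both chains have one exactly when X has
    two. *)
Lemma pairsum_bar_sym b a X : pairsum R b a chain_bar chain_bar X
  = pairsum R a b chain_bar chain_bar X.
Proof.
have [z0|z0] := eqVneq (zerosX X) 2%N.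
  suff E b' a' : pairs b' a' chain_bar chain_bar X = pairs b' a' (@chain m n) (@chain m n) X.
    by have := pairsum_sym b a X; rewrite /pairsum !E.
  apply: pairs_eq => p /zeros_pskel; rewrite z0 /chain_bar => E.
  case: (boolP (chain p.1)) => //= c1; case: (boolP (chain p.2)) => /= c2; rewrite ?andbF ?andbT //.
  have := zeros_chain m_gt0 n_gt0 co_mn c1; have := zeros_chain m_gt0 n_gt0 co_mn c2.
  by move: E; case: (zeros p.1) => [|[|?]]; case: (zeros p.2) => [|[|?]].
rewrite /pairsum !pairs_nil // => p /zeros_pskel E /andP[_ /eqP z1] /andP[_ /eqP z2];
  by case/eqP: z0; rewrite -E z1 z2.
Qed.

(* When X has a single point of content 0, this point comes first among the
   singles of row 0, so that the first letter of the colouring tells which of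
   the two chains passes through the origin. *)
Lemma sing0_head p X : chain p.1 -> chain p.2 -> pskel p = X -> zerosX X = 1%N ->
  exists h r, sing m n X 0 = h :: r /\
   forall p', chain p'.1 -> chain p'.2 -> pskel p' = X -> zeros p'.1 = (h \in rowp 0 p'.1).
Proof.
move=> c1 c2 E z1.
have cnt p' v : chain p'.1 -> chain p'.2 -> pskel p' = X -> v.1 = 0%N ->
    ((v \in rowp 0 p'.1) <= zeros p'.1)%N /\ ((v \in rowp 0 p'.2) <= zeros p'.2)%N.
  move=> d1 d2 E' v0.
  have H t : ((v \in rowp 0 t) <= zeros t)%N.
    case: (boolP (v \in _)) => // vin; rewrite /zeros -has_count.
    by apply/hasP; exists v; rewrite // v0.
  by split.
have [v v0 vs] : exists2 v : pnt, v.1 = 0%N & v \in sing m n X 0.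
  have : has (fun v : pnt => v.1 == 0%N) (rowp 0 p.1 ++ rowp 0 p.2).
    by rewrite has_count count_cat -!/(zeros _) (zeros_pskel E) z1.
  case/hasP => v vin /eqP v0; exists v => //.
  have vm : v.1 = m * 0 %[mod n] by rewrite v0 muln0.
  have Xv := pair_count m_gt0 n_gt0 c1 c2 E n_gt0 vm.
  have [le1 le2] := cnt p v c1 c2 E v0; have zz := zeros_pskel E.
  rewrite mem_filter mem_rowX // vm eqxx /dbl Xv /=.
  by move: vin le1 le2; rewrite mem_cat; do 2 case: (v \in _) => //=; lia.
case sE : (sing m n X 0) vs => [|h r] // vs.
have h0 : h.1 = 0%N.
  have : sorted <%O (h :: r) by rewrite -sE; apply: lt_sorted_filter; apply: rowX_sorted.
  move=> /(order_path_min lt_trans)/allP hr; move: vs; rewrite inE => /orP[/eqP<-//|/hr].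
  by rewrite lt_pnt v0 /= => /andP[/eqP].
exists h, r; split=> // p' d1 d2 E'.
have hs : h \in sing m n X 0 by rewrite sE mem_head.
move: hs; rewrite mem_filter mem_rowX // => /and3P[_ /eqP hm Xh].
have := pair_count m_gt0 n_gt0 d1 d2 E' n_gt0 hm.
have [le1 le2] := cnt p' h d1 d2 E' h0; have zz := zeros_pskel E'.
move: Xh le1 le2; do 2 case: (h \in _) => //=; lia.
Qed.

(** The bar-hat pairs are the colourings whose first letter is true, and the hat-bar pairs those
    whose first letter is false. If X does not have exactly one point of content 0, all four sums
    are empty. *)
Lemma pairsum_exchange a b X :
  q * pairsum R a.+1 b chain_bar chain_hat X + pairsum R a b.+1 chain_hat chain_bar X
  = pairsum R b a.+1 chain_hat chain_bar X + q * pairsum R b.+1 a chain_bar chain_hat X.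
Proof.
have [z1|z1] := eqVneq (zerosX X) 1%N; last first.
  rewrite /pairsum !pairs_nil ?big_nil ?mulr0 // =>
      p /zeros_pskel E /andP[_ /eqP w1] /andP[_ /eqP w2];
    by case/eqP: z1; rewrite -E w1 w2.
have [[p [c1 c2 E]]|no] := pselect (exists p, [/\ chain p.1, chain p.2 & pskel p = X]); last first.
  by rewrite /pairsum !pairs_nil ?big_nil ?mulr0 // => p E /andP[c1 _] /andP[c2 _];
    apply: no; exists p.
have gX := chain_pair_good c1 c2 E.
have [h [r [sE hE]]] := sing0_head c1 c2 E z1.
have wE (p' : seq cPF * seq cPF) : head false (word_of X 0 p'.1) = (h \in rowp 0 p'.1).
  by rewrite /word_of sE.
have gT a' b' : pairsum R a' b' chain_bar chain_hat X
    = q ^- doubles m n X * halve q (gf _ m n X a' b' (fun u => head false u)).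
  rewrite /pairsum; apply: gfE => //; [exact: qvar_neq0|exact: uniq_pairs|].
  move=> p'; rewrite mem_pairs //; apply/and5P/asboolP.
    move=> [/eqP-> /eqP-> /andP[d1 /eqP w1] /andP[d2 /eqP w2] /eqP E']; split=> //.
    by rewrite wE; move: w1; rewrite (hE p') //; case: (_ \in _).
  case=> -[d1 ->] [d2 ->] E'; rewrite wE => hin; rewrite !eqxx /chain_bar /chain_hat d1 d2
      (hE p') // hin.
  have := zeros_pskel E'; rewrite (hE p') // hin z1 => /eqP; rewrite -[1%N]addn0 eqn_add2l =>
      /eqP->.
  by split=> //; apply/eqP.
have gF a' b' : pairsum R a' b' chain_hat chain_bar X
    = q ^- doubles m n X * halve q (gf _ m n X a' b' (fun u => ~~ head false u)).
  rewrite /pairsum; apply: gfE => //; [exact: qvar_neq0|exact: uniq_pairs|].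
  move=> p'; rewrite mem_pairs //; apply/and5P/asboolP.
    move=> [/eqP-> /eqP-> /andP[d1 /eqP w1] /andP[d2 /eqP w2] /eqP E']; split=> //.
    by rewrite wE; move: w1; rewrite (hE p') //; case: (_ \in _).
  case=> -[d1 ->] [d2 ->] E'; rewrite wE => hin; rewrite !eqxx /chain_bar /chain_hat d1 d2
      (hE p') // (negPf hin).
  have := zeros_pskel E'; rewrite (hE p') // (negPf hin) z1 add0n => ->.
  by split=> //; apply/eqP.
rewrite !gT !gF.
have := gf_sym_head (qvar_neq0 R) m_gt0 n_gt0 a b (congr1 size sE).
move=> /(congr1 ( *%R (q ^- doubles m n X))); rewrite !mulrDr ![_ * (q * _)]mulrCA; exact.
Qed.
End PairSums.

Lemma sum_exchange (K : comNzRingType) (q : K) (I : Type) (r : seq I) (f p1 p2 p3 p4 : I -> K) :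
  (forall i, q * p1 i + p2 i = p3 i + q * p4 i) ->
  q * (\sum_(i <- r) f i * p1 i - \sum_(i <- r) f i * p4 i)
  = \sum_(i <- r) f i * p3 i - \sum_(i <- r) f i * p2 i.
Proof.
move=> H; rewrite -!sumrB mulr_sumr; apply: eq_bigr => i _.
have -> : p3 i = q * p1 i + p2 i - q * p4 i by rewrite H addrK.
ring.
Qed.

(** * Relations between the operators *)

Section Operators.
Variables (R : realType) (m n : nat).
Hypotheses (m_gt0 : (0 < m)%N) (n_gt0 : (0 < n)%N) (co_mn : coprime m n).
Local Notation q := (qvar R).
Local Notation V := (V R m n).
Local Notation cPF := (cPF m n).
Local Notation chain := (@chain m n).
Implicit Types (F : V) (M X : mon).

Lemma opsum0 (P : pred (seq cPF)) F M : opsum P 0 F M = if P [::] then F M else 0.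
Proof.
rewrite /opsum tuples0 // big_cons big_nil addr0; case: ifP => // _.
have -> : quo M (skel ([::] : seq cPF)) = M.
  by rewrite -[M in LHS](@mulm1 mon) /skel big_nil quo_mul.
by rewrite /hexp cats0 subrr expr0z mul1r.
Qed.

Lemma frakhE (a : nat) F M : frakh R m n a F M = opsum chain a F M.
Proof. by case: a => [|a]; [rewrite opsum0 | apply: hop_opsum]. Qed.

Lemma frakh_hatE (a : nat) F M : frakh_hat R m n a F M = opsum (@chain_hat m n) a F M.
Proof.
case: a => [|a]; first by rewrite opsum0.
apply: hop_opsum => // t; rewrite HhatE // /chain_hat; split=> [[-> ->] //|/andP[-> /eqP] //].
Qed.

Lemma frakh_barE (a : nat) F M : frakh_bar R m n a F M = opsum (@chain_bar m n) a F M.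
Proof.
case: a => [|a]; first by rewrite opsum0.
apply: hop_opsum => // t; rewrite HbarE // /chain_bar; split=> [[-> ->] //|/andP[-> /eqP] //].
Qed.

Definition pairskels b a M : seq mon :=
  [seq pskel p | p <- [seq (t', t) | t' <- tuples m n b M, t <- tuples m n a M] & dvm (pskel p) M].

Lemma pairskels_dvm b a M : all (fun X => dvm X M) (pairskels b a M).
Proof. by apply/allP => _ /mapP[p + ->]; rewrite mem_filter => /andP[]. Qed.

Lemma mem_pairskels b a M (p : seq cPF * seq cPF) :
  size p.1 = b -> size p.2 = a -> dvm (pskel p) M -> pskel p \in pairskels b a M.
Proof.
move=> s1 s2 d; apply: map_f; rewrite mem_filter d; case: p s1 s2 d => t' t /= s1 s2 /asboolP[M' E].
apply: allpairs_f; rewrite mem_tuples // ?s1 ?s2 eqxx; apply/asboolP.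
  by exists (mmul M' (skel t)); rewrite -E /pskel /= -mulmA [mmul (skel t) _]mulmC.
by exists (mmul M' (skel t')); rewrite -E /pskel /= mulmA.
Qed.

(** The use of [undup] allows [vals] to be a concatenation of the lists attached to several
    composites. *)
Definition pairsum_comp (P P' : pred (seq cPF)) := forall (vals : seq mon) b a F (G : V) M,
  (forall M', G M' = opsum P b F M') -> all (fun X => dvm X M) vals ->
  {subset pairskels b a M <= vals} ->
  opsum P' a G M = \sum_(X <- undup vals) pairfactor F M X * pairsum R b a P P' X.

Lemma pairsum_compP (P P' : pred (seq cPF)) : (forall t, P t -> chain t) ->
  (forall t, P' t -> chain t) -> pairsum_comp P P'.
Proof.
move=> c c' vals b a F G M GE /allP dv sub; apply: opsum_comp => //.
- exact: undup_uniq.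
- by apply/allP => X; rewrite mem_undup; apply: dv.
by move=> p s1 s2 _ _ d; rewrite mem_undup; apply: sub; apply: mem_pairskels.
Qed.

Lemma chain_hatW t : chain_hat t -> chain t. Proof. by case/andP. Qed.
Lemma chain_barW t : chain_bar t -> chain t. Proof. by case/andP. Qed.

Lemma opsum_commute (P : pred (seq cPF)) (op : nat -> V -> V) :
  (forall t, P t -> chain t) -> (forall a F M, op a F M = opsum P a F M) ->
  (forall b a X, pairsum R b a P P X = pairsum R a b P P X) ->
  forall a b, op a \o op b = op b \o op a.
Proof.
move=> Pc opE sym a b; apply/funext => F; apply: val_inj; apply/funext => M /=.
have comp := pairsum_compP Pc Pc.
pose vals := pairskels b a M ++ pairskels a b M.
have dv : all (fun X => dvm X M) vals by rewrite all_cat !pairskels_dvm.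
rewrite !opE (comp vals b a F) // ?(comp vals a b F) //.
- by apply: eq_bigr => X _; rewrite sym.
- by move=> X; rewrite mem_cat orbC => ->.
- by move=> X; rewrite mem_cat => ->.
Qed.

Lemma opsum_zero (P : pred (seq cPF)) a M : opsum P a (coef (0 : V)) M = 0.
Proof. by rewrite /opsum big1 // => t _; rewrite [coef 0 _]raddf0 mulr0. Qed.

Section IntegerIndex.
Variables (P : pred (seq cPF)) (op : int -> V -> V).
Hypotheses (Pc : forall t, P t -> chain t)
  (opE : forall (a : nat) F M, op a F M = opsum P a F M) (opN : forall a, op (Negz a) = 0).

Lemma op_zero (a : int) : op a 0 = 0.
Proof.
case: a => a; last by rewrite opN.
by apply: val_inj; apply/funext => M; rewrite /= opE opsum_zero.
Qed.

Lemma op_commute (a b : int) : (forall b a X, pairsum R b a P P X = pairsum R a b P P X) ->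
  op a \o op b = op b \o op a.
Proof.
move=> sym; case: a b => a [b|b].
- exact: (opsum_commute Pc opE sym).
- by rewrite opN; apply/funext => F /=; rewrite op_zero.
- by rewrite opN; apply/funext => F /=; rewrite op_zero.
- by rewrite !opN.
Qed.
End IntegerIndex.

(** Here a stands for the index a - 1 of the final relation, which keeps all indices natural. *)
Lemma hat_bar_exchange (a b : nat) (h := frakh_hat R m n) (g := frakh_bar R m n) :
  q *: ((h b \o g a.+1) - (h a \o g b.+1)) = (g a.+1 \o h b) - (g b.+1 \o h a).
Proof.
apply/funext => F; apply: val_inj; apply/funext => M.
rewrite [LHS]/(q * (h b (g a.+1 F) M - h a (g b.+1 F) M)).
rewrite [RHS]/(g a.+1 (h b F) M - g b.+1 (h a F) M).
pose vals := pairskels a.+1 b M ++ pairskels b.+1 a M ++ pairskels b a.+1 M ++ pairskels a b.+1 M.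
have dv : all (fun X => dvm X M) vals by rewrite !all_cat !pairskels_dvm.
have compbh := pairsum_compP chain_barW chain_hatW.
have comphb := pairsum_compP chain_hatW chain_barW.
rewrite !frakh_hatE !frakh_barE.
rewrite (compbh vals a.+1 b F) //; first last.
- by move=> X Xin; rewrite !mem_cat Xin.
- by move=> M'; apply: frakh_barE.
rewrite (compbh vals b.+1 a F) //; first last.
- by move=> X Xin; rewrite !mem_cat Xin !orbT.
- by move=> M'; apply: frakh_barE.
rewrite (comphb vals b a.+1 F) //; first last.
- by move=> X Xin; rewrite !mem_cat Xin !orbT.
- by move=> M'; apply: frakh_hatE.
rewrite (comphb vals a b.+1 F) //; first last.
- by move=> X Xin; rewrite !mem_cat Xin !orbT.
- by move=> M'; apply: frakh_hatE.
apply: sum_exchange => X.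
exact: pairsum_exchange.
Qed.
End Operators.

Theorem mainTheorem2 (R : realType) (m n : nat) (m_gt0 : (0 < m)%N)
    (n_gt0 : (0 < n)%N) (coprime_mn : coprime m n) (a b : int) :
  let h := frakh R m n in
  let hhat := frakh_hat R m n in
  let hbar := frakh_bar R m n in
  [/\ h a \o h b = h b \o h a,
      hhat a \o hhat b = hhat b \o hhat a,
      hbar a \o hbar b = hbar b \o hbar a
    & qvar R *: ((hhat b \o hbar a) - (hhat (a - 1) \o hbar (b + 1)))
      = (hbar a \o hhat b) - (hbar (b + 1) \o hhat (a - 1))].
Proof.
move=> h hhat hbar.
have zhat c : hhat c 0 = 0.
  by apply: op_zero => [a' F M|//]; apply: frakh_hatE.
have zbar c : hbar c 0 = 0.
  by apply: op_zero => [a' F M|//]; apply: frakh_barE.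
split.
- apply: (@op_commute _ _ _ m_gt0 n_gt0 coprime_mn (@chain m n)) => // [a' F M|b' a' X].
    exact: frakhE.
  exact: pairsum_sym.
- apply: (op_commute m_gt0 n_gt0 coprime_mn (@chain_hatW m n)) => // [a' F M|b' a' X].
    exact: frakh_hatE.
  exact: pairsum_hat_sym.
- apply: (op_commute m_gt0 n_gt0 coprime_mn (@chain_barW m n)) => // [a' F M|b' a' X].
    exact: frakh_barE.
  exact: pairsum_bar_sym.
have compr0 (f : V R m n -> V R m n) : f 0 = 0 -> f \o 0 = 0.
  by move=> f0; apply/funext => F /=; rewrite f0.
have comp0r (f : V R m n -> V R m n) : 0 \o f = 0 by [].
(* This settles a <= 0: the bar operator is zero also at index 0, and a - 1 is negative. *)
have zero_case : hbar a = 0 -> hhat (a - 1) = 0 ->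
   qvar R *: ((hhat b \o hbar a) - (hhat (a - 1) \o hbar (b + 1)))
      = (hbar a \o hhat b) - (hbar (b + 1) \o hhat (a - 1)).
  by move=> -> ->; rewrite !comp0r !compr0 // subr0 scaler0.
case: a zero_case => [[|a]|a] zero_case; try exact: zero_case.
have -> : Posz a.+1 - 1 = a by rewrite intS addrC addKr.
clear zero_case.
case: b => [b|b].
  have -> : Posz b + 1 = b.+1 by rewrite intS addrC.
  exact: hat_bar_exchange.
(* A negative index plus 1 may reach 0, where the bar operator still vanishes. *)
have -> : hbar (Negz b + 1) = 0 by case: b.
rewrite [hhat (Negz b)](_ : _ = 0) // !comp0r !compr0 // subr0 scaler0 //.
Qed.
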